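(* Assume that the following conditions (A1)–(A3) are satisfied: (A1) for every $t\ge0$, the set $F_t^{-1}(\xi)=\{\zeta\in\mathbb{R}^p:F_t(\zeta)=\xi\}$ is nonempty for all $\xi\in{\rm im}\,(C,D_{\rm e})$; (A2) $F_t$ is radially unbounded, locally uniformly in $t$; (A3) for every $t\ge0$ and every $\xi\in{\rm im}\,(C,D_{\rm e})$, the set $f(t,F_t^{-1}(\xi))=\{f(t,\zeta):\zeta\in F_t^{-1}(\xi)\}$ is convex. Assume further that, for all compact sets $K\subset\mathbb{R}^p$, there exists $\varphi\in L^1_{\rm loc}(\mathbb{R}_+,\mathbb{R}_+)$ such that $\sup_{\xi\in K}\|f(t,\xi)\|\le\varphi(t)$ for all $t\ge0$. Let $v\in L^\infty_{\rm loc}(\mathbb{R}_+,\mathbb{R}^{m_{\rm e}})$, $t_0\ge0$ and $x^0\in\mathbb{R}^n$. Then the following statements hold. (1) There exists $(v,x,y)\in\tilde{\mathcal B}(S^f,t_0)$ such that $x(t_0)=x^0$. (2) If $(v,x,y)\in\tilde{\mathcal B}(S^f,t_0)$ has a bounded maximal interval of definition $[t_0,\tau)$, where $t_0<\tau<\infty$, then $\int_{t_0}^\tau\|Bf(t,y(t))\|\,dt=\infty$, $y\notin L^\infty([t_0,\tau),\mathbb{R}^p)$ and $\|x(t)\|\to\infty$ as $t\uparrow\tau$. In particular, the system (L) has the blow-up property.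
   Context: Setting. $\mathbb{R}_+=[0,\infty)$; norms on $\mathbb{R}^k$ are Euclidean and matrix norms are the induced operator norms. Let $n,m,m_{\rm e},p$ be positive integers, $A\in\mathbb{R}^{n\times n}$, $B\in\mathbb{R}^{n\times m}$, $B_{\rm e}\in\mathbb{R}^{n\times m_{\rm e}}$, $C\in\mathbb{R}^{p\times n}$, $D\in\mathbb{R}^{p\times m}$, $D_{\rm e}\in\mathbb{R}^{p\times m_{\rm e}}$, and let $f:\mathbb{R}_+\times\mathbb{R}^p\to\mathbb{R}^m$ be a Caratheodory function, i.e. $f(t,\cdot)$ is continuous for every $t\ge0$ and $f(\cdot,\xi)$ is measurable for every $\xi\in\mathbb{R}^p$. The Lur'e system $S^f$, also called (L), is $$\dot x(t)=Ax(t)+Bf(t,y(t))+B_{\rm e}v(t),\qquad y(t)=Cx(t)+Df(t,y(t))+D_{\rm e}v(t).$$ Write $(f\circ y)(t):=f(t,y(t))$ and $F_t(\xi):=F(t,\xi):=\xi-Df(t,\xi)$ for $t\ge0$, $\xi\in\mathbb{R}^p$. ${\rm im}\,(C,D_{\rm e})\subset\mathbb{R}^p$ is the image of the block matrix $(C,D_{\rm e})\in\mathbb{R}^{p\times(n+m_{\rm e})}$. $F_t$ need not be invertible; $F_t^{-1}(\xi)$ is the fibre of $\xi$. Trajectories. For $0\le t_0<\tau\le\infty$, a pre-trajectory of (L) on $[t_0,\tau)$ is a triple $(v,x,y)\in L^\infty_{\rm loc}(\mathbb{R}_+,\mathbb{R}^{m_{\rm e}})\times W^{1,1}_{\rm loc}([t_0,\tau),\mathbb{R}^n)\times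 L^1_{\rm loc}([t_0,\tau),\mathbb{R}^p)$ such that $f\circ y\in L^1_{\rm loc}([t_0,\tau),\mathbb{R}^m)$ and both equations of (L) hold for a.e. $t\in[t_0,\tau)$ (''loc'' refers to compact subintervals of $[t_0,\tau)$; elements of $W^{1,1}_{\rm loc}$ are identified with locally absolutely continuous functions). It is maximally defined if there is no pre-trajectory $(v,\tilde x,\tilde y)$ on some $[t_0,\tilde\tau)$ with $\tilde\tau>\tau$ and $(\tilde x,\tilde y)|_{[t_0,\tau)}=(x,y)$. $\tilde{\mathcal B}(S^f,t_0)$ denotes the set of all maximally defined pre-trajectories with initial time $t_0$ (defined on $[t_0,\tau)$ for some $\tau\in(t_0,\infty]$). Blow-up property. (L) has the blow-up property if, for every $t_0\ge 0$ and every $(v,x,y)\in\tilde{\mathcal B}(S^f,t_0)$ with bounded interval of definition $[t_0,\tau)$, $\tau<\infty$, one has $\limsup_{t\uparrow\tau}\|x(t)\|+\int_{t_0}^\tau(\|y(s)\|+\|f(s,y(s))\|)\,ds=\infty$. Radial unboundedness. $F_t$ is radially unbounded, locally uniformly in $t$, if for all $\rho>0$ and all compact $T\subset\mathbb{R}_+$ there exists $\sigma\ge0$ such that $\|F_t(\xi)\|\ge\rho$ for all $t\in T$ and all $\xi$ with $\|\xi\|\ge\sigma$. *)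

(* Defs.v *)
From HB Require Import structures.
From mathcomp Require Import all_boot all_order all_algebra.
From mathcomp Require Import all_classical all_reals all_analysis.

Set Implicit Arguments.
Unset Strict Implicit.
Unset Printing Implicit Defensive.

Import Order.TTheory GRing.Theory Num.Theory.
Import numFieldNormedType.Exports.

Local Open Scope classical_set_scope.
Local Open Scope ring_scope.

(* The norm that the library puts on matrices is the maximum norm; it induces
   the same topology as this one, so [continuous], [compact] and [is_derive]
   on column vectors can be taken from the library. *)
Definition enorm (R : realType) (k : nat) (u : 'cV[R]_k) : R :=
  Num.sqrt (\sum_i u i ord0 ^+ 2).

(* The real line with the Lebesgue measurable sets: the Caratheodory
   sigma-algebra is the completion of the Borel one.  The default measurable
   structure of the library on R is the Borel one, so Lebesgue measurability
   is obtained by typing the domains of functions with [lebR R]. *)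
Notation lebR R := (caratheodory_type ((wlength (@idfun R))^*)%mu).

Notation leb R := (@completed_lebesgue_measure R).

Definition mfun_vec (R : realType) (k : nat) (I : set R) (g : R -> 'cV[R]_k) :=
  forall i, measurable_fun (I : set (lebR R)) (fun t : lebR R => g t i ord0).

Definition L1 (R : realType) (k : nat) (g : R -> 'cV[R]_k) (I : set R) :=
  mfun_vec I g /\ (leb R).-integrable I (fun t => (enorm (g t))%:E).

Definition Linfty (R : realType) (k : nat) (g : R -> 'cV[R]_k) (I : set R) :=
  mfun_vec I g /\
  exists M : R, {ae leb R, forall t, I t -> enorm (g t) <= M}.

(* Finite families of non-overlapping closed intervals [s i, t i] with
   endpoints in I. *)
Definition abs_continuous (R : realType) (k : nat) (g : R -> 'cV[R]_k)
    (I : set R) :=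
  forall eps : R, 0 < eps -> exists2 delta : R, 0 < delta &
    forall (N : nat) (s t : 'I_N -> R),
      (forall i, [/\ I (s i), I (t i) & s i <= t i]) ->
      (forall i j, i != j -> t i <= s j \/ t j <= s i) ->
      \sum_i (t i - s i) < delta ->
      \sum_i enorm (g (t i) - g (s i)) < eps.

Definition on_compacts (R : realType) (P : set R -> Prop) (J : set R) :=
  forall a b : R, `[a, b]%classic `<=` J -> P `[a, b]%classic.

(* [t0, tau) with tau possibly infinite *)
Definition Ico (R : realType) (t0 : R) (tau : \bar R) : set R :=
  [set t | t0 <= t /\ (t%:E < tau)%E].

Definition Rplus (R : realType) : set R := `[0, +oo[%classic.

Definition caratheodory_function (R : realType) (p m : nat)
    (f : R -> 'cV[R]_p -> 'cV[R]_m) :=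
  (forall t, 0 <= t -> continuous (f t)) /\
  (forall xi, mfun_vec (@Rplus R) (f ^~ xi)).

Record lure (R : realType) (n m me p : nat) := Lure {
  lA : 'M[R]_n;
  lB : 'M[R]_(n, m);
  lBe : 'M[R]_(n, me);
  lC : 'M[R]_(p, n);
  lD : 'M[R]_(p, m);
  lDe : 'M[R]_(p, me);
  lf : R -> 'cV[R]_p -> 'cV[R]_m }.

Section lure_system.
Context (R : realType) (n m me p : nat) (S : lure R n m me p).

Definition lF (t : R) (xi : 'cV[R]_p) : 'cV[R]_p := xi - lD S *m lf S t xi.

Definition lfibre (t : R) (xi : 'cV[R]_p) : set 'cV[R]_p :=
  lF t @^-1` [set xi].

Definition im_CDe : set 'cV[R]_p := range (mulmx (row_mx (lC S) (lDe S))).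

Definition radially_unbounded_loc_unif :=
  forall (rho : R) (T : set R), 0 < rho -> compact T -> T `<=` @Rplus R ->
  exists2 sigma : R, 0 <= sigma &
    forall t xi, T t -> sigma <= enorm xi -> rho <= enorm (lF t xi).

(* v, x and y are total functions; only their values on [0, +oo) (for v) and
   on [t0, tau) (for x and y) matter, up to null sets for v and y. *)
Definition pre_trajectory (t0 : R) (tau : \bar R)
    (v : R -> 'cV[R]_me) (x : R -> 'cV[R]_n) (y : R -> 'cV[R]_p) :=
  let J := Ico t0 tau in
  [/\ 0 <= t0 /\ (t0%:E < tau)%E,
      on_compacts (Linfty v) (@Rplus R),
      on_compacts (abs_continuous x) J,
      on_compacts (L1 y) J /\ on_compacts (L1 (fun t => lf S t (y t))) J &
      {ae leb R, forall t, J t ->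
        is_derive (t : R) (1 : R) x
          (lA S *m x t + lB S *m lf S t (y t) + lBe S *m v t) /\
        y t = lC S *m x t + lD S *m lf S t (y t) + lDe S *m v t}].

Definition max_pre_trajectory (t0 : R) (tau : \bar R)
    (v : R -> 'cV[R]_me) (x : R -> 'cV[R]_n) (y : R -> 'cV[R]_p) :=
  pre_trajectory t0 tau v x y /\
  ~ exists tau' x' y',
      [/\ (tau < tau')%E, pre_trajectory t0 tau' v x' y',
          forall t, Ico t0 tau t -> x' t = x t &
          {ae leb R, forall t, Ico t0 tau t -> y' t = y t}].

Definition blow_up_property :=
  forall (t0 tau : R) v x y, max_pre_trajectory t0 tau%:E v x y ->
  (limf_esup (fun t => (enorm (x t))%:E) (tau^'-) +
   \int[leb R]_(s in Ico t0 tau%:E)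
      (enorm (y s) + enorm (lf S s (y s)))%:E)%E = +oo%E.

End lure_system.

(* Main.v *)
Require Import Defs.
From HB Require Import structures.
From mathcomp Require Import all_boot all_order all_algebra.
From mathcomp Require Import all_classical all_reals all_analysis.
From mathcomp Require Import measurable_realfun.
From mathcomp Require Import ring lra.
Import Order.TTheory GRing.Theory Num.Theory.
Import numFieldNormedType.Exports.
Set Implicit Arguments.
Unset Strict Implicit.
Unset Printing Implicit Defensive.
Local Open Scope classical_set_scope.
Local Open Scope ring_scope.

(** The second equation of the system says that the output solves
    F_t(y) = C x + De v.  Substituting its solutions into the first equation
    gives the differential inclusion x' \in V(t, x), where V(t, x) is the set
    of all A x + B f(t, xi) + Be v(t) with F_t(xi) = C x + De v(t).  These sets
    are nonempty by [A1] and convex by [A3]; by [A2] the solutions xi stay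
    bounded when t and x do.  Hence V(t, _) has a closed graph, as f(t, _) is
    continuous, and on bounded sets of states the bound for f dominates V(t, _)
    by an integrable function of t.

    Such an inclusion is solved by Euler polygons
    ([differential_inclusion]).  The polygons have velocities below a fixed
    integrable function, hence converge along a subsequence
    ([equicontinuous_extraction]) to a function x whose increments obey the
    same domination, hence is the integral of a density h
    ([dominated_density], by Radon-Nikodym).  For rational q, q.h is almost
    everywhere at most the upper limit of q.u_k, where the u_k are the
    velocities of the polygons; the limit points of u_k(t) lie in V(t, x(t)),
    which is closed and convex, so h(t) cannot be separated from it
    ([mem_of_limit_points]).

    Measurability enters twice, through [measurable_selection]: to find the
    velocities of the Euler polygons, and to find a measurable output y that
    produces the velocity h.  The result is [local_existence], in which the
    length of the interval of existence depends only on bounds for the initial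
    time and state.

    For the first statement, solutions are prolonged again and again by a step
    that is nearly as long as possible; if the times converged to a point
    beyond which the limit could be continued, the uniform local existence
    would allow steps of a fixed length ([maximal_existence]).

    For the second statement, suppose that the maximal interval [t0, tau) is
    bounded.  A state that stays bounded up to tau has a limit there and is
    continued from it ([integral_solution_extension]), against maximality.  If
    the norm of x did not tend to infinity, x would return to some box
    arbitrarily close to tau; but too little time is then left to move away
    from the box, so x would stay bounded ([state_trapped]).  If B f(t, y) were
    integrable, x would be bounded by the variation of constants, here in the
    form of a contraction estimate on a short final interval
    ([input_not_integrable]); and a bounded y makes f(t, y) integrable. *)

(** * Lebesgue and Borel measurability *)

Notation mu1 R := (@lebesgue_measure R).

Lemma ae_mu1_filter (R : realType) : Filter (almost_everywhere (mu1 R)).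
Proof. exact: (ae_filter_ringOfSetsType (mu1 R)). Qed.

#[local] Hint Extern 0 (Filter (nbhs (almost_everywhere (@lebesgue_measure _)))) =>
  (exact: ae_mu1_filter) : typeclass_instances.
#[local] Hint Extern 0 (Filter (almost_everywhere (@lebesgue_measure _))) =>
  (exact: ae_mu1_filter) : typeclass_instances.

Section completion.
Context {R : realType}.
Implicit Types (P : R -> Prop) (N D : set R) (g h : R -> R).

Lemma borel_caratheodory (A : set R) : measurable A ->
  measurable (A : set (lebR R)).
Proof. by move=> mA; exact: sub_caratheodory. Qed.

Lemma leb_measurable_itv (i : interval R) : measurable ([set` i] : set (lebR R)).
Proof. exact: (borel_caratheodory (measurable_itv i)). Qed.

(** A Lebesgue null set has outer measure zero, and so is covered by a Borel
    null set. *)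
Lemma leb_negligibleE N : (leb R).-negligible N <-> (mu1 R).-negligible N.
Proof.
split=> [[/= A [mA A0 NA]]|[A [mA A0 NA]]].
  apply/negligible_outer_measure/eqP; rewrite eq_le outer_measure_ge0 andbT.
  by rewrite -A0; exact: le_outer_measure.
by exists A; split => //; exact: borel_caratheodory.
Qed.

Lemma ae_lebE P : {ae leb R, forall t, P t} <-> {ae mu1 R, forall t, P t}.
Proof. exact: leb_negligibleE. Qed.

Lemma measurable_fun_borel D g : measurable D ->
  measurable_fun D g -> measurable_fun (D : set (lebR R)) (g : lebR R -> R).
Proof. by move=> mD mg _ Y mY; apply: borel_caratheodory; exact: mg. Qed.

Lemma leb_decomp (A : set R) : measurable (A : set (lebR R)) ->
  exists B N, [/\ measurable B, (mu1 R).-negligible N & A = B `|` N].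
Proof.
move=> mA.
have : (measurable_realfun.completed_algebra_gen (mu1 R)) A.
  by rewrite -g_sigma_completed_algebra_genE completed_caratheodory_measurable.
by move=> -[B mB [N nN <-]]; exists B, N.
Qed.

(** A preimage of a ray is a Borel set up to a null set. Setting [g] to zero
    on the union of the null sets that belong to the rational rays makes the
    preimages of all rays Borel at once. *)
Lemma borel_version D g : measurable D ->
  measurable_fun (D : set (lebR R)) (g : lebR R -> R) ->
  exists2 h, measurable_fun setT h & {ae mu1 R, forall t, D t -> h t = g t}.
Proof.
move=> mD mg.
have mD' := borel_caratheodory mD.
have mg0 : measurable_fun setT ((g \_ D) : lebR R -> R).
  exact/(measurable_restrictT _ _).1.
have /choice[BN' BNP] (q : rat) : exists BN : set R * set R,
    [/\ measurable BN.1, (mu1 R).-negligible BN.2 &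
    (g \_ D) @^-1` `]ratr q, +oo[%classic = BN.1 `|` BN.2].
  have [|B [N ?]] := leb_decomp (A := (g \_ D) @^-1` `]ratr q, +oo[%classic).
    by rewrite -[X in measurable X]setTI; exact: mg0.
  by exists (B, N).
pose B q := (BN' q).1; pose N q := (BN' q).2.
have BN q : [/\ measurable (B q), (mu1 R).-negligible (N q) &
    (g \_ D) @^-1` `]ratr q, +oo[%classic = B q `|` N q] by exact: BNP.
have [N' [mN' N'0 NN']] : (mu1 R).-negligible (\bigcup_n
    (if unpickle n is Some q then N q else set0)).
  apply: negligible_bigcup => k; case: unpickle => [q|].
    by have [] := BN q.
  exact: negligible_set0.
have subN q : N q `<=` N'.
  by move=> t Nt; apply: NN'; exists (pickle q); [exact: I|rewrite pickleK].
exists ((g \_ D) \_ (~` N')).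
  apply: (measurability _ (measurable_realfun.RGenOInfty.measurableE R)).
  move=> _ [_ [x ->] <-]; rewrite setTI.
  have -> : ((g \_ D) \_ (~` N')) @^-1` `]x, +oo[%classic =
      (\bigcup_n (if unpickle n is Some q then
         if x < ratr q then B q `\` N' else set0 else set0))
      `|` (if x < 0 then N' else set0).
    apply/seteqP; split => t /=; rewrite in_itv/= andbT /patch.
      case: ifPn => [/set_mem|/negP] N't xt; last first.
        by right; move: xt => ->; apply: contrapT => nN't; apply: N't; exact: mem_set.
      have [q] := rat_in_itvoo xt; rewrite in_itv/= => /andP[xq qt].
      left; exists (pickle q); [exact: I|rewrite pickleK xq; split => //].
      have [_ _ /seteqP[/(_ t) + _]] := BN q.
      rewrite /= in_itv/= andbT => /(_ qt)[//|/subN//].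
    case=> [[k _]|].
      case: unpickle => // q; case: ifPn => // xq [Bt N't].
      rewrite mem_set//.
      have [_ _ /seteqP[_ /(_ t)]] := BN q.
      by rewrite /= in_itv/= andbT => /(_ (or_introl Bt)); exact: lt_trans.
    case: ifPn => // x0 N't; rewrite memNset//.
  apply: measurableU; last by case: ifPn.
  apply: bigcupT_measurable => k; case: unpickle => // q; case: ifPn => // _.
  by apply: measurableD => //; have [] := BN q.
exists N'; split => // t /=; apply: contra_notP => N't Dt.
by rewrite patchE mem_set// patchE mem_set.
Qed.

Lemma ge0_leb_integralE D h : measurable D -> measurable_fun D h ->
  (forall t, 0 <= h t) ->
  (\int[leb R]_(t in D) (h t)%:E = \int[mu1 R]_(t in D) (h t)%:E)%E.
Proof.
move=> mD mh h0.
pose id' := idfun : lebR R -> measurableTypeR R.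
have mid : measurable_fun [set: lebR R] id'.
  by move=> _ Y mY; rewrite setTI; exact: borel_caratheodory.
transitivity (\int[pushforward (leb R) id']_(t in D) (h t)%:E)%E.
  have mh' : measurable_fun (D : set (measurableTypeR R)) (EFin \o h) by exact/measurable_EFinP.
  by rewrite (ge0_integral_pushforward mid _ _ mh')// => t _; rewrite lee_fin.
exact: (eq_measure_integral (measure_function_pushforward__canonical__measure_function_Measure (leb R) mid)).
Qed.

Lemma leb_integrableE D h : measurable D -> measurable_fun D h ->
  (leb R).-integrable D (EFin \o h) <-> (mu1 R).-integrable D (EFin \o h).
Proof.
move=> mD mh; have mnh : measurable_fun D (fun t => `|h t|).
  exact: measurableT_comp.
have mlh := measurable_fun_borel mD mh.
split=> /integrableP[_ ih]; apply/integrableP; split.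
- exact/measurable_EFinP.
- by move: ih; rewrite /= (ge0_leb_integralE mD mnh).
- exact/measurable_EFinP.
- by move: ih; rewrite /= (ge0_leb_integralE mD mnh).
Qed.

(** Stated for absolute values because it transfers integrability between [g]
    and a Borel version [h]. *)
Lemma leb_integral_abse_ae D g h :
  measurable (D : set (lebR R)) ->
  measurable_fun (D : set (lebR R)) (g : lebR R -> R) ->
  measurable_fun (D : set (lebR R)) (h : lebR R -> R) ->
  {ae mu1 R, forall t, D t -> h t = g t} ->
  (\int[leb R]_(t in D) `|(g t)%:E| = \int[leb R]_(t in D) `|(h t)%:E|)%E.
Proof.
move=> mD mg mh hg; apply: ae_eq_integral.
- exact: mD.
- by apply: measurableT_comp; [exact: abse_measurable|exact/measurable_EFinP].
- by apply: measurableT_comp; [exact: abse_measurable|exact/measurable_EFinP].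
- by apply/ae_lebE; apply: filterS hg => t /[swap] Dt /(_ Dt) /= ->.
Qed.

Lemma integrable_borel_version D g : measurable D ->
  (leb R).-integrable D (EFin \o g) ->
  exists2 h, (mu1 R).-integrable setT (EFin \o h) &
    {ae mu1 R, forall t, D t -> h t = g t}.
Proof.
move=> mD ig.
have mg : measurable_fun (D : set (lebR R)) (g : lebR R -> R).
  by apply/measurable_EFinP; case/integrableP: ig.
have [h mh hg] := borel_version mD mg.
have mDh : measurable_fun D h by exact: measurable_funTS.
exists (h \_ D); last first.
  by apply: filterS hg => t /[swap] Dt /(_ Dt) <-; rewrite patchE mem_set.
have mDR : measurable (D : set (measurableTypeR R)) := mD.
rewrite -restrict_EFin; apply/(integrable_mkcond _ mDR).1.
apply/(leb_integrableE mD mDh).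
have mD' := borel_caratheodory mD.
apply/integrableP; split.
  exact/measurable_EFinP/measurable_fun_borel.
case/integrableP : ig => _.
by rewrite /= (leb_integral_abse_ae mD' mg (measurable_fun_borel mD mDh) hg).
Qed.

Lemma ae_eq_leb_measurable D g h : measurable D -> measurable_fun D h ->
  {ae mu1 R, forall t, D t -> h t = g t} ->
  measurable_fun (D : set (lebR R)) (g : lebR R -> R).
Proof.
move=> mD mh hg; apply/measurable_EFinP.
apply: (ae_measurable_fun completed_lebesgue_measure_is_complete
  (f := EFin \o h)); last exact/measurable_EFinP/measurable_fun_borel.
by apply/ae_lebE; apply: filterS hg => t /[swap] Dt /(_ Dt) /= ->.
Qed.

Lemma ae_eq_leb_integrable D g h : measurable D ->
  (mu1 R).-integrable D (EFin \o h) ->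
  {ae mu1 R, forall t, D t -> h t = g t} ->
  (leb R).-integrable D (EFin \o g).
Proof.
move=> mD ih hg.
have mh : measurable_fun D h by apply/measurable_EFinP; case/integrableP: ih.
have mg := ae_eq_leb_measurable mD mh hg.
have mD' := borel_caratheodory mD.
move/(leb_integrableE mD mh)/integrableP: ih => [_ ih].
apply/integrableP; split; first exact/measurable_EFinP.
by rewrite /= (leb_integral_abse_ae mD' mg (measurable_fun_borel mD mh) hg).
Qed.

End completion.

(** * Integrals of functions on the line *)

(** All integrands are functions on the whole line, cut off outside the
    interval of interest: a single hypothesis then covers the integrability on
    all subintervals. *)
Notation Lint h := ((@lebesgue_measure _).-integrable setT (EFin \o h)).

Section lint.
Context {R : realType}.
Implicit Types (f g h : R -> R) (s t u : R) (D : set R).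
Notation mu := (@lebesgue_measure R).

Definition itg h s t : R := \int[mu]_(r in `]s, t]) h r.

Lemma mR_itv (i : interval R) : measurable ([set` i] : set (measurableTypeR R)).
Proof. exact: measurable_itv. Qed.

Lemma mR_T : measurable (setT : set (measurableTypeR R)).
Proof. exact: measurableT. Qed.

Lemma Lint_measurable h : Lint h -> measurable_fun setT h.
Proof. by case/integrableP => mh _; apply/measurable_EFinP. Qed.

Lemma LintS D h : measurable D -> Lint h -> mu.-integrable D (EFin \o h).
Proof. by move=> mD; apply: integrableS => //; exact: mR_T. Qed.

Lemma Lint_itv (i : interval R) h : Lint h -> mu.-integrable [set` i] (EFin \o h).
Proof. by move=> Ih; apply: LintS Ih; exact: measurable_itv. Qed.

Lemma LintD f g : Lint f -> Lint g -> Lint (fun r => f r + g r).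
Proof. by move=> If Ig; have := integrableD mR_T If Ig. Qed.

Lemma LintN f : Lint f -> Lint (fun r => - f r).
Proof. by move=> If; have := integrableN If. Qed.

Lemma LintB f g : Lint f -> Lint g -> Lint (fun r => f r - g r).
Proof. by move=> If Ig; exact/LintD/LintN. Qed.

Lemma LintZ k f : Lint f -> Lint (fun r => k * f r).
Proof. by move=> If; have := integrableZl mR_T k If. Qed.

Lemma Lint0 : Lint (fun _ : R => 0 : R).
Proof. exact: (integrable0 (mu1 R) setT). Qed.

Lemma Lint_norm f : Lint f -> Lint (fun r => `|f r|).
Proof. by move=> If; have := integrable_abse If. Qed.

Lemma Lint_sum (I : Type) (l : seq I) (F : I -> R -> R) :
  (forall i, Lint (F i)) -> Lint (fun r => \sum_(i <- l) F i r).
Proof.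
move=> IF; elim: l => [|i l ih].
  by under eq_fun do rewrite big_nil; exact: Lint0.
under eq_fun do rewrite big_cons.
by apply: (LintD (f := F i)).
Qed.

Lemma Lint_le_ae f g : measurable_fun setT f -> Lint g ->
  {ae mu, forall r, `|f r| <= g r} -> Lint f.
Proof.
move=> mf Ig fg; apply/integrableP; split.
  exact/measurable_EFinP.
case/integrableP : Ig => mg; apply: le_lt_trans.
apply: ae_ge0_le_integral => //.
- by apply: measurableT_comp; [exact: abse_measurable|exact/measurable_EFinP].
- by apply: measurableT_comp; [exact: abse_measurable|exact: mg].
- apply: filterS fg => r fgr _ /=; rewrite lee_fin.
  exact: le_trans fgr (ler_norm _).
Qed.

Lemma itg_chasles h s u t : Lint h -> s <= u -> u <= t ->
  itg h s t = itg h s u + itg h u t.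
Proof.
move=> Ih su ut; apply/eqP; rewrite addrC -subr_eq; apply/eqP.
by apply: Rintegral_itvB => //; exact: Lint_itv.
Qed.

Lemma itgge h s t : t <= s -> itg h s t = 0.
Proof.
by move=> ts; rewrite /itg set_itv_ge ?Rintegral_set0// bnd_simp -leNgt.
Qed.

Lemma itgD f g s t : Lint f -> Lint g ->
  itg (fun r => f r + g r) s t = itg f s t + itg g s t.
Proof. by move=> If Ig; apply: RintegralD; [exact: mR_itv|exact: Lint_itv..]. Qed.

Lemma itgB f g s t : Lint f -> Lint g ->
  itg (fun r => f r - g r) s t = itg f s t - itg g s t.
Proof. by move=> If Ig; apply: RintegralB; [exact: mR_itv|exact: Lint_itv..]. Qed.

Lemma itgZ k f s t : Lint f -> itg (fun r => k * f r) s t = k * itg f s t.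
Proof. by move=> If; apply: RintegralZl; [exact: mR_itv|exact: Lint_itv]. Qed.

Lemma itg_sum (I : Type) (l : seq I) (F : I -> R -> R) s t :
  (forall i, Lint (F i)) ->
  itg (fun r => \sum_(i <- l) F i r) s t = \sum_(i <- l) itg (F i) s t.
Proof.
move=> IF; elim: l => [|i l ih].
  under [X in itg X]eq_fun do rewrite big_nil.
  rewrite big_nil /itg Rintegral_cst ?mul0r//; exact: mR_itv.
under [X in itg X]eq_fun do rewrite big_cons.
by rewrite big_cons itgD ?ih//; exact: Lint_sum.
Qed.

Lemma eq_itg_ae f g s t : measurable_fun setT f -> measurable_fun setT g ->
  {ae mu, forall r, s < r <= t -> f r = g r} -> itg f s t = itg g s t.
Proof.
move=> mf mg fg; congr fine; apply: ae_eq_integral.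
- exact: mR_itv.
- by apply/measurable_EFinP; exact: measurable_funTS.
- by apply/measurable_EFinP; exact: measurable_funTS.
- by apply: filterS fg => r fgr /=; rewrite in_itv/= => /fgr ->.
Qed.

Lemma le_itg f g s t : Lint f -> Lint g ->
  {ae mu, forall r, s < r <= t -> f r <= g r} -> itg f s t <= itg g s t.
Proof.
move=> If Ig fg.
have mf := Lint_measurable If; have mg := Lint_measurable Ig.
(* the inequality holds only almost everywhere: [g] is replaced by the maximum
   of [f] and [g], which changes no integral *)
have Im : Lint (fun r => Num.max (f r) (g r)).
  apply: (Lint_le_ae (g := fun r => `|f r| + `|g r|)).
  - exact: measurable_maxr.
  - by apply: LintD; exact: Lint_norm.
  - apply: nearW => r; rewrite maxEle; case: ifP => _.
      by rewrite lerDr.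
    by rewrite lerDl.
rewrite -(@eq_itg_ae (fun r => Num.max (f r) (g r)) g s t) //; last 2 first.
- exact: Lint_measurable.
- by apply: filterS fg => r fgr /fgr ?; exact/max_idPr.
apply: le_Rintegral; [exact: mR_itv|exact: Lint_itv..|].
by move=> r _; rewrite le_max lexx.
Qed.

Lemma itg_ge0 f s t : (forall r, 0 <= f r) -> 0 <= itg f s t.
Proof. by move=> f0; exact: Rintegral_ge0. Qed.

Lemma norm_itg_le f g s t : Lint f -> Lint g ->
  {ae mu, forall r, s < r <= t -> `|f r| <= g r} -> `|itg f s t| <= itg g s t.
Proof.
move=> If Ig fg; apply: (le_trans (y := itg (fun r => `|f r|) s t)).
  by apply: le_normr_Rintegral; [exact: mR_itv|exact: Lint_itv].
by apply: le_itg => //; exact: Lint_norm.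
Qed.

Lemma itg_cst_cut (c : R) a b s t : a <= s -> s <= t -> t <= b ->
  itg ((cst c) \_ `]a, b]) s t = c * (t - s).
Proof.
move=> as_ st tb; transitivity (\int[mu]_(r in `]s, t]) c).
  apply: eq_Rintegral => r; rewrite inE/= in_itv/= => /andP[sr rt].
  rewrite patchE mem_set//= in_itv/=.
  by rewrite (le_lt_trans as_ sr) (le_trans rt tb).
rewrite Rintegral_cst; last exact: mR_itv.
have := @lebesgue_measure_itv R `]s, t]; rewrite /= lte_fin => ->.
by move: st; rewrite le_eqVlt => /predU1P[->|->//]; rewrite ltxx subrr.
Qed.

Lemma Lint_cst_cut (c : R) a b : Lint ((cst c) \_ `]a, b]).
Proof.
have mD := mR_itv `]a, b].
rewrite -restrict_EFin; apply/(integrable_mkcond _ mD).1.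
apply: measurable_bounded_integrable => //.
- have := @lebesgue_measure_itv R `]a, b] => /= ->; by case: ifP; rewrite ltry.
- by exists `|c|; split => // x xc r _; exact: ltW.
Qed.

End lint.

(** * Absolutely continuous functions *)

Section clamping.
Context {R : realType}.
Implicit Types (a b s t : R).

(** Composition with [clamp a b] extends a function on [a, b] to the line, by
    constants and with the same modulus of continuity. *)
Definition clamp (a b t : R) := Num.max a (Num.min b t).

Lemma clamp_itv a b t : a <= b -> a <= clamp a b t <= b.
Proof. by move=> ab; rewrite /clamp le_max lexx ge_max ab ge_min lexx. Qed.

Lemma clamp_id a b t : a <= t <= b -> clamp a b t = t.
Proof. by move=> /andP[at_ tb]; rewrite /clamp (min_idPr tb) (max_idPr at_). Qed.

Lemma clamp_le a b s t : s <= t -> clamp a b s <= clamp a b t.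
Proof. by move=> st; rewrite le_max2// le_min2. Qed.

Lemma clamp_dist a b s t : s <= t -> 0 <= clamp a b t - clamp a b s <= t - s.
Proof.
move=> st; rewrite /clamp; case: (leP b t) => bt; case: (leP b s) => bs;
  rewrite ?maxEle; repeat (case: ifPn; rewrite -?ltNge => ?); lra.
Qed.

End clamping.

Section calculus.
Context {R : realType}.
Implicit Types (f g h z : R -> R) (a b s t u : R) (D : set R).
Notation mu := (@lebesgue_measure R).

(** The supremum of the points at which [P] is known cannot lie before [b],
    since the step carries [P] from some point just left of it to a point to
    its right. *)
Lemma real_induction (P : R -> Prop) a b : a <= b -> P a ->
  (forall t, a <= t <= b -> exists2 r, 0 < r & forall s u,
     a <= s -> u <= b -> t - r < s <= t -> t <= u < t + r -> P s -> P u) ->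
  P b.
Proof.
move=> ab Pa step; pose S := [set t | a <= t <= b /\ P t].
have Sa : S a by rewrite /S/= lexx ab.
have ubS : ubound S b by move=> t [/andP[]].
have hsS : has_sup S by split; [exists a|exists b].
pose c := sup S.
have ac : a <= c by exact: ub_le_sup (ex_intro _ b ubS) a Sa.
have cb : c <= b by apply: ge_sup => //; exists a.
have [|r r0 stepc] := step c; first by rewrite ac.
have [s [/andP[as_ sb] Ps] cs] := sup_adherent r0 hsS.
have sc : s <= c by apply: ub_le_sup; [exists b|split; rewrite ?as_].
have Pu : P (Num.min b (c + r / 2)).
  apply: (stepc s) => //; first by rewrite ge_min lexx.
    by rewrite cs sc.
  rewrite le_min cb lerDl divr_ge0 ?ltW//= gt_min ltrD2l.
  by rewrite ltr_pdivrMr// ltr_pMr// ltr1n orbT.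
have [bc|cb'] := leP b (c + r / 2); first by move: Pu; rewrite (min_idPl bc).
move: Pu; rewrite (min_idPr (ltW cb')) => Pu.
have : c + r / 2 <= c.
  apply: ub_le_sup; first by exists b.
  by split => //; rewrite (ltW cb') (le_trans ac)// lerDl divr_ge0// ltW.
by rewrite gerDl leNgt divr_gt0.
Qed.

Definition nonoverlapping N (s t : 'I_N -> R) :=
  (forall i, s i <= t i) /\
  (forall i j, i != j -> t i <= s j \/ t j <= s i).

Lemma nonoverlapping_trivIset N (s t : 'I_N -> R) : nonoverlapping s t ->
  trivIset setT (fun i => `]s i, t i]%classic).
Proof.
move=> [st no]; apply/trivIsetP => i j _ _ /no ij.
apply/seteqP; split => // r [] /=; rewrite !in_itv/= => /andP[sr rt] /andP[sr' rt'].
by case: ij => [tisj|tjsi]; [have := le_lt_trans (le_trans rt tisj) sr'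
  |have := le_lt_trans (le_trans rt' tjsi) sr]; rewrite ltxx.
Qed.

Lemma nonoverlapping_length N (s t : 'I_N -> R) : nonoverlapping s t ->
  mu (\big[setU/set0]_(i < N) `]s i, t i]%classic) = (\sum_i (t i - s i))%:E.
Proof.
move=> no; have := nonoverlapping_trivIset no => tI.
rewrite (measure_bigsetU_ord mu xpredT (F := fun i => `]s i, t i]%classic))//.
rewrite -sumEFin; apply: eq_bigr => i _.
have := @lebesgue_measure_itv R `]s i, t i]; rewrite /= lte_fin => ->.
case: no => /(_ i) + _; rewrite le_eqVlt => /predU1P[->|->//].
by rewrite ltxx subrr.
Qed.

Lemma nonoverlapping_itg h N (s t : 'I_N -> R) : Lint h -> nonoverlapping s t ->
  \sum_i itg h (s i) (t i) =
  \int[mu]_(r in \big[setU/set0]_(i < N) `]s i, t i]%classic) h r.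
Proof.
move=> Ih no; have tI := nonoverlapping_trivIset no.
apply: EFin_inj; rewrite -sumEFin.
have mI i : measurable (`]s i, t i]%classic : set (measurableTypeR R)).
  exact: mR_itv.
rewrite /Rintegral fineK; last first.
  apply: integrable_fin_num; first exact: bigsetU_measurable.
  by apply: LintS => //; exact: bigsetU_measurable.
rewrite integral_bigsetU_EFin//; last 3 first.
- exact: index_enum_uniq.
- exact: sub_trivIset tI.
- apply/measurable_EFinP; apply: measurable_funTS; exact: Lint_measurable.
apply: eq_bigr => i _; rewrite /itg /Rintegral fineK//.
by apply: integrable_fin_num; [exact: mR_itv|exact: Lint_itv].
Qed.

(** By [nonoverlapping_itg] the sum is a single integral, over a union of
    small measure. *)
Lemma itg_abs_continuous h e : Lint h -> 0 < e -> exists2 d, 0 < d &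
  forall N (s t : 'I_N -> R), nonoverlapping s t ->
  \sum_i (t i - s i) < d -> \sum_i itg (fun r => `|h r|) (s i) (t i) < e.
Proof.
move=> Ih e0; have [d [d0 hd]] := integral_normr_continuous Ih e0.
exists d => // N s t no sd.
rewrite (nonoverlapping_itg _ no); last exact: Lint_norm.
apply: hd; first by apply: bigsetU_measurable => i _; exact: mR_itv.
by move: sd; rewrite -lte_fin -(nonoverlapping_length no).
Qed.

Lemma itg_small h e : Lint h -> 0 < e -> exists2 d, 0 < d &
  forall s t, s <= t -> t - s < d -> itg (fun r => `|h r|) s t < e.
Proof.
move=> Ih e0; have [d d0 hd] := itg_abs_continuous Ih e0.
exists d => // s t st sd.
have := hd 1%N (fun=> s) (fun=> t).
rewrite !big_ord1; apply => //; split => // i j.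
by rewrite !ord1 eqxx.
Qed.

Lemma itg_derive h a : Lint h ->
  {ae mu, forall t, a < t -> is_derive t 1 (itg h a) (h t)}.
Proof.
move=> Ih.
have := @FTC1 R h (BRight a).
move=> /(_ (fun y => Lint_itv `]a, y] Ih)).
have loc : locally_integrable setT h.
  split; [exact: Lint_measurable|exact: openT|move=> K _ cK].
  have : mu.-integrable K (EFin \o h).
    by apply: LintS => //; exact: compact_measurable.
  by case/integrableP.
move=> /(_ loc); apply: filterS => t ht at_.
have [dt dt'] := ht at_; rewrite -dt' derive1E.
exact: DeriveDef.
Qed.

Definition abs_continuousR (z : R -> R) (I : set R) := forall e, 0 < e ->
  exists2 d, 0 < d & forall N (s t : 'I_N -> R),
  (forall i, I (s i) /\ I (t i)) -> nonoverlapping s t ->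
  \sum_i (t i - s i) < d -> \sum_i `|z (t i) - z (s i)| < e.

Lemma nonoverlapping_rcons N (s t : 'I_N -> R) s0 t0 :
  nonoverlapping s t -> s0 <= t0 -> (forall i, t i <= s0) ->
  nonoverlapping (fun i : 'I_N.+1 => if unlift ord_max i is Some j then s j else s0)
    (fun i : 'I_N.+1 => if unlift ord_max i is Some j then t j else t0).
Proof.
move=> [st no] st0 ts0; split => [i|i j]; first by case: unliftP.
case: unliftP => [i' ->|->]; case: unliftP => [j' ->|->].
- by rewrite (inj_eq lift_inj); exact: no.
- by left.
- by right.
- by rewrite eqxx.
Qed.

Lemma sum_rcons N (F : 'I_N -> R) x :
  \sum_(i < N.+1) (if unlift ord_max i is Some j then F j else x) =
  \sum_i F i + x.
Proof.
rewrite big_ord_recr/= unlift_none; congr (_ + _).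
apply: eq_bigr => i _.
have -> : widen_ord (leqnSn N) i = lift ord_max i.
  by apply: val_inj; rewrite /= /bump leqNgt ltn_ord.
by rewrite liftK.
Qed.

(** The difference quotient without the division, so that [w = t] is allowed.
    *)
Lemma is_derive_bound z t l e : is_derive t 1 z l -> 0 < e ->
  exists2 r, 0 < r & forall w, `|w - t| < r ->
    `|z w - z t - l * (w - t)| <= e * `|w - t|.
Proof.
move=> [dz dv] e0.
move: (dz); rewrite /derivable -/(derive z t 1) dv.
move=> /cvgrPdist_le/(_ e e0)[r /= r0 hr]; exists r => // w wt.
have [->|wt0] := eqVneq w t; first by rewrite !subrr mulr0 subr0 normr0 mulr0.
have wt0' : w - t != 0 by rewrite subr_eq0.
have := hr (w - t); rewrite /ball/= !sub0r !normrN => /(_ wt wt0').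
rewrite [_ *: 1]mulr1 subrK -ler_pdivrMr ?normr_gt0//.
rewrite -normfV -normrM; congr (_ <= _).
by rewrite distrC; congr `|_|; rewrite /GRing.scale/=; field.
Qed.

(** The points without derivative zero form a null set, so they lie in an open
    set [U] that is smaller than the [d] which absolute continuity gives for
    [e]. Going from [a] to [b] by continuous induction, a step either starts
    near a point of derivative zero, and has slope at most [e], or is an
    interval inside [U]; the latter steps contribute at most [e] altogether.
    *)
Lemma abs_continuousR_derive0_eq z a b : a <= b -> abs_continuousR z `[a, b] ->
  {ae mu, forall t, a <= t <= b -> is_derive t 1 z 0} -> z b = z a.
Proof.
move=> ab acz dz.
suff H e : 0 < e -> `|z b - z a| <= e * (b - a) + e.
  apply/eqP; rewrite -subr_eq0 -normr_le0.
  apply/ler_addgt0Pr => e e0; rewrite add0r.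
  have k0 : 0 < b - a + 1 by rewrite ltr_wpDl// subr_ge0.
  have := H (e / (b - a + 1)) (divr_gt0 e0 k0).
  suff -> : e / (b - a + 1) * (b - a) + e / (b - a + 1) = e by [].
  by field; rewrite gt_eqF.
move=> e0; have [d d0 hd] := acz e e0.
have [U [oU NU mU]] : exists U, [/\ open U,
    ~` [set t | a <= t <= b -> is_derive t 1 z 0] `<=` U & (mu U < d%:E)%E].
  case: dz => N [mN N0 NN].
  have muN : (mu N < +oo)%E by rewrite N0.
  have [U [oU NU mU]] := lebesgue_regularity_outer mN muN d0.
  exists U; split=> //; first exact: subset_trans NU.
  have -> : U = N `|` (U `\` N) by rewrite setDUK.
  apply: le_lt_trans mU; rewrite -[leRHS]add0e -N0.
  apply: measureU2 => //; apply: measurableD => //; exact: open_measurable.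
(* the intervals [s i, t i] collect the steps inside U that lead from a to t
   *)
pose P t := exists N (s t' : 'I_N -> R), [/\ nonoverlapping s t',
   forall i, a <= s i /\ t' i <= t,
   forall i, `[s i, t' i]%classic `<=` U &
   `|z t - z a| <= e * (t - a) + \sum_i `|z (t' i) - z (s i)|].
suff [N [s [t' [no st' sU le]]]] : P b.
  rewrite (le_trans le)// lerD2l ltW//; apply: hd => //.
    move=> i; case: no => /(_ i) st _; have [as_ tb] := st' i.
    rewrite /= !in_itv/= as_ tb (le_trans as_ st)/=.
    by rewrite (le_trans st tb).
  rewrite -lte_fin -(nonoverlapping_length no); apply: le_lt_trans mU.
  apply: le_measure; rewrite ?inE.
  - by apply: bigsetU_measurable => i _; exact: mR_itv.
  - exact: open_measurable.
  - apply: (big_ind (fun X => X `<=` U)) => [|A B AU BU|i _].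
    + exact: sub0set.
    + by rewrite subUset.
    + exact: subset_trans (@subset_itv_oc_cc _ _ _ _) (sU i).
apply: (real_induction ab).
  exists 0%N, (fun=> 0), (fun=> 0); split => //; first by split => -[].
  - by case.
  - by case.
  - by rewrite big_ord0 !subrr normr0 mulr0 add0r.
move=> t /andP[at_ tb].
have [Ut|nUt] := pselect (U t).
  have [r /= r0 rU] := (nbhs_ballP _ _).1 (open_nbhs_nbhs (conj oU Ut)).
  exists r => // s u as_ ub /andP[rs st] /andP[tu ur].
  move=> [N [s0 [t0 [no st0 sU le]]]].
  have su := le_trans st tu.
  exists N.+1, (fun i => if unlift ord_max i is Some j then s0 j else s),
    (fun i => if unlift ord_max i is Some j then t0 j else u); split.
  - apply: nonoverlapping_rcons => // i; by case: (st0 i).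
  - move=> i; case: unliftP => [j _|_]//.
    by have [? ?] := st0 j; split => //; rewrite (le_trans _ su).
  - move=> i; case: unliftP => [j _|_]; first exact: sU.
    move=> w /=; rewrite in_itv/= => /andP[sw wu]; apply: rU => /=.
    rewrite -ball_normE/= ltr_distlC; apply/andP; split; first exact: lt_le_trans sw.
    exact: le_lt_trans ur.
  - have -> : \sum_(i < N.+1) `|z (if unlift ord_max i is Some j then t0 j else u)
        - z (if unlift ord_max i is Some j then s0 j else s)| =
        \sum_i `|z (t0 i) - z (s0 i)| + `|z u - z s|.
      by rewrite -sum_rcons; apply: eq_bigr => i _; case: unlift.
    rewrite (le_trans (ler_distD (z s) _ _))// addrC addrA lerD2r.
    rewrite (le_trans le)// lerD2r ler_pM2l// lerD2r//.
have dt : is_derive t 1 z 0.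
  by apply: contrapT => ndt; apply: nUt; apply: NU => /=; rewrite at_ tb => /(_ isT).
have [r r0 rz0] := is_derive_bound dt e0.
have rz w : `|w - t| < r -> `|z w - z t| <= e * `|w - t|.
  by move=> /rz0; rewrite mul0r subr0.
exists r => // s u as_ ub /andP[rs st] /andP[tu ur].
move=> [N [s0 [t0 [no st0 sU le]]]].
have su := le_trans st tu.
exists N, s0, t0; split => //.
  by move=> i; have [? ?] := st0 i; split => //; rewrite (le_trans _ su).
have zu : `|z u - z t| <= e * (u - t).
  by have := rz u; rewrite (@ger0_norm _ (u - t)) ?subr_ge0//; apply; rewrite ltrBlDl.
have zs : `|z t - z s| <= e * (t - s).
  have := rz s; rewrite (distrC s) (distrC (z s)).
  rewrite (@ger0_norm _ (t - s)) ?subr_ge0//; apply.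
  by rewrite ltrBlDr addrC -ltrBlDr.
have -> : z u - z a = (z u - z t) + (z t - z s) + (z s - z a) by ring.
have -> : e * (u - a) = e * (u - t) + e * (t - s) + e * (s - a) by ring.
rewrite (le_trans (ler_normD _ _))//; rewrite -[leRHS]addrA lerD//.
by rewrite (le_trans (ler_normD _ _))// lerD.
Qed.

End calculus.

(** * Densities of dominated increments *)

Section density.
Context {R : realType}.
Implicit Types (f g h z : R -> R) (a b s t u : R) (D : set R).
Notation mu := (@lebesgue_measure R).

Lemma small_incr_right_continuous (F phi : R -> R) : Lint phi ->
  (forall s t, s <= t -> 0 <= F t - F s <= itg phi s t) ->
  right_continuous F.
Proof.
move=> Iphi Fphi t; apply/cvgrPdist_lt => e e0.
have [d d0 hd] := itg_small Iphi e0.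
near=> u; have tu : t < u by near: u; exact: nbhs_right_gt.
have /andP[F0 Fle] := Fphi t u (ltW tu).
rewrite distrC ger0_norm//; apply: (le_lt_trans Fle).
apply: le_lt_trans (hd t u (ltW tu) _).
  by apply: le_itg => //; [exact: Lint_norm|apply: nearW => r _; exact: ler_norm].
rewrite ltrBlDl; near: u; apply: nbhs_right_lt.
by rewrite ltrDl.
Unshelve. all: by end_near. Qed.

(** [F] and the primitive of [phi] generate Lebesgue-Stieltjes measures.
    Comparing coverings by half-open intervals, the first measure is at most
    the second, which is [phi] times the Lebesgue measure. So the first is
    finite and absolutely continuous, and its Radon-Nikodym derivative is the
    density. *)
Lemma monotone_density (F phi : R -> R) : Lint phi -> (forall r, 0 <= phi r) ->
  (forall s t, s <= t -> 0 <= F t - F s <= itg phi s t) ->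
  exists2 h, Lint h & forall s t, s <= t -> F t - F s = itg h s t.
Proof.
move=> Iphi phi0 Fphi.
pose Phi t := \int[mu]_(r in `]-oo, t]) phi r.
have PhiE s t : s <= t -> Phi t - Phi s = itg phi s t.
  by move=> st; apply: Rintegral_itvB => //; exact: Lint_itv.
have ndF : nondecreasing F.
  by move=> s t st; have /andP[] := Fphi s t st; rewrite subr_ge0.
have rcF := small_incr_right_continuous Iphi Fphi.
have Phiphi s t : s <= t -> 0 <= Phi t - Phi s <= itg phi s t.
  by move=> st; rewrite PhiE// lexx itg_ge0.
have ndPhi : nondecreasing Phi.
  by move=> s t st; have /andP[] := Phiphi s t st; rewrite subr_ge0.
have rcPhi := small_incr_right_continuous Iphi Phiphi.
pose cF : cumulative R R := HB.pack F (isCumulative.Build R _ R F ndF rcF).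
pose cPhi : cumulative R R := HB.pack Phi (isCumulative.Build R _ R Phi ndPhi rcPhi).
pose nu : set (measurableTypeR R) -> \bar R :=
  fun A => (\int[mu]_(r in A) (phi r)%:E)%E.
have nu0 : nu set0 = 0%E by exact: integral_set0.
have nu_ge0 A : (0 <= nu A)%E.
  by apply: integral_ge0 => r _; rewrite lee_fin.
have nu_sadd : semi_sigma_additive nu.
  apply: semi_sigma_additive_nng_induced.
    by apply/measurable_EFinP; exact: Lint_measurable.
  by move=> r; rewrite lee_fin.
pose mnu : {measure set (measurableTypeR R) -> \bar R} :=
  HB.pack nu (isMeasure.Build _ _ _ nu nu0 nu_ge0 nu_sadd).
have LSoc (G : cumulative R R) s t : s <= t ->
    lebesgue_stieltjes_measure G `]s, t]%classic = (G t - G s)%:E.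
  move=> st; rewrite /lebesgue_stieltjes_measure /measure_extension/=.
  rewrite measurable_mu_extE//; last exact: is_ocitv.
  exact: wlength_itv_bnd.
have nuE A : measurable A -> lebesgue_stieltjes_measure cPhi A = nu A.
  apply: (lebesgue_stieltjes_measure_unique (mu := mnu)) => X [[s t] _ <-]/=.
  have [st|ts] := leP s t; last first.
    by rewrite set_itv_ge ?bnd_simp -?leNgt ?ltW// measure0.
  rewrite LSoc//= PhiE// /itg /Rintegral fineK//.
  by apply: integrable_fin_num; [exact: mR_itv|exact: Lint_itv].
have leFPhi A : (lebesgue_stieltjes_measure cF A <= lebesgue_stieltjes_measure cPhi A)%E.
  apply: le_ereal_inf_tmp => _ [I cI <-]; apply: ge_ereal_inf.
  exists (\sum_(0 <= k <oo) wlength cF (I k))%E; first by exists I.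
  apply: lee_nneseries => [k _ _|k _]; first exact: wlength_ge0.
  have [/(_ k) [[s t] _ /= <-] _] := cI.
  have [st|ts] := leP s t; last first.
    have -> : `]s, t]%classic = set0 by rewrite set_itv_ge// bnd_simp -leNgt ltW.
    by rewrite !wlength0.
  rewrite !wlength_itv_bnd// lee_fin /= PhiE//.
  by have /andP[] := Fphi s t st.
have fin : fin_num_fun (lebesgue_stieltjes_measure cF).
  apply: lty_fin_num_fun; apply: (le_lt_trans (leFPhi _)).
  rewrite nuE//; have := integrable_fin_num measurableT Iphi.
  by move=> /fin_numPlt/andP[].
pose m0 : {measure set (measurableTypeR R) -> \bar R} :=
  lebesgue_stieltjes_measure cF.
pose fF : {finite_measure set (measurableTypeR R) -> \bar R} :=
  HB.pack_for (FiniteMeasure.type (measurableTypeR R) R) (Measure.sort m0)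
   (Measure_isFinite.Build _ (measurableTypeR R) R m0 fin).
have dom : fF `<< mu.
  apply/null_content_dominatesP => A mA A0.
  apply/eqP; rewrite -measure_le0; apply: (le_trans (leFPhi A)).
  rewrite nuE// /nu null_set_integral//.
  by apply/measurable_EFinP; apply: measurable_funTS; exact: Lint_measurable.
have [f [f0 ffin If fE]] := radon_nikodym_sigma_finite dom.
exists (fine \o f).
  apply: eq_integrable If => //.
  by move=> r _ /=; rewrite fineK.
move=> s t st; rewrite /itg /Rintegral.
have -> : (\int[mu]_(r in `]s, t]) ((fine \o f) r)%:E = fF `]s, t]%classic)%E.
  rewrite fE; last exact: mR_itv.
  by apply: eq_integral => r _ /=; rewrite fineK.
by rewrite /= LSoc.
Qed.

Lemma itg_sub f s s' t' t : Lint f -> (forall r, 0 <= f r) ->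
  s <= s' -> s' <= t' -> t' <= t -> itg f s' t' <= itg f s t.
Proof.
move=> If f0 ss' st' tt'.
rewrite (@itg_chasles _ f s s' t)// ?(le_trans st')//.
rewrite (@itg_chasles _ f s' t' t)//.
by rewrite addrCA lerDl addr_ge0// itg_ge0.
Qed.

(** Adding a primitive of [phi] makes [z] monotone, with increments at most
    those of the primitive of [2 * phi]. Clamping the argument extends [z] to
    the line, as [monotone_density] demands. *)
Lemma dominated_density z (phi : R -> R) a b : a <= b -> Lint phi ->
  (forall r, 0 <= phi r) ->
  (forall s t, a <= s -> s <= t -> t <= b -> `|z t - z s| <= itg phi s t) ->
  exists2 h, Lint h & forall t, a <= t <= b -> z t = z a + itg h a t.
Proof.
move=> ab Iphi phi0 zphi.
pose cl := clamp a b.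
have cla t : a <= cl t by have /andP[] := clamp_itv t ab.
have clb t : cl t <= b by have /andP[] := clamp_itv t ab.
pose Phi t := \int[mu]_(r in `]-oo, t]) phi r.
have PhiE s t : s <= t -> Phi t - Phi s = itg phi s t.
  by move=> st; apply: Rintegral_itvB => //; exact: Lint_itv.
have zcl s t : s <= t -> `|z (cl t) - z (cl s)| <= itg phi s t.
  move=> st; apply: (le_trans (zphi _ _ (cla s) (clamp_le a b st) (clb t))).
  have [cts|cst] := leP (cl t) (cl s); first by rewrite itgge// itg_ge0.
  have at_ : a < t.
    rewrite ltNge; apply: contraTN cst => ta; rewrite -leNgt.
    by rewrite {1}/cl /clamp (max_idPl _)// (le_trans _ ta)// ge_min lexx orbT.
  have sb : s < b.
    rewrite ltNge; apply: contraTN cst => bs; rewrite -leNgt.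
    by rewrite {2}/cl /clamp (min_idPl bs) (max_idPr ab).
  apply: itg_sub => //; last 1 first.
  - by rewrite /cl /clamp ge_max (ltW at_) ge_min lexx orbT.
  - by rewrite /cl /clamp (min_idPr (ltW sb)) le_max lexx orbT.
  - exact: ltW.
have [||h Ih hE] := @monotone_density (fun t => z (cl t) + Phi t)
    (fun r => 2 * phi r) (LintZ 2 Iphi).
- by move=> r; rewrite mulr_ge0.
- move=> s t st; rewrite itgZ// opprD addrACA PhiE//.
  have := zcl s t st; rewrite ler_norml => /andP[z1 z2].
  by apply/andP; split; lra.
exists (fun r => h r - phi r); first exact: LintB.
move=> t /andP[at_ tb]; rewrite itgB// -hE// -PhiE// /cl !clamp_id ?at_ ?tb ?lexx//.
by ring.
Qed.

(** At almost every [t] the primitive of [g - f] has derivative [g t - f t],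
    which is not negative because the increments to the right of [t] are not.
    *)
Lemma itg_le_ae f g a b : Lint f -> Lint g ->
  (forall s t, a <= s -> s <= t -> t <= b -> itg f s t <= itg g s t) ->
  {ae mu, forall t, a < t < b -> f t <= g t}.
Proof.
move=> If Ig fg.
have := itg_derive a (LintB Ig If); apply: filterS => t dt /andP[at_ tb].
rewrite -subr_ge0 leNgt; apply/negP => d0.
have e0 : 0 < - (g t - f t) / 2 by rewrite divr_gt0// oppr_gt0.
have [r r0 hr] := is_derive_bound (dt at_) e0.
pose k := Num.min (r / 2) (b - t).
have k0 : 0 < k by rewrite lt_min divr_gt0//= subr_gt0.
have := hr (t + k); have -> : t + k - t = k by ring.
rewrite gtr0_norm//.
have kr : k < r.
  by rewrite gt_min; apply/orP; left; rewrite ltr_pdivrMr// ltr_pMr// ltr1n.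
move=> /(_ kr).
have tk : t <= t + k by rewrite lerDl ltW.
rewrite (itg_chasles (LintB Ig If) (ltW at_) tk).
rewrite [_ + _ - itg _ _ _]addrAC subrr add0r itgB//.
have : itg f t (t + k) <= itg g t (t + k).
  apply: fg; [exact: ltW|exact: tk|].
  by rewrite -lerBrDl ge_min lexx orbT.
set A := itg f _ _; set B := itg g _ _ => AB.
rewrite ler_norml => /andP[_].
have : 0 < - (g t - f t) * k by rewrite mulr_gt0// oppr_gt0.
nra.
Qed.

End density.

(** * Extraction of convergent subsequences *)

Section extraction.
Context {R : realType}.
Notation mu := (@lebesgue_measure R).

(** The sequence has a cluster point in a compact product of segments. As [J]
    is countable, the [m]-th chosen member can be required to be within
    [m.+1%:R^-1] of the cluster point in the first [m] coordinates. The map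
    [sigma] need not increase: [m <= sigma m] is enough for limits. *)
Lemma diagonal_extraction (J : countType) (w : nat -> J -> R) (M : J -> R) :
  (forall k j, `|w k j| <= M j) ->
  exists (sigma : nat -> nat) (l : J -> R), (forall m, (m <= sigma m)%N) /\
    forall j, w (sigma m) j @[m --> \oo] --> l j.
Proof.
move=> wM.
have cK : compact [set f : {ptws J -> R} | forall j, `[- M j, M j]%classic (f j)].
  have := @tychonoff J (fun=> R : topologicalType) (fun j => `[- M j, M j]%classic).
  by apply=> j; exact: segment_compact.
pose w' : nat -> {ptws J -> R} := w.
have [|p [_ clp]] := cK (w' @ \oo) (fmap_proper_filter w' eventually_filter).
  by exists 0%N => // k _ j /=; rewrite in_itv/= -ler_norml.
have Fp : Filter (nbhs p) := nbhs_filter p.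
have nb (e : R) (m : nat) : 0 < e -> nbhs p
    [set f : {ptws J -> R} | forall j, (pickle j < m)%N -> `|p j - f j| < e].
  move=> e0; elim: m => [|m ih]; first by apply: filterS filterT => f _ j.
  have ih' : nbhs p [set f : {ptws J -> R} | forall j, pickle j = m ->
      `|p j - f j| < e].
    have [[j jm]|noj] := pselect (exists j : J, pickle j = m); last first.
      by apply: filterS filterT => f _ j jm; exfalso; apply: noj; exists j.
    have /cvgrPdist_lt/(_ e e0) := @proj_continuous J (fun=> R) j p.
    apply: filterS => f pf j' j'm.
    by rewrite (pcan_inj pickleK (etrans j'm (esym jm))).
  apply: filterS (filterI ih ih') => f [fm fm'] j; rewrite ltnS leq_eqVlt.
  by case/predU1P => [|jm]; [exact: fm'|exact: fm].
have /choice[sigma sP] (m : nat) : exists k, (m <= k)%N /\ forall j, (pickle j < m)%N ->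
      `|p j - w k j| < m.+1%:R^-1.
  have [||f [[k /= mk <-] kP]] := clp (w' @` [set k | (m <= k)%N])
    [set f : {ptws J -> R} | forall j, (pickle j < m)%N -> `|p j - f j| < m.+1%:R^-1].
  - by exists m => // k /= mk; exists k.
  - exact: nb.
  - by exists k.
exists sigma, p; split=> [m|j]; first by case: (sP m).
apply/cvgrPdist_lt => e e0; near=> m.
have [_ /(_ j)] := sP m.
have jm : (pickle j < m)%N by near: m; exact: nbhs_infty_gt.
move=> /(_ jm) /lt_trans; apply.
by near: m; exact: (near_infty_natSinv_lt (PosNum e0)).
Unshelve. all: by end_near. Qed.

Lemma ae_forall_count (T : countType) (P : T -> R -> Prop) :
  (forall q, {ae mu, forall t, P q t}) -> {ae mu, forall t, forall q, P q t}.
Proof.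
move=> aeP; rewrite /almost_everywhere /prop_near1/= .
have : mu.-negligible (\bigcup_n (if unpickle n is Some q then
    ~` [set t | P q t] else set0)).
  apply: negligible_bigcup => k; case: unpickle => [q|].
    exact: aeP.
  exact: negligible_set0.
apply: negligibleS => t /= /existsNP[q nP].
by exists (pickle q); [exact: I|rewrite pickleK].
Qed.

(** Diagonal extraction gives convergence at rational times, and the common
    modulus of continuity that comes from [phi] spreads it to all times. *)
Lemma equicontinuous_extraction n (X : nat -> R -> 'cV[R]_n) (phi : R -> R) a b
    (x0 : 'cV[R]_n) :
  a <= b -> Lint phi -> (forall r, 0 <= phi r) ->
  (forall k, X k a = x0) ->
  (forall k s t i, a <= s -> s <= t -> t <= b ->
     `|X k t i ord0 - X k s i ord0| <= itg phi s t) ->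
  exists (sigma : nat -> nat) (x : R -> 'cV[R]_n), (forall m, (m <= sigma m)%N) /\
    forall t i, a <= t <= b -> X (sigma m) t i ord0 @[m --> \oo] --> x t i ord0.
Proof.
move=> ab Iphi phi0 Xa Xphi.
pose cl := clamp a b.
have cla t : a <= cl t by have /andP[] := clamp_itv t ab.
have clb t : cl t <= b by have /andP[] := clamp_itv t ab.
(* rational times outside [a, b] are moved to the nearest endpoint *)
have [|sigma [l [sm sl]]] := @diagonal_extraction (rat * 'I_n)%type
    (fun k j => X k (cl (ratr j.1)) j.2 ord0)
    (fun j => `|x0 j.2 ord0| + itg phi a b).
  move=> k [q i]/=.
  have -> : X k (cl (ratr q)) i ord0 = x0 i ord0 +
      (X k (cl (ratr q)) i ord0 - X k a i ord0).
    by rewrite Xa addrC subrK.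
  rewrite (le_trans (ler_normD _ _))// lerD2l.
  apply: (le_trans (Xphi _ _ _ _ _ _ _)) => //.
  exact: itg_sub.
have cv t i : a <= t <= b -> cvg (X (sigma m) t i ord0 @[m --> \oo]).
  move=> /andP[at_ tb]; apply/cauchy_cvgP/cauchy_exP => e e0.
  have e2 : 0 < e / 2 by rewrite divr_gt0.
  have [d d0 hd] := itg_small Iphi e2.
  have small k s u : a <= s -> s <= u -> u <= b -> u - s < d ->
      `|X k u i ord0 - X k s i ord0| < e / 2.
    move=> as_ su ub usd; apply: le_lt_trans (hd s u su usd).
    apply: (le_trans (Xphi _ _ _ _ as_ su ub)); apply: le_itg => //.
      exact: Lint_norm.
    by apply: nearW => r _; exact: ler_norm.
  have [q] := rat_in_itvoo (ltr_pwDr d0 (lexx t)).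
  rewrite in_itv/= => /andP[tq qtd].
  have tcl : t <= cl (ratr q).
    by rewrite /cl /clamp le_max le_min tb (ltW tq) orbT.
  have cltd : cl (ratr q) - t < d.
    rewrite ltrBlDl /cl /clamp gt_max gt_min qtd orbT andbT.
    by rewrite (le_lt_trans at_)// ltrDl.
  exists (l (q, i)).
  have := sl (q, i); move=> /cvgrPdist_lt/(_ _ e2); apply: filterS => m /= lX.
  rewrite -ball_normE/= (splitr e).
  rewrite (le_lt_trans (ler_distD (X (sigma m) (cl (ratr q)) i ord0) _ _))//.
  by rewrite ltrD// small.
exists sigma, (fun t => \col_i lim (X (sigma m) t i ord0 @[m --> \oo])).
by split=> // t i abt; rewrite mxE; exact: cv.
Qed.
End extraction.

(** * Convex sets and separation *)

Section separation.
Context {R : realType} {n : nat}.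
Implicit Types (u v w c : 'cV[R]_n) (C : set 'cV[R]_n).

Definition dot u v : R := \sum_i u i ord0 * v i ord0.

Definition convexv C := forall u v (l : R), 0 <= l <= 1 -> C u -> C v ->
  C (l *: u + (1 - l) *: v).

Definition coord_cvg (u : nat -> 'cV[R]_n) v :=
  forall i, u m i ord0 @[m --> \oo] --> v i ord0.

Definition seq_closed C := forall (u : nat -> 'cV[R]_n) v,
  (forall k, C (u k)) -> coord_cvg u v -> C v.

Lemma bounded_extraction (u : nat -> 'cV[R]_n) (B : R) :
  (forall m i, `|u m i ord0| <= B) ->
  exists (tau : nat -> nat) v, (forall m, (m <= tau m)%N) /\
    coord_cvg (u \o tau) v.
Proof.
move=> uB; have [tau [l [tm tl]]] := diagonal_extraction (M := fun=> B)
  (w := fun k (i : 'I_n) => u k i ord0) uB.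
by exists tau, (\col_i l i); split => // i; rewrite mxE; exact: tl.
Qed.

Lemma cvg_sumr (F : 'I_n -> nat -> R) (l : 'I_n -> R) :
  (forall i, F i m @[m --> \oo] --> l i) ->
  (\sum_i F i m) @[m --> \oo] --> \sum_i l i.
Proof.
by move=> Fl; apply: cvg_big => [|i _]; [exact: add_continuous|exact: Fl].
Qed.

Lemma dot_cvg w (u : nat -> 'cV[R]_n) v : coord_cvg u v ->
  dot w (u m) @[m --> \oo] --> dot w v.
Proof.
move=> uv; apply: (cvg_sumr (F := fun i m => w i ord0 * u m i ord0)) => i.
by apply: cvgM; [exact: cvg_cst|exact: uv].
Qed.

Lemma dotD w u v : dot w (u + v) = dot w u + dot w v.
Proof. by rewrite /dot -big_split; apply: eq_bigr => i _; rewrite !mxE mulrDr. Qed.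

Lemma dotN w u : dot w (- u) = - dot w u.
Proof. by rewrite /dot -sumrN; apply: eq_bigr => i _; rewrite !mxE mulrN. Qed.

Lemma dotB w u v : dot w (u - v) = dot w u - dot w v.
Proof. by rewrite dotD dotN. Qed.

Lemma dot_sqDZ u v (k : R) :
  dot (u + k *: v) (u + k *: v) = dot u u + 2 * k * dot u v + k ^+ 2 * dot v v.
Proof.
rewrite /dot !mulr_sumr -!big_split; apply: eq_bigr => i _ /=.
by rewrite !mxE; ring.
Qed.

Lemma dot_ge0 u : 0 <= dot u u.
Proof. by apply: sumr_ge0 => i _; rewrite -expr2 sqr_ge0. Qed.

Lemma dot_eq0 u : dot u u = 0 -> u = 0.
Proof.
move=> /eqP; rewrite psumr_eq0; last by move=> i _; rewrite -expr2 sqr_ge0.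
move=> /allP u0; apply/colP => i; rewrite mxE.
by have := u0 i; rewrite mem_index_enum => /(_ isT); rewrite -expr2 sqrf_eq0 => /eqP.
Qed.

Lemma coord_cvgB (u : nat -> 'cV[R]_n) v w : coord_cvg u v ->
  coord_cvg (fun k => u k - w) (v - w).
Proof.
move=> uv i; rewrite !mxE; under eq_fun do rewrite !mxE.
by apply: cvgB; [exact: uv|exact: cvg_cst].
Qed.

Lemma dot_sq_cvg (u : nat -> 'cV[R]_n) v : coord_cvg u v ->
  dot (u m) (u m) @[m --> \oo] --> dot v v.
Proof.
move=> uv; apply: (cvg_sumr (F := fun i m => u m i ord0 * u m i ord0)) => i.
by apply: cvgM; exact: uv.
Qed.

Lemma coord_le_dot u (B : R) : 0 <= B -> dot u u <= B ->
  forall i, `|u i ord0| <= B + 1.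
Proof.
move=> B0 uB i; have : u i ord0 ^+ 2 <= B.
  apply: le_trans uB; rewrite /dot (bigD1 i)//= -expr2 lerDl.
  by apply: sumr_ge0 => j _; rewrite -expr2 sqr_ge0.
rewrite -real_normK ?num_real//; have := normr_ge0 (u i ord0).
set x := `|_|; nra.
Qed.

(** The set contains a point [p] nearest to [h], because minimizing sequences
    are bounded; the direction is [h - p]. A point of [C] on the wrong side
    would allow to come closer to [h] along the segment from [p]. *)
Lemma strict_separation C h : convexv C -> seq_closed C -> C !=set0 -> ~ C h ->
  exists w d, 0 < d /\ forall c, C c -> d <= dot w (h - c).
Proof.
move=> cvxC clC [c0 Cc0] nCh.
pose D c := dot (c - h) (c - h).
have hi : has_inf (D @` C).
  by split; [exists (D c0), c0|exists 0 => _ [c _ <-]; exact: dot_ge0].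
set m := inf (D @` C).
have m0 : 0 <= m by apply: lb_le_inf => [|_ [c _ <-]]; [case: hi|exact: dot_ge0].
have mD c : C c -> m <= D c by move=> Cc; apply: ge_inf; [case: hi|exists c].
have /choice[c cP] (k : nat) : exists c, C c /\ D c < m + k.+1%:R^-1.
  have k0 : (0 : R) < k.+1%:R^-1 by rewrite invr_gt0.
  by have [_ [c Cc <-] cm] := inf_adherent k0 hi; exists c.
have [|tau [p' [tm cp]]] := @bounded_extraction (fun k => c k - h) (m + 1 + 1).
  move=> k; apply: coord_le_dot; first by rewrite addr_ge0.
  rewrite (le_trans (ltW (cP k).2))// lerD2l invf_le1// ler1n//.
pose p := p' + h.
have cp' : coord_cvg (c \o tau) p.
  have -> : c \o tau = fun k => ((fun k => c k - h) \o tau) k - (- h).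
    by apply/funext => k /=; rewrite opprK subrK.
  by rewrite /p -[h in p' + h]opprK; exact: coord_cvgB.
have Cp : C p by apply: clC cp' => k; case: (cP (tau k)).
have Dp : D p <= m.
  have -> : D p = dot p' p' by rewrite /D /p addrK.
  apply/ler_addgt0Pr => e e0.
  have e2 : 0 < e / 2 by rewrite divr_gt0.
  have /cvgrPdist_lt/(_ _ e2) pk := dot_sq_cvg cp.
  near \oo => k.
  have pk' : `|dot p' p' - D (c (tau k))| < e / 2 by near: k; exact: pk.
  have k2 : k.+1%:R^-1 < e / 2 by near: k; exact: (near_infty_natSinv_lt (PosNum e2)).
  have : D (c (tau k)) < m + e / 2.
    apply: (lt_le_trans (cP (tau k)).2); rewrite lerD2l.
    apply: le_trans (ltW k2); rewrite lef_pV2 ?posrE// ler_nat ltnS.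
    exact: tm.
  move: pk'; rewrite ltr_norml => /andP[_]; lra.
exists (h - p), (dot (h - p) (h - p)); split.
  rewrite lt_neqAle dot_ge0 andbT eq_sym; apply/eqP => /dot_eq0/subr0_eq hp.
  by apply: nCh; rewrite hp.
move=> c1 Cc1.
suff : 0 <= dot (h - p) (p - c1).
  move=> ?; have -> : h - c1 = (h - p) + (p - c1) by rewrite addrA subrK.
  by rewrite [leRHS]dotD lerDl.
rewrite leNgt; apply/negP; set x := dot _ _ => x0.
pose N := dot (c1 - p) (c1 - p); have N0 : 0 <= N := dot_ge0 _.
have k0 : 0 < N + 1 - x by lra.
(* the distance to h along the segment is quadratic in l with slope 2 * x < 0
   at 0; this l is small enough for the slope to win *)
pose l := - x / (N + 1 - x).
have l0 : 0 < l by rewrite divr_gt0// oppr_gt0.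
have l1 : l <= 1 by rewrite ler_pdivrMr// mul1r; lra.
have := mD (l *: c1 + (1 - l) *: p) (cvxC _ _ _ _ Cc1 Cp).
rewrite l1 (ltW l0) => /(_ isT).
have -> : D (l *: c1 + (1 - l) *: p) = D p + l * (2 * x + l * N).
  have -> : D (l *: c1 + (1 - l) *: p) =
      dot ((p - h) + l *: (c1 - p)) ((p - h) + l *: (c1 - p)).
    by rewrite /D; congr dot; apply/colP => i; rewrite !mxE; ring.
  rewrite dot_sqDZ.
  have -> : dot (p - h) (c1 - p) = x.
    by apply: eq_bigr => i _; rewrite !mxE; ring.
  by rewrite /D -/N; ring.
have lN : l * N <= - x.
  rewrite /l mulrAC ler_pdivrMr; last exact: k0.
  apply: ler_wpM2l; first by rewrite oppr_ge0 ltW.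
  by rewrite -addrA lerDl subr_ge0 (le_trans (ltW x0)).
have : l * (2 * x + l * N) < 0 by rewrite pmulr_rlt0//; lra.
lra.
Unshelve. all: by end_near. Qed.

End separation.

(** * Differential inclusions with convex values *)

Section inclusion.
Context {R : realType} {n : nat}.
Notation mu := (@lebesgue_measure R).
Implicit Types (u v w c : 'cV[R]_n) (C : set 'cV[R]_n).

Definition ratv (q : 'cV[rat]_n) : 'cV[R]_n := map_mx ratr q.

(** Otherwise a hyperplane strictly separates [h] from [C], and so does one
    with a rational normal [q], as the limit points are bounded. But the [u m]
    with [dot q (u m)] nearly as large as [dot q h] accumulate at a point of
    [C]. *)
Lemma mem_of_limit_points C (h : 'cV[R]_n) (u : nat -> 'cV[R]_n) (B : R) :
  convexv C -> seq_closed C -> (forall m i, `|u m i ord0| <= B) ->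
  (forall (tau : nat -> nat) l, (forall m, (m <= tau m)%N) ->
     coord_cvg (u \o tau) l -> C l) ->
  (forall (q : 'cV[rat]_n) M (e : R), 0 < e -> exists2 m, (M <= m)%N &
     dot (ratv q) h - e < dot (ratv q) (u m)) ->
  C h.
Proof.
move=> cvxC clC uB limC qh; apply: contrapT => nCh.
have [|w [d [d0 wd]]] := strict_separation cvxC clC _ nCh.
  have [tau [l [tm tl]]] := bounded_extraction uB.
  by exists l; exact: limC tl.
pose K := \sum_i (`|h i ord0| + `|B|).
have K0 : 0 <= K by apply: sumr_ge0 => i _; rewrite addr_ge0.
(* replacing the normal w by a rational one this close changes the gap d by at
   most d / 4 *)
pose eta := d / (4 * (K + 1)).
have eta0 : 0 < eta by rewrite divr_gt0// mulr_gt0// ltr_wpDl.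
have /choice[q0 q0P] (i : 'I_n) : exists q : rat, `|w i ord0 - ratr q| < eta.
  have [q] := rat_in_itvoo (ltr_pwDr eta0 (lexx (w i ord0))).
  rewrite in_itv/= => /andP[wq qw]; exists q.
  by rewrite distrC ltr_norml ltrBrDr ltrBlDl qw andbT addrC (lt_trans _ wq)// gtrBl.
pose q : 'cV[rat]_n := \col_i q0 i.
have d4 : 0 < d / 4 by rewrite divr_gt0.
have /choice[t tP] (M : nat) : exists m, (M <= m)%N /\
    dot (ratv q) h - d / 4 < dot (ratv q) (u m).
  by have [m Mm hm] := qh q M _ d4; exists m.
have [tau [l [tm tl]]] := @bounded_extraction _ _ (u \o t) B (fun m i => uB (t m) i).
have Cl : C l.
  apply: (limC (t \o tau)) tl => m.
  exact: leq_trans (tm m) (tP (tau m)).1.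
have lB i : `|l i ord0| <= B.
  apply: (cvgr_to_le (cvg_norm (tl i))).
  by apply: nearW => m /=.
have ql : dot (ratv q) (h - l) <= d / 4.
  rewrite dotB lerBlDl -lerBlDr.
  apply: (cvgr_to_ge (dot_cvg (w := ratv q) tl)); apply: nearW => m /=.
  by rewrite ltW// (tP (tau m)).2.
have := wd _ Cl.
have -> : dot w (h - l) = dot (ratv q) (h - l) + dot (w - ratv q) (h - l).
  by rewrite /dot -big_split; apply: eq_bigr => i _; rewrite !mxE/=; ring.
have : dot (w - ratv q) (h - l) <= eta * K.
  rewrite /dot /K mulr_sumr; apply: ler_sum => i _.
  rewrite !mxE; apply: (le_trans (ler_norm _)); rewrite normrM.
  apply: ler_pM => //; first by have := q0P i; exact: ltW.
  rewrite (le_trans (ler_normB _ _))// lerD2l (le_trans (lB i))//.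
  exact: ler_norm.
have : eta * K <= d / 4.
  have -> : d / 4 = eta * (K + 1).
    by rewrite /eta; field; rewrite gt_eqF// ltr_wpDl.
  by rewrite ler_pM2l// lerDl.
lra.
Qed.

Definition vitg (h : R -> 'cV[R]_n) s t : 'cV[R]_n :=
  \col_i itg (fun r => h r i ord0) s t.

(** Explicit Euler scheme with [N] steps of length [d]: during a step the
    velocity belongs to the state at its beginning, here [s], of which only
    the distance to [r] matters. *)
Lemma euler_polygon (G : R -> 'cV[R]_n -> set 'cV[R]_n) (phi : R -> R) a d
    (x0 : 'cV[R]_n) N :
  (forall r, 0 <= phi r) ->
  (forall x, exists g : R -> 'cV[R]_n,
     [/\ forall i, measurable_fun setT (fun r => g r i ord0),
         forall r i, `|g r i ord0| <= phi r &
         {ae mu, forall r, G r x (g r)}]) ->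
  0 < d ->
  exists u : R -> 'cV[R]_n, [/\
    forall i, measurable_fun setT (fun r => u r i ord0),
    forall r i, `|u r i ord0| <= phi r &
    {ae mu, forall r, a < r <= a + d *+ N ->
      exists s, [/\ a <= s <= r, r - s <= d & G r (x0 + vitg u a s) (u r)]}].
Proof.
move=> phi0 sel d0; elim: N => [|N [u [mu_ uphi uG]]].
  exists (fun=> 0); split => [i|r i|].
  - by under eq_fun do rewrite mxE; exact: measurable_cst.
  - by rewrite mxE normr0.
  - apply: nearW => r; rewrite mulr0n addr0 => /andP[ar ra].
    by have := lt_le_trans ar ra; rewrite ltxx.
have [g [mg gphi gG]] := sel (x0 + vitg u a (a + d *+ N)).
pose u' r := if r <= a + d *+ N then u r else g r.
have vE s : s <= a + d *+ N -> vitg u' a s = vitg u a s.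
  move=> sN; apply/colP => i; rewrite !mxE; apply: eq_Rintegral => r.
  by rewrite inE/= in_itv/= => /andP[_ rs]; rewrite /u' (le_trans rs sN).
exists u'; split => [i|r i|].
- have -> : (fun r => u' r i ord0) =
      fun r => if r <= a + d *+ N then u r i ord0 else g r i ord0.
    by apply/funext => r; rewrite /u'; case: ifP.
  apply: measurable_fun_if => //.
  + by apply: measurable_fun_ler => //; exact: measurable_cst.
  + exact: measurable_funTS.
  + exact: measurable_funTS.
- by rewrite /u'; case: ifP.
- apply: filterS2 uG gG => r uGr gGr /andP[ar]; rewrite mulrSr addrA => rN.
  rewrite /u'; case: leP => rN'.
    have [|s [/andP[as_ sr] rsd Gr]] := uGr; first by rewrite ar.
    by exists s; split; [rewrite as_|by []|rewrite vE// (le_trans sr)].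
  exists (a + d *+ N); split.
  + by rewrite lerDl mulrn_wge0 ?ltW.
  + by rewrite lerBlDl.
  + by rewrite vE.
Qed.

Lemma coord_vitgB (h : R -> 'cV[R]_n) a s t : (forall i, Lint (fun r => h r i ord0)) ->
  a <= s -> s <= t -> vitg h a t - vitg h a s = vitg h s t.
Proof.
move=> Ih as_ st; apply/colP => i; rewrite !mxE.
by rewrite (itg_chasles (Ih i) as_ st) addrAC subrr add0r.
Qed.

Lemma itg_dot q (h : R -> 'cV[R]_n) s t : (forall i, Lint (fun r => h r i ord0)) ->
  itg (fun r => dot q (h r)) s t = dot q (vitg h s t).
Proof.
move=> Ih; rewrite /dot itg_sum => [|i]; last exact: LintZ.
by apply: eq_bigr => i _; rewrite itgZ// mxE.
Qed.

Lemma Lint_dot q (h : R -> 'cV[R]_n) : (forall i, Lint (fun r => h r i ord0)) ->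
  Lint (fun r => dot q (h r)).
Proof. by move=> Ih; apply: Lint_sum => i; exact: LintZ. Qed.

Lemma norm_dot_le q u (B : R) : (forall i, `|u i ord0| <= B) ->
  `|dot q u| <= (\sum_i `|q i ord0|) * B.
Proof.
move=> uB; rewrite (le_trans (ler_norm_sum _ _ _))// mulr_suml.
by apply: ler_sum => i _; rewrite normrM ler_wpM2l.
Qed.

Lemma cvg_geid (tau : nat -> nat) : (forall m, (m <= tau m)%N) ->
  tau m @[m --> \oo] --> \oo.
Proof.
move=> tm A [N _ NA]; exists N => // m /= Nm.
by apply: NA => /=; exact: leq_trans (tm m).
Qed.

(** Euler polygons with ever more steps converge along a subsequence to some
    [x], which has a density [h]. For rational [q] the integral of [dot q h]
    over an interval is the limit of the integrals of [dot q u], hence at most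
    that of the supremum of any tail; so almost everywhere [dot q h] is at
    most the upper limit of [dot q u]. The limit points of the velocities [u k
    t] lie in [G t (x t)] by the closed graph, and [mem_of_limit_points] puts
    [h t] there too. *)
Theorem differential_inclusion (G : R -> 'cV[R]_n -> set 'cV[R]_n)
    (phi : R -> R) a b (x0 : 'cV[R]_n) : a < b ->
  Lint phi -> (forall r, 0 <= phi r) ->
  (forall x, exists g : R -> 'cV[R]_n,
     [/\ forall i, measurable_fun setT (fun r => g r i ord0),
         forall r i, `|g r i ord0| <= phi r &
         {ae mu, forall r, G r x (g r)}]) ->
  (forall t x, convexv (G t x)) ->
  (forall t (xs us : nat -> 'cV[R]_n) x u, (forall k, G t (xs k) (us k)) ->
     coord_cvg xs x -> coord_cvg us u -> G t x u) ->
  exists2 h : R -> 'cV[R]_n, forall i, Lint (fun r => h r i ord0) &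
    {ae mu, forall t, a < t < b -> G t (x0 + vitg h a t) (h t)}.
Proof.
move=> ab Iphi phi0 sel cvxG clG.
pose d (k : nat) := (b - a) / k.+1%:R.
have d0 k : 0 < d k by rewrite divr_gt0// subr_gt0.
have /choice[u uP] (k : nat) := euler_polygon a x0 k.+1 phi0 sel (d0 k).
have abd k : a + d k *+ k.+1 = b.
  by rewrite /d -mulr_natr divfK// addrC subrK.
have mu_ k i : measurable_fun setT (fun r => u k r i ord0) by have [] := uP k.
have uphi k r i : `|u k r i ord0| <= phi r by have [] := uP k.
have Iu k i : Lint (fun r => u k r i ord0).
  by apply: Lint_le_ae Iphi _ => //; exact: nearW.
pose X k t := x0 + vitg (u k) a t.
have Xphi k s t i : a <= s -> s <= t -> t <= b ->
    `|X k t i ord0 - X k s i ord0| <= itg phi s t.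
  move=> as_ st tb; have -> : X k t i ord0 - X k s i ord0 = vitg (u k) s t i ord0.
    by rewrite -(coord_vitgB (Iu k) as_ st) !mxE; ring.
  by rewrite mxE; apply: norm_itg_le => //; apply: nearW => r _.
have Xa k : X k a = x0.
  by apply/colP => i; rewrite !mxE itgge// addr0.
have [sigma [x [sm sx]]] := equicontinuous_extraction (ltW ab) Iphi phi0 Xa Xphi.
have xphi i s t : a <= s -> s <= t -> t <= b ->
    `|x t i ord0 - x s i ord0| <= itg phi s t.
  move=> as_ st tb.
  have abs_ : a <= s <= b by rewrite as_ (le_trans st).
  have abt : a <= t <= b by rewrite tb (le_trans as_).
  apply: (cvgr_to_le (cvg_norm (cvgB (sx t i abt) (sx s i abs_)))).
  by apply: nearW => m /=; exact: Xphi.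
have /choice[h0 h0P] (i : 'I_n) : exists h, Lint h /\
    forall t, a <= t <= b -> x t i ord0 = x a i ord0 + itg h a t.
  have [h Ih hE] := dominated_density (ltW ab) Iphi phi0 (xphi i).
  by exists h.
pose h t : 'cV[R]_n := \col_i h0 i t.
have Ih i : Lint (fun r => h r i ord0).
  by under [X in EFin \o X]eq_fun do rewrite mxE; have [] := h0P i.
have xa : x a = x0.
  apply/colP => i; apply: (@cvg_unique _ _ ((fun m => X (sigma m) a i ord0) @ \oo)) => //.
    by apply: sx; rewrite lexx ltW.
  rewrite (_ : (fun _ => _) = fun=> x0 i ord0); first exact: cvg_cst.
  by apply/funext => m; rewrite Xa.
have xE t : a <= t <= b -> x t = x0 + vitg h a t.
  move=> abt; apply/colP => i; rewrite !mxE (h0P i).2// xa; congr (_ + itg _ _ _).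
  by apply/funext => r; rewrite mxE.
exists h => //.
(* the inequality between q.h and the supremum of the tail of the q.u that
   starts at M *)
have main (qM : 'cV[rat]_n * nat) : {ae mu, forall t, a < t < b ->
    dot (ratv qM.1) (h t) <= sups (fun m => dot (ratv qM.1) (u (sigma m) t)) qM.2}.
  case: qM => q M /=; set cq := \sum_i `|ratv q i ord0|.
  have wb r m : `|dot (ratv q) (u (sigma m) r)| <= cq * phi r by exact: norm_dot_le.
  have ub r : has_ubound (range (fun m => dot (ratv q) (u (sigma m) r))).
    by exists (cq * phi r) => _ [m _ <-]; rewrite (le_trans (ler_norm _)).
  have hs r N : has_sup (sdrop (fun m => dot (ratv q) (u (sigma m) r)) N).
    split; first by exists (dot (ratv q) (u (sigma N) r)), N => /=.
    by exists (cq * phi r) => _ [m _ <-]; rewrite (le_trans (ler_norm _)).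
  have sup_ge r N m : (N <= m)%N -> dot (ratv q) (u (sigma m) r) <=
      sups (fun m => dot (ratv q) (u (sigma m) r)) N.
    by move=> Nm; apply: ub_le_sup; [case: (hs r N)|exists m].
  have Isup : Lint (fun r => sups (fun m => dot (ratv q) (u (sigma m) r)) M).
    apply: (Lint_le_ae (g := fun r => cq * phi r)).
    - apply: (@measurable_fun_sups _ _ _ setT (fun m r => dot (ratv q) (u (sigma m) r))) => // m.
      by apply: Lint_measurable; exact: Lint_dot.
    - exact: LintZ.
    - apply: nearW => r; rewrite ler_norml; apply/andP; split.
        apply: le_trans (sup_ge r M M (leqnn M)).
        by have := wb r M; rewrite ler_norml => /andP[].
      apply: ge_sup; first by case: (hs r M).
      by move=> _ [m _ <-]; rewrite (le_trans (ler_norm _)).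
  apply: itg_le_ae => //; first exact: Lint_dot.
  move=> s t as_ st tb; rewrite itg_dot//.
  have -> : vitg h s t = x t - x s.
    rewrite (xE t) ?(xE s) ?as_ ?tb ?(le_trans as_ st) ?(le_trans st tb)//.
    by rewrite -(coord_vitgB Ih as_ st); apply/colP => i; rewrite !mxE; ring.
  have cX : coord_cvg (fun m => X (sigma m) t - X (sigma m) s) (x t - x s).
    move=> i; rewrite (_ : (fun m => _) =
        fun m => X (sigma m) t i ord0 - X (sigma m) s i ord0); last first.
      by apply/funext => m; rewrite [LHS]mxE [X in _ + X]mxE.
    rewrite mxE [X in _ + X]mxE.
    by apply: cvgB; apply: sx; rewrite ?as_ ?tb ?(le_trans as_ st) ?(le_trans st tb).
  apply: (cvgr_to_le (dot_cvg (w := ratv q) cX)).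
  near=> m; have -> : X (sigma m) t - X (sigma m) s = vitg (u (sigma m)) s t.
    by rewrite -(coord_vitgB (Iu _) as_ st); apply/colP => i; rewrite !mxE; ring.
  rewrite -itg_dot//; apply: le_itg => //; first exact: Lint_dot.
  apply: nearW => r _; apply: sup_ge; near: m; exact: nbhs_infty_ge.
have eul (k : nat) : {ae mu, forall r, a < r <= b ->
      exists s, [/\ a <= s <= r, r - s <= d k & G r (X k s) (u k r)]}.
  by have [_ _] := uP k; rewrite abd.
have := ae_forall_count main; have := ae_forall_count eul.
apply: filterS2 => t tE tM /andP[at_ tb].
have abt : a <= t <= b by rewrite !ltW.
rewrite -xE//.
have /choice[s sP] k : exists s, [/\ a <= s <= t, t - s <= d k & G t (X k s) (u k t)].
  by apply: tE; rewrite at_ ltW.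
apply: (@mem_of_limit_points _ _ (fun m => u (sigma m) t) (phi t)) => //.
- move=> us l Gus usl; apply: (clG t (fun=> x t) us) => // i; exact: cvg_cst.
- move=> tau l tm ul; apply: (clG t (fun m => X (sigma (tau m)) (s (sigma (tau m))))
    (fun m => u (sigma (tau m)) t)) => //.
    by move=> k; have [] := sP (sigma (tau k)).
  move=> i; apply/cvgrPdist_lt => e e0.
  have e2 : 0 < e / 2 by rewrite divr_gt0.
  have [dl dl0 hdl] := itg_small Iphi e2.
  have := cvg_comp _ _ (cvg_geid tm) (sx t i abt).
  move=> /cvgrPdist_lt/(_ _ e2) near1.
  have bd0 : 0 < dl / (b - a) by rewrite divr_gt0// subr_gt0.
  near=> m.
  have xX : `|x t i ord0 - X (sigma (tau m)) t i ord0| < e / 2 by near: m.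
  set k := sigma (tau m) in xX *.
  have [/andP[as_ st] tsd _] := sP k.
  rewrite (splitr e) (le_lt_trans (ler_distD (X k t i ord0) _ _))// ltrD//.
  apply: (le_lt_trans (Xphi k (s k) t i as_ st (ltW tb))).
  apply: le_lt_trans (hdl (s k) t st _).
    by apply: le_itg => //; [exact: Lint_norm|apply: nearW => r _; exact: ler_norm].
  apply: (le_lt_trans tsd); rewrite /d mulrC -ltr_pdivlMr ?subr_gt0//.
  apply: (@le_lt_trans _ _ m.+1%:R^-1).
    rewrite lef_pV2 ?posrE// ler_nat ltnS.
    exact: leq_trans (tm m) (sm _).
  by near: m; exact: (near_infty_natSinv_lt (PosNum bd0)).
- move=> q M e e0; have := tM (q, M); rewrite at_ tb => /(_ isT) /= le.
  have hs : has_sup (sdrop (fun m => dot (ratv q) (u (sigma m) t)) M).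
    split; first by exists (dot (ratv q) (u (sigma M) t)), M => /=.
    exists ((\sum_i `|ratv q i ord0|) * phi t) => _ [m _ <-].
    by rewrite (le_trans (ler_norm _))// norm_dot_le.
  have [_ [m /= Mm <-] lt] := sup_adherent e0 hs.
  by exists m => //; apply: le_lt_trans lt; rewrite lerD2r.
Unshelve. all: by end_near. Qed.

End inclusion.

(** * Measurable selections *)

Section coordinatewise_convergence.
Context {R : realType} {p : nat}.

Lemma coord_cvg_cvg (u : nat -> 'cV[R]_p) v : coord_cvg u v ->
  u m @[m --> \oo] --> v.
Proof.
move=> uv; apply/cvg_ballP => e e0.
have : \forall m \near \oo, forall i, ball (v i ord0) e (u m i ord0).
  by apply: filter_forall => i; have /cvg_ballP/(_ e e0) := uv i.
by apply: filterS => m um; split => // i j; rewrite (ord1 j).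
Qed.

Lemma continuous_coord_cvg (h : 'cV[R]_p -> R) (u : nat -> 'cV[R]_p) v :
  continuous h -> coord_cvg u v -> h (u m) @[m --> \oo] --> h v.
Proof. by move=> ch /coord_cvg_cvg uv; apply: continuous_cvg => //; exact: ch. Qed.

Lemma rational_approx (v : 'cV[R]_p) : exists q : nat -> 'cV[rat]_p,
  coord_cvg (fun k => ratv (R := R) (q k)) v.
Proof.
have /choice[q qP] (ki : nat * 'I_p) : exists q : rat,
    `|v ki.2 ord0 - ratr q| < ki.1.+1%:R^-1.
  have k0 : (0 : R) < ki.1.+1%:R^-1 by rewrite invr_gt0.
  have [q] := rat_in_itvoo (ltr_pwDr k0 (lexx (v ki.2 ord0))).
  rewrite in_itv/= => /andP[wq qw]; exists q.
  by rewrite distrC ltr_norml ltrBrDr ltrBlDl qw andbT addrC (lt_trans _ wq)// gtrBl.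
exists (fun k => \col_i q (k, i)) => i; apply/cvgrPdist_lt => e e0.
near=> k; rewrite !mxE; apply: (lt_trans (qP (k, i))).
by near: k; exact: (near_infty_natSinv_lt (PosNum e0)).
Unshelve. all: by end_near. Qed.

End coordinatewise_convergence.

Section selection.
Context {R : realType} d (T : measurableType d) (p : nat) (I : set T).
Hypothesis mI : measurable I.
Implicit Types H g : T -> 'cV[R]_p -> R.

Definition carath g := (forall t, I t -> continuous (g t)) /\
  (forall xi, measurable_fun I (g ^~ xi)).

(** Only the zeros of [H] are of interest; a bound on one sublevel set above
    zero makes approximate zeros accumulate. *)
Definition coercive H := forall t, I t ->
  exists B : R, forall xi, H t xi <= 1 -> forall i, `|xi i ord0| <= B.

Definition ge0fam H := forall t xi, I t -> 0 <= H t xi.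

Lemma carathD g h : carath g -> carath h -> carath (fun t xi => g t xi + h t xi).
Proof.
move=> [cg mg] [ch mh]; split => [t It xi|xi].
  exact: (continuousD (cg t It xi) (ch t It xi)).
exact: measurable_funD.
Qed.

Lemma carath_sum (J : Type) (l : seq J) (P : pred J) (F : J -> T -> 'cV[R]_p -> R) :
  (forall j, carath (F j)) -> carath (fun t xi => \sum_(j <- l | P j) F j t xi).
Proof.
move=> cF; elim: l => [|j l ih].
  split => [t It|xi].
    by under eq_fun do rewrite big_nil; exact: cst_continuous.
  by under eq_fun do rewrite big_nil; exact: measurable_cst.
have -> : (fun t xi => \sum_(j <- j :: l | P j) F j t xi) =
    fun t xi => (if P j then F j t xi else 0) + \sum_(j <- l | P j) F j t xi.
  by apply/funext => t; apply/funext => xi; rewrite big_cons; case: ifP; rewrite ?add0r.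
apply: carathD; last exact: ih.
case: (P j); first exact: cF.
split => [t It|xi].
  exact: cst_continuous.
exact: measurable_cst.
Qed.

Lemma carath_dist i (y : T -> R) : measurable_fun I y ->
  carath (fun t xi => `|xi i ord0 - y t|).
Proof.
move=> my; split => [t It xi|xi].
  have c0 := continuousB (@coord_continuous R p 1 i ord0 xi) (@cst_continuous _ _ (y t) xi).
  exact: (continuous_comp c0 (@norm_continuous _ R^o _)).
apply: measurableT_comp => //; apply: measurable_funB => //.
Qed.

Lemma carath_pospart (c : R) g : carath g ->
  carath (fun t xi => Num.max (c - g t xi) 0).
Proof.
move=> [cg mg]; split => [t It xi|xi].
  have cb : {for xi, continuous (fun xi => c - g t xi)}.
    exact: (continuousB (@cst_continuous _ _ c xi) (cg t It xi)).
  exact: (continuous_max cb (@cst_continuous _ _ 0 xi)).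
apply: measurable_maxr; last exact: measurable_cst.
by apply: measurable_funB => //; exact: measurable_cst.
Qed.

Lemma coercive_le H H' : coercive H ->
  (forall t xi, I t -> H t xi <= H' t xi) -> coercive H'.
Proof.
move=> cH HH' t It; have [B HB] := cH t It.
by exists B => xi ? i; apply: HB; exact: le_trans (HH' t xi It) _.
Qed.

(** By compactness, [H t] has a zero as soon as it takes arbitrarily small
    values, and by continuity the rational points decide this. *)
Lemma measurable_zero H : carath H -> ge0fam H -> coercive H ->
  measurable [set t | I t /\ exists xi, H t xi = 0].
Proof.
move=> [cH mH] H0 coH.
have -> : [set t | I t /\ exists xi, H t xi = 0] =
   \bigcap_k \bigcup_n (if unpickle n is Some q then
      I `&` [set t | H t (ratv (q : 'cV[rat]_p)) < k.+1%:R^-1] else set0).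
  apply/seteqP; split => [t [It [xi Hxi]] k _|t Ht].
    have [q qxi] := rational_approx xi.
    have k0 : (0 : R) < k.+1%:R^-1 by rewrite invr_gt0.
    have /cvgrPdist_lt/(_ _ k0) := continuous_coord_cvg (cH t It) qxi.
    rewrite Hxi => -[N _ /(_ N (leqnn N))/=]; rewrite sub0r normrN => HN.
    exists (pickle (q N)); [exact: Logic.I|rewrite pickleK; split => //=].
    exact: le_lt_trans (ler_norm _) HN.
  have It : I t.
    by have [n _] := Ht 0%N Logic.I; case: unpickle => // q [].
  split => //.
  have /choice[q qP] k : exists q : 'cV[rat]_p, H t (ratv q) < k.+1%:R^-1.
    have [n _] := Ht k Logic.I; case: unpickle => // q [_ /= Hq]; by exists q.
  have [B HB] := coH t It.
  have [|tau [xi [tm txi]]] := @bounded_extraction _ _ (fun k => ratv (q k)) B.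
    move=> k i; apply: HB; apply: (le_trans (ltW (qP k))).
    by rewrite invf_le1// ler1n.
  exists xi; apply/eqP; rewrite eq_le H0// andbT.
  apply/ler_addgt0Pr => e e0; rewrite add0r.
  apply: (cvgr_to_le (continuous_coord_cvg (cH t It) txi)).
  near=> k; apply/ltW; apply: (lt_trans (qP (tau k))).
  apply: (@le_lt_trans _ _ k.+1%:R^-1).
    by rewrite lef_pV2 ?posrE// ler_nat ltnS.
  by near: k; exact: (near_infty_natSinv_lt (PosNum e0)).
apply: bigcapT_measurable => k; apply: bigcupT_measurable => n.
case: unpickle => // q.
have := mH (ratv q) mI `]-oo, k.+1%:R^-1[%classic (measurable_itv _).
by congr measurable; apply/seteqP; split => t [It] /=; rewrite in_itv.
Unshelve. all: by end_near. Qed.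

(** The maximum of [g t] over the zeros of [H t] is at least [c] exactly when
    [H t] plus the positive part of [c - g t] has a zero, a condition that
    [measurable_zero] covers. *)
Lemma argmax_measurable H g : carath H -> ge0fam H -> coercive H ->
  carath g -> (forall t, I t -> exists xi, H t xi = 0) ->
  exists m : T -> R, [/\ measurable_fun I m,
    forall t, I t -> exists xi, H t xi = 0 /\ g t xi = m t &
    forall t xi, I t -> H t xi = 0 -> g t xi <= m t].
Proof.
move=> cH H0 coH cg ne.
have /choice[m mP] t : exists m, I t -> (exists xi, H t xi = 0 /\ g t xi = m) /\
    forall xi, H t xi = 0 -> g t xi <= m.
  have [It|nIt] := pselect (I t); last by exists 0.
  have [B HB] := coH t It.
  have bz xi i : H t xi = 0 -> `|xi i ord0| <= B by move=> Hxi; rewrite HB// Hxi.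
  have lim_zero (u : nat -> 'cV[R]_p) v : (forall k, H t (u k) = 0) ->
      coord_cvg u v -> H t v = 0.
    move=> u0 uv; have := continuous_coord_cvg (cH.1 t It) uv.
    under eq_fun do rewrite u0.
    by move=> /(cvg_unique _ (cvg_cst _)) <-.
  pose A := g t @` [set xi | H t xi = 0].
  have A0 : A !=set0 by have [xi Hxi] := ne t It; exists (g t xi), xi.
  have ubA : has_ubound A.
    apply: contrapT => nub.
    have /choice[u uP] k : exists xi, H t xi = 0 /\ k%:R < g t xi.
      apply: contrapT => nex; apply: nub; exists k%:R => _ [xi Hxi <-].
      by rewrite leNgt; apply/negP => lt; apply: nex; exists xi.
    have [|tau [xi [tm txi]]] := @bounded_extraction _ _ u B.
      by move=> k i; apply: bz; case: (uP k).
    have gc := continuous_coord_cvg (cg.1 t It) txi.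
    have /cvgrPdist_lt/(_ 1 ltr01) gb := gc.
    near \oo => k.
    have g1 : `|g t xi - g t ((u \o tau) k)| < 1 by near: k.
    have gk : g t xi + 1 < k%:R by near: k; exact: nbhs_infty_gtr.
    have [_ /=] := uP (tau k); move: g1; rewrite /= ltr_norml => /andP[+ _].
    have : (k%:R : R) <= (tau k)%:R by rewrite ler_nat.
    lra.
  have hs : has_sup A by [].
  exists (sup A) => _; split; last first.
    by move=> xi Hxi; apply: ub_le_sup => //; exists xi.
  have /choice[u uP] k : exists xi, H t xi = 0 /\ sup A - k.+1%:R^-1 < g t xi.
    have k0 : (0 : R) < k.+1%:R^-1 by rewrite invr_gt0.
    by have [_ [xi Hxi <-] lt] := sup_adherent k0 hs; exists xi.
  have [|tau [xi [tm txi]]] := @bounded_extraction _ _ u B.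
    by move=> k i; apply: bz; case: (uP k).
  have Hxi : H t xi = 0 by apply: lim_zero txi => k; case: (uP (tau k)).
  exists xi; split => //; apply/eqP; rewrite eq_le; apply/andP; split.
    by apply: ub_le_sup => //; exists xi.
  apply/ler_addgt0Pr => e e0; rewrite -lerBlDr.
  apply: (cvgr_to_ge (continuous_coord_cvg (cg.1 t It) txi)).
  near=> k; apply: ltW; apply: lt_trans (uP (tau k)).2.
  rewrite ltrD2l ltrN2; apply: (@le_lt_trans _ _ k.+1%:R^-1).
    by rewrite lef_pV2 ?posrE// ler_nat ltnS.
  by near: k; exact: (near_infty_natSinv_lt (PosNum e0)).
exists m; split; last 2 first.
- by move=> t It; case: (mP t It).
- by move=> t xi It; case: (mP t It) => _; exact.
move=> _; apply: (measurability _ (measurable_realfun.RGenCInfty.measurableE R)) => //.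
move=> _ [_ [c ->] <-].
have -> : I `&` m @^-1` `[c, +oo[%classic = [set t | I t /\
    exists xi, H t xi + Num.max (c - g t xi) 0 = 0].
  apply/seteqP; split => t [It]; rewrite /= in_itv/= andbT => ct; split => //.
    have [[xi [Hxi gxi]] _] := mP t It.
    by exists xi; rewrite Hxi add0r gxi; apply/max_idPr; rewrite subr_le0.
  have [xi /eqP] := ct; rewrite paddr_eq0 ?H0 ?le_max ?lexx ?orbT// => /andP[/eqP Hxi].
  move=> /eqP mx; have [_ /(_ xi Hxi)] := mP t It; apply: le_trans.
  by rewrite -subr_le0 -mx le_max lexx.
apply: measurable_zero.
- by apply: carathD => //; exact: carath_pospart.
- by move=> t xi It; rewrite addr_ge0 ?H0// le_max lexx orbT.
- by apply: coercive_le coH _ => t xi It; rewrite lerDl le_max lexx orbT.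
Unshelve. all: by end_near. Qed.

(** The point [y t] is the only zero of the distance to [y t], so [g t (y t)]
    is the maximum of [g t] over the zeros of that distance. *)
Lemma carath_comp_measurable g (y : T -> 'cV[R]_p) : carath g ->
  (forall i, measurable_fun I (fun t => y t i ord0)) ->
  measurable_fun I (fun t => g t (y t)).
Proof.
move=> cg my.
pose H t (xi : 'cV[R]_p) := \sum_i `|xi i ord0 - y t i ord0|.
have Hy t xi : H t xi = 0 -> xi = y t.
  move=> /eqP; rewrite psumr_eq0// => /allP xy; apply/colP => i.
  have := xy i; rewrite mem_index_enum => /(_ isT).
  by rewrite normr_eq0 subr_eq0 => /eqP.
have [||||t It|m [mm mg _]] := @argmax_measurable H g.
- by apply: carath_sum => i; exact: carath_dist.
- by move=> t xi It; exact: sumr_ge0.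
- move=> t It; exists (1 + \sum_i `|y t i ord0|) => xi Hxi i.
  rewrite -[xi i ord0](subrK (y t i ord0)) (le_trans (ler_normD _ _))// lerD//.
    apply: le_trans Hxi; rewrite /H (bigD1 i)//= lerDl; exact: sumr_ge0.
  by rewrite (bigD1 i)//= lerDl; exact: sumr_ge0.
- exact: cg.
- by exists (y t); rewrite /H big1// => i _; rewrite subrr normr0.
apply: eq_measurable_fun mm => t /set_mem It.
by have [xi [/Hy -> ->]] := mg t It.
Qed.

(** The selected zero is the lexicographic maximum. Its coordinates are found
    one after the other: when [y] gives the first [k] of them, the next one is
    the maximum of that coordinate over the zeros of [H] plus the deviations
    from [y] in the first [k] coordinates. *)
Theorem measurable_selection H : carath H -> ge0fam H -> coercive H ->
  (forall t, I t -> exists xi, H t xi = 0) ->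
  exists y : T -> 'cV[R]_p,
    (forall i, measurable_fun I (fun t => y t i ord0)) /\
    forall t, I t -> H t (y t) = 0.
Proof.
move=> cH H0 coH ne.
have first_coords k : (k <= p)%N -> exists y : nat -> T -> R,
   (forall j, measurable_fun I (y j)) /\
   forall t, I t -> exists xi : 'cV[R]_p, H t xi = 0 /\
     forall i : 'I_p, (i < k)%N -> xi i ord0 = y i t; last first.
  have [y [my yP]] := first_coords p (leqnn p).
  exists (fun t => \col_i y i t); split => [i|t It].
    by under eq_fun do rewrite mxE; exact: my.
  have [xi [Hxi xiy]] := yP t It.
  suff -> : \col_i y i t = xi by [].
  by apply/colP => i; rewrite mxE xiy.
elim: k => [_|k ih kp].
  exists (fun _ _ => 0); split => [j|t It]; first exact: measurable_cst.
  by have [xi Hxi] := ne t It; exists xi.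
have [y [my yP]] := ih (ltnW kp).
pose ik := Ordinal kp.
pose H' t xi := H t xi + \sum_(i < p | (i < k)%N) `|xi i ord0 - y i t|.
have [|||||m [mm mP _]] := @argmax_measurable H' (fun t xi => xi ik ord0).
- apply: carathD => //; apply: carath_sum => i; exact: carath_dist.
- by move=> t xi It; rewrite addr_ge0 ?H0//; exact: sumr_ge0.
- apply: coercive_le coH _ => t xi It; rewrite lerDl; exact: sumr_ge0.
- split => [t It|xi]; first exact: coord_continuous.
  exact: measurable_cst.
- move=> t It; have [xi [Hxi xiy]] := yP t It; exists xi.
  by rewrite /H' Hxi add0r big1// => i ik'; rewrite xiy// subrr normr0.
exists (fun j => if j == k then m else y j); split => [j|t It].
  by case: ifP.
have [xi [/eqP H'xi xik]] := mP t It; exists xi.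
move: H'xi; rewrite paddr_eq0 ?H0//; last exact: sumr_ge0.
rewrite psumr_eq0// => /andP[/eqP Hxi /allP xiy]; split => // i.
rewrite ltnS leq_eqVlt => /predU1P[ik'|ik'].
  by rewrite ik' eqxx -xik; congr (xi _ ord0); exact: val_inj.
rewrite ltn_eqF//; have := xiy i; rewrite mem_index_enum ik' => /(_ isT).
by rewrite normr_eq0 subr_eq0 => /eqP.
Qed.

End selection.

(** * Norms, matrices and truncation *)

Section euclidean_norm.
Context {R : realType} {k : nat}.
Implicit Types u : 'cV[R]_k.

Lemma enorm_ge0 u : 0 <= enorm u.
Proof. exact: sqrtr_ge0. Qed.

Lemma coord_le_enorm u i : `|u i ord0| <= enorm u.
Proof.
rewrite -sqrtr_sqr ler_sqrt; last by apply: sumr_ge0 => j _; rewrite sqr_ge0.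
by rewrite (bigD1 i)//= lerDl; apply: sumr_ge0 => j _; rewrite sqr_ge0.
Qed.

Lemma enorm_le_sum u : enorm u <= \sum_i `|u i ord0|.
Proof.
have s0 : 0 <= \sum_i `|u i ord0| by exact: sumr_ge0.
rewrite -[leRHS]ger0_norm// -sqrtr_sqr ler_sqrt; last exact: sqr_ge0.
have : forall s : seq 'I_k, \sum_(i <- s) u i ord0 ^+ 2 <= (\sum_(i <- s) `|u i ord0|) ^+ 2.
  elim=> [|i s ih]; first by rewrite !big_nil expr0n.
  rewrite !big_cons sqrrD real_normK ?num_real// -addrA lerD2l.
  by rewrite (le_trans ih)// lerDr mulrn_wge0// mulr_ge0// sumr_ge0.
exact.
Qed.

Lemma enorm_le u (B : R) : (forall i, `|u i ord0| <= B) -> enorm u <= k%:R * B.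
Proof.
move=> uB; rewrite (le_trans (enorm_le_sum u))//.
rewrite -[k in leRHS]card_ord -sum1_card natr_sum mulr_suml.
by apply: ler_sum => i _; rewrite mul1r.
Qed.

Lemma enorm_measurable d (T : measurableType d) (D : set T) (g : T -> 'cV[R]_k) :
  (forall i, measurable_fun D (fun t => g t i ord0)) ->
  measurable_fun D (fun t => enorm (g t)).
Proof.
move=> mg; apply: (@measurableT_comp _ _ _ _ _ _ (@Num.sqrt R)).
  exact: continuous_measurable_fun (@sqrt_continuous R).
apply: measurable_sum => i; exact: measurable_funX.
Qed.

Lemma compact_box (s : R) : compact [set u : 'cV[R]_k | forall i, `|u i ord0| <= s].
Proof.
have cr : compact [set r : 'rV[R]_k | forall i, `[- s, s]%classic (r ord0 i)].
  by apply: (@rV_compact _ _ (fun=> `[- s, s]%classic)) => i; exact: segment_compact.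
have ct : continuous (@trmx R 1 k).
  move=> r A /nbhs_ballP[e e0 eA].
  have near_r : nbhs r [set w : 'rV[R]_k | forall i, ball (r ord0 i) e (w ord0 i)].
    have := @filter_forall _ _ (fun i (w : 'rV[R]_k) => ball (r ord0 i) e (w ord0 i))
      (nbhs r) (nbhs_filter r).
    apply => i.
    have := @coord_continuous R 1 k ord0 i r.
    by move=> /(_ _ (nbhsx_ballx (r ord0 i) e e0)).
  apply: (@filterS _ (nbhs r) (nbhs_filter r) _ _ _ near_r) => w rw.
  by apply: eA; split => // i j; rewrite !mxE (ord1 j).
have := continuous_compact (continuous_subspaceT ct) cr.
congr compact; apply/seteqP; split => [_ [r rs <-] i|u us].
  by have := rs i; rewrite mxE/= in_itv/= -ler_norml.
exists u^T; last by rewrite trmxK.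
by move=> i; rewrite /= mxE in_itv/= -ler_norml.
Qed.

End euclidean_norm.

Section matrices.
Context {R : realType}.

(** A crude bound for the operator norm that belongs to the maximum norm. *)
Definition mxsum a b (M : 'M[R]_(a, b)) : R := \sum_i \sum_j `|M i j|.

Lemma mxsum_ge0 a b (M : 'M[R]_(a, b)) : 0 <= mxsum M.
Proof. by apply: sumr_ge0 => i _; apply: sumr_ge0. Qed.

Lemma mulmx_coord_le a b (M : 'M[R]_(a, b)) (u : 'cV[R]_b) (B : R) i :
  (forall j, `|u j ord0| <= B) -> `|(M *m u) i ord0| <= mxsum M * B.
Proof.
move=> uB; rewrite mxE (le_trans (ler_norm_sum _ _ _))//.
apply: (@le_trans _ _ ((\sum_j `|M i j|) * B)).
  by rewrite mulr_suml; apply: ler_sum => j _; rewrite normrM ler_wpM2l.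
case: b M u uB => [|b] M u uB.
  by rewrite big_ord0 mul0r /mxsum big1 ?mul0r// => j _; rewrite big_ord0.
have B0 : 0 <= B := le_trans (normr_ge0 _) (uB ord0).
rewrite ler_wpM2r// /mxsum [leRHS](bigD1 i)//= lerDl.
by apply: sumr_ge0 => j _; apply: sumr_ge0.
Qed.

Lemma coord_cvgD k (u w : nat -> 'cV[R]_k) v z : coord_cvg u v -> coord_cvg w z ->
  coord_cvg (fun m => u m + w m) (v + z).
Proof.
move=> uv wz i; rewrite mxE (_ : (fun m => _) = fun m => u m i ord0 + w m i ord0).
  by apply: cvgD; [exact: uv|exact: wz].
by apply/funext => m; rewrite mxE.
Qed.

Lemma coord_cvg_cst k (v : 'cV[R]_k) : coord_cvg (fun=> v) v.
Proof. by move=> i; exact: cvg_cst. Qed.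

Lemma coord_cvg_mulmx a b (M : 'M[R]_(a, b)) (u : nat -> 'cV[R]_b) v :
  coord_cvg u v -> coord_cvg (fun m => M *m u m) (M *m v).
Proof.
move=> uv i; rewrite mxE (_ : (fun m => _) = fun m => \sum_j M i j * u m j ord0).
  apply: (cvg_sumr (F := fun j m => M i j * u m j ord0)) => j.
  by apply: cvgM; [exact: cvg_cst|exact: uv].
by apply/funext => m; rewrite mxE.
Qed.

Lemma coord_cvg_unique k (u : nat -> 'cV[R]_k) v z : coord_cvg u v -> coord_cvg u z -> v = z.
Proof.
move=> uv uz; apply/colP => i.
exact: (cvg_unique _ (uv i) (uz i)).
Qed.

Lemma measurable_mulmx d (T : measurableType d) (I : set T) a b (M : 'M[R]_(a, b))
    (g : T -> 'cV[R]_b) i :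
  (forall j, measurable_fun I (fun t => g t j ord0)) ->
  measurable_fun I (fun t => (M *m g t) i ord0).
Proof.
move=> mg; under eq_fun do rewrite mxE.
by apply: measurable_sum => j; apply: measurable_funM => //; exact: measurable_cst.
Qed.

Lemma measurable_coordD d (T : measurableType d) (I : set T) k
    (g h : T -> 'cV[R]_k) i :
  measurable_fun I (fun t => g t i ord0) -> measurable_fun I (fun t => h t i ord0) ->
  measurable_fun I (fun t => (g t + h t) i ord0).
Proof. by move=> mg mh; under eq_fun do rewrite mxE; exact: measurable_funD. Qed.

Definition clip (r z : R) : R := clamp (- r) r z.

Lemma clip_le r z : 0 <= r -> `|clip r z| <= r.
Proof.
by move=> r0; rewrite ler_norml clamp_itv// (le_trans _ r0)// oppr_le0.
Qed.

Lemma clip_id r z : `|z| <= r -> clip r z = z.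
Proof. by rewrite ler_norml; exact: clamp_id. Qed.

Lemma clip_continuous r : continuous (clip r).
Proof.
move=> z.
have c1 := continuous_min (@cst_continuous _ _ r z) (@cvg_id _ (nbhs z)).
exact: (continuous_max (@cst_continuous _ _ (- r) z) c1).
Qed.

Lemma measurable_clip d (T : measurableType d) (I : set T) (r z : T -> R) :
  measurable_fun I r -> measurable_fun I z ->
  measurable_fun I (fun t => clip (r t) (z t)).
Proof.
move=> mr mz; apply: measurable_maxr; last exact: measurable_minr.
exact: measurableT_comp.
Qed.

(** Truncating the state makes the velocities integrably bounded over all
    states at once. *)
Definition clipv k (r : R) (u : 'cV[R]_k) : 'cV[R]_k := \col_i clip r (u i ord0).

Lemma coord_cvg_clipv k r (u : nat -> 'cV[R]_k) v : coord_cvg u v ->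
  coord_cvg (fun m => clipv r (u m)) (clipv r v).
Proof.
move=> uv i; rewrite mxE (_ : (fun m => _) = fun m => clip r (u m i ord0)).
  by apply: continuous_cvg; [exact: clip_continuous|exact: uv].
by apply/funext => m; rewrite mxE.
Qed.

Lemma clipv_id k r (u : 'cV[R]_k) : (forall i, `|u i ord0| <= r) -> clipv r u = u.
Proof. by move=> ur; apply/colP => i; rewrite mxE clip_id. Qed.

End matrices.

Section carath_calculus.
Context {R : realType} d (T : measurableType d) (p : nat) (I : set T).
Notation carath := (@carath R d T p I).

Lemma carath_fun (y : T -> R) : measurable_fun I y -> carath (fun t _ => y t).
Proof. by move=> my; split => // t It; exact: cst_continuous. Qed.

Lemma carath_coord i : carath (fun _ xi => xi i ord0).
Proof. by split => [t It|xi]; [exact: coord_continuous|exact: measurable_cst]. Qed.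

Lemma carathM g h : carath g -> carath h -> carath (fun t xi => g t xi * h t xi).
Proof.
move=> [cg mg] [ch mh]; split => [t It xi|xi].
  exact: (continuousM (cg t It xi) (ch t It xi)).
exact: measurable_funM.
Qed.

Lemma carathB g h : carath g -> carath h -> carath (fun t xi => g t xi - h t xi).
Proof.
move=> [cg mg] [ch mh]; split => [t It xi|xi].
  exact: (continuousB (cg t It xi) (ch t It xi)).
exact: measurable_funB.
Qed.

Lemma carath_norm g : carath g -> carath (fun t xi => `|g t xi|).
Proof.
move=> [cg mg]; split => [t It xi|xi]; last exact: measurableT_comp.
exact: (continuous_comp (cg t It xi) (@norm_continuous _ R^o _)).
Qed.

Lemma carath_mulmx a b (M : 'M[R]_(a, b)) (g : T -> 'cV[R]_p -> 'cV[R]_b) i :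
  (forall j, carath (fun t xi => g t xi j ord0)) ->
  carath (fun t xi => (M *m g t xi) i ord0).
Proof.
move=> cg; have -> : (fun t xi => (M *m g t xi) i ord0) =
    fun t xi => \sum_j M i j * g t xi j ord0.
  by apply/funext => t; apply/funext => xi; rewrite mxE.
apply: carath_sum => j; apply: carathM => //; apply: carath_fun.
exact: measurable_cst.
Qed.

End carath_calculus.

Section indefinite_integral.
Context {R : realType}.
Notation mu := (@lebesgue_measure R).

Lemma norm_itgB_le (h : R -> R) a s t : Lint h -> s <= t ->
  `|itg h a t - itg h a s| <= itg (fun r => `|h r|) s t.
Proof.
move=> Ih st; have Inh := Lint_norm Ih.
have leh u w : `|itg h u w| <= itg (fun r => `|h r|) u w.
  by apply: norm_itg_le => //; exact: nearW.
have [as_|sa] := leP a s.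
  by rewrite (itg_chasles Ih as_ st) addrAC subrr add0r.
rewrite (itgge _ (ltW sa)) subr0; have [at_|ta] := leP a t.
  by rewrite (le_trans (leh _ _))// itg_sub// ltW.
by rewrite (itgge _ (ltW ta)) normr0 itg_ge0.
Qed.

Lemma itg_continuous (h : R -> R) a : Lint h -> continuous (itg h a).
Proof.
move=> Ih t; apply/cvgrPdist_lt => e e0.
have [d d0 hd] := itg_small Ih e0.
near=> s; have std : `|t - s| < d.
  by near: s; exact: (nbhsx_ballx t d d0).
have [st|ts] := leP s t.
  apply: (le_lt_trans (norm_itgB_le a Ih st)); apply: hd => //.
  exact: le_lt_trans (ler_norm _) std.
rewrite distrC; apply: (le_lt_trans (norm_itgB_le a Ih (ltW ts))).
by apply: hd; [exact: ltW|rewrite (le_lt_trans (ler_norm _))// distrC].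
Unshelve. all: by end_near. Qed.

Lemma measurable_itg (h : R -> R) a : Lint h -> measurable_fun setT (itg h a).
Proof. by move=> Ih; apply: continuous_measurable_fun; exact: itg_continuous. Qed.

(** A Borel version of [g], truncated at [phi] so that the bound holds
    everywhere, is integrable. *)
Lemma leb_integrable_le_ae (D : set R) (g phi : R -> R) : measurable D ->
  measurable_fun (D : set (lebR R)) (g : lebR R -> R) ->
  Lint phi -> {ae mu, forall t, D t -> `|g t| <= phi t} ->
  (leb R).-integrable D (EFin \o g).
Proof.
move=> mD mg Iphi gphi.
have [h mh hg] := borel_version mD mg.
pose h' t := clip `|phi t| (h t).
have mh' : measurable_fun setT h'.
  apply: measurable_clip => //; apply: Lint_measurable; exact: Lint_norm.
have Ih' : Lint h'.
  apply: (Lint_le_ae mh' (Lint_norm Iphi)).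
  by apply: nearW => t; apply: clip_le.
apply: (ae_eq_leb_integrable mD (LintS mD Ih')).
apply: filterS2 hg gphi => t hgt gphit Dt.
rewrite /h' hgt// clip_id// (le_trans (gphit Dt))//.
exact: ler_norm.
Qed.

End indefinite_integral.

(** * A priori bounds for the Lur'e system *)

Lemma itv_Rplus (R : realType) (a b : R) : 0 <= a -> `[a, b]%classic `<=` @Rplus R.
Proof.
by move=> a0 t; rewrite /Rplus/= !in_itv/= => /andP[/(le_trans a0) ->].
Qed.

Section lure_system.
Context {R : realType} {n m me p : nat} (S : lure R n m me p).
Notation mu := (@lebesgue_measure R).
Notation f := (lf S).
Implicit Types (v : R -> 'cV[R]_me).

Definition rhs v t (x : 'cV[R]_n) (xi : 'cV[R]_p) : 'cV[R]_n :=
  lA S *m x + lB S *m f t xi + lBe S *m v t.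

Definition outmap v t (x : 'cV[R]_n) : 'cV[R]_p := lC S *m x + lDe S *m v t.

Lemma outmap_im v t x : im_CDe S (outmap v t x).
Proof. by exists (col_mx x (v t)) => //; rewrite mul_row_col. Qed.

Lemma output_eq v t x xi : lF S t xi = outmap v t x <->
  xi = lC S *m x + lD S *m f t xi + lDe S *m v t.
Proof.
rewrite /lF /outmap; split => [/eqP|E].
  by rewrite subr_eq addrAC => /eqP.
by rewrite {1}E addrAC addrK.
Qed.

Definition fibres_nonempty :=
  forall t xi, 0 <= t -> im_CDe S xi -> lfibre S t xi !=set0.

Definition fibre_images_convex := forall t xi, 0 <= t -> im_CDe S xi ->
  convex_set (f t @` lfibre S t xi : set (convex_lmodType 'cV[R]_m)).

Definition locally_L1_bounded (g : R -> 'cV[R]_p -> 'cV[R]_m) :=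
  forall K : set 'cV[R]_p, compact K -> exists phi : R -> R,
  [/\ forall t, 0 <= t -> 0 <= phi t,
      on_compacts (fun I : set R => (leb R).-integrable I (EFin \o phi))
        (@Rplus R) &
      forall t xi, 0 <= t -> K xi -> enorm (g t xi) <= phi t].

(** Approximate solutions [xi] of the output equation are bounded as well as
    the exact ones: this is what makes the selection of outputs coercive. *)
Definition output_bound v (r sig : R) (D : set R) :=
  forall t (x : 'cV[R]_n) (xi : 'cV[R]_p), D t -> (forall i, `|x i ord0| <= r) ->
  (forall i, `|(lF S t xi - outmap v t x) i ord0| <= 1) ->
  forall i, `|xi i ord0| <= sig.

Definition velocity_bound v (r sig : R) (phi : R -> R) (D : set R) :=
  forall t (xi : 'cV[R]_p), D t -> (forall i, `|xi i ord0| <= sig) ->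
  enorm (f t xi) <= phi t /\
  forall x : 'cV[R]_n, (forall i, `|x i ord0| <= r) ->
    forall i, `|rhs v t x xi i ord0| <= phi t.

Hypothesis A2 : radially_unbounded_loc_unif S.
Hypothesis f_bnd : locally_L1_bounded f.

(** Radial unboundedness confines the outputs to a ball of radius [sig],
    uniformly for times up to [T] and states in the box of radius [r]; on that
    ball, [f] has an integrable bound. The set [D] collects the times at which
    the essential bound of [v] holds and the bound of [f] agrees with its
    Borel version. *)
Lemma apriori_bounds v (T r : R) : on_compacts (Linfty v) (@Rplus R) ->
  0 <= T -> 0 <= r ->
  exists (D : set R) (sig : R) (phi : R -> R), [/\
    measurable D /\ D `<=` `[0, T]%classic,
    {ae mu, forall t, 0 <= t <= T -> D t},
    Lint phi /\ (forall t, 0 <= phi t),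
    0 <= sig /\ output_bound v r sig D &
    velocity_bound v r sig phi D].
Proof.
move=> vL T0 r0.
have [_ [M /ae_lebE vM]] := vL 0 T (@itv_Rplus R 0 T (lexx 0)).
pose W := mxsum (lC S) * r + mxsum (lDe S) * `|M|.
have W0 : 0 <= W by rewrite addr_ge0// mulr_ge0// mxsum_ge0.
(* W bounds the coordinates of C x + De v, and W + 1 those of lF S t xi for an
   approximate solution xi *)
have rho0 : 0 < p%:R * (W + 1) + 1 :> R.
  by rewrite ltr_wpDl// mulr_ge0// addr_ge0.
have [sig sig0 sigP] := A2 rho0 (@segment_compact R 0 T) (@itv_Rplus R 0 T (lexx 0)).
have [phiK [phiK0 phiKI phiKP]] := f_bnd (@compact_box R p sig).
have mI : measurable `[0, T]%classic by exact: measurable_itv.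
have [phib Iphib phibK] := integrable_borel_version mI (phiKI 0 T (@itv_Rplus R 0 T (lexx 0))).
have [N [mN N0 NP]] := filterI vM phibK.
pose c := mxsum (lA S) * r + mxsum (lBe S) * `|M|.
have c0 : 0 <= c by rewrite addr_ge0// mulr_ge0// mxsum_ge0.
pose phi t := (1 + mxsum (lB S)) * `|phib t| + ((cst c) \_ `]-1, T]) t.
have b0 := mxsum_ge0 (lB S).
have phi0 t : 0 <= phi t.
  rewrite addr_ge0 ?mulr_ge0// ?addr_ge0//.
  by rewrite patchE; case: ifP.
exists (`[0, T]%classic `\` N), sig, phi.
have DP t : (`[0, T]%classic `\` N) t -> [/\ 0 <= t, t <= T,
    forall i, `|v t i ord0| <= `|M| & phib t = phiK t].
  move=> [/= tT nN]; have /andP[t0 tT'] : 0 <= t <= T by rewrite in_itv/= in tT.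
  have [vt pt] : (fun t => `[0, T]%classic t -> enorm (v t) <= M) t /\
     (fun t => `[0, T]%classic t -> phib t = phiK t) t.
    by apply: contrapT => nP; apply: nN; apply: NP.
  split => //; last exact: pt.
  by move=> i; rewrite (le_trans (coord_le_enorm _ _))// (le_trans (vt tT))// ler_norm.
split.
- by split; [exact: measurableD|exact: subDsetl].
- exists N; split => // t /= /not_implyP[tT nD]; apply: contrapT => nN.
  by apply: nD; split => //=; rewrite in_itv.
- split => //; apply: LintD; last exact: Lint_cst_cut.
  by apply: LintZ; exact: Lint_norm.
- split => // t x xi /DP[t0 tT vt _] xr F1 i.
  rewrite (le_trans (coord_le_enorm _ _))// leNgt; apply/negP => /ltW big.
  have := sigP t xi _ big; rewrite /= in_itv/= t0 tT => /(_ isT).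
  apply/negP; rewrite -ltNge (@le_lt_trans _ _ (p%:R * (W + 1)))// ?ltrDl//.
  apply: enorm_le => j.
  have -> : lF S t xi j ord0 = (lF S t xi - outmap v t x) j ord0 + outmap v t x j ord0.
    by rewrite [X in _ = X + _]mxE [X in _ = _ + X + _]mxE subrK.
  rewrite addrC (le_trans (ler_normD _ _))// lerD//.
  rewrite mxE (le_trans (ler_normD _ _))// lerD//; exact: mulmx_coord_le.
- move=> t xi /DP[t0 tT vt pt] xs.
  have fphi : enorm (f t xi) <= `|phib t|.
    by rewrite pt (le_trans (phiKP _ _ t0 xs))// ler_norm.
  have -> : phi t = (1 + mxsum (lB S)) * `|phib t| + c.
    by rewrite /phi patchE mem_set//= in_itv/= tT andbT (lt_le_trans _ t0).
  split.
    rewrite (le_trans fphi)// mulrDl mul1r -addrA lerDl addr_ge0// mulr_ge0//.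
  move=> x xr i; rewrite /rhs mxE [X in `|X + _|]mxE.
  rewrite (le_trans (ler_normD _ _))// /c addrA lerD//; last exact: mulmx_coord_le.
  rewrite (le_trans (ler_normD _ _))// addrC lerD//; first exact: mulmx_coord_le.
  apply: (@le_trans _ _ (mxsum (lB S) * `|phib t|)).
    apply: mulmx_coord_le => j; exact: le_trans (coord_le_enorm _ _) fphi.
  by rewrite ler_wpM2r// lerDr.
Qed.

End lure_system.

(** * Measurable outputs and sets of velocities *)

Section output_selection.
Context {R : realType} {n m me p : nat} (S : lure R n m me p).
Notation mu := (@lebesgue_measure R).
Notation f := (lf S).
Hypothesis f_car : caratheodory_function f.

Lemma measurable_Rplus : measurable (@Rplus R : set (lebR R)).
Proof. by apply: borel_caratheodory; exact: measurable_itv. Qed.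

Lemma carath_f (E : set (lebR R)) j : measurable E -> E `<=` @Rplus R ->
  carath E (fun (t : lebR R) xi => f t xi j ord0).
Proof.
move=> mE ER; split => [t Et xi|xi].
  have t0 : 0 <= t by have := ER t Et; rewrite /Rplus/= in_itv/= andbT.
  exact: (continuous_comp (f_car.1 t t0 xi) (@coord_continuous R m 1 j ord0 _)).
apply: measurable_funS measurable_Rplus ER _; exact: f_car.2.
Qed.

Section bounded_region.
Variables (v : R -> 'cV[R]_me) (r sig : R) (D : set R) (E : set R).
Hypothesis Dsig : output_bound S v r sig D.
Hypothesis mE : measurable (E : set (lebR R)).
Hypothesis ED : E `<=` D.
Hypothesis ER : E `<=` @Rplus R.
Hypothesis mv : mfun_vec E v.

Lemma measurable_outmap (z : R -> 'cV[R]_n) i : mfun_vec E z ->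
  measurable_fun (E : set (lebR R)) (fun t : lebR R => outmap S v t (z t) i ord0).
Proof.
by move=> mz; apply: measurable_coordD; apply: measurable_mulmx.
Qed.

Lemma carath_lF i : carath (E : set (lebR R)) (fun (t : lebR R) xi => lF S t xi i ord0).
Proof.
have -> : (fun (t : lebR R) xi => lF S t xi i ord0) =
    fun t xi => xi i ord0 - (lD S *m f t xi) i ord0.
  by apply/funext => t; apply/funext => xi; rewrite !mxE.
apply: carathB; first exact: carath_coord.
by apply: carath_mulmx => j; exact: carath_f.
Qed.

(** The cost [Q] singles out outputs with an additional property. It is zero
    when any output will do, and the deviation from a prescribed velocity when
    the output has to produce that velocity. *)
Lemma select_output (z : R -> 'cV[R]_n) (Q : R -> 'cV[R]_p -> R) :
  mfun_vec E z -> (forall t i, E t -> `|z t i ord0| <= r) ->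
  carath (E : set (lebR R)) (Q : lebR R -> _) -> (forall t xi, E t -> 0 <= Q t xi) ->
  (forall t, E t -> exists xi, lF S t xi = outmap S v t (z t) /\ Q t xi = 0) ->
  exists y : R -> 'cV[R]_p, mfun_vec E y /\
    forall t, E t -> lF S t (y t) = outmap S v t (z t) /\ Q t (y t) = 0.
Proof.
move=> mz zr cQ Q0 ex.
pose H (t : lebR R) (xi : 'cV[R]_p) :=
  \sum_i `|lF S t xi i ord0 - outmap S v t (z t) i ord0| + Q t xi.
have s0 t xi : 0 <= \sum_i `|lF S t xi i ord0 - outmap S v t (z t) i ord0|.
  exact: sumr_ge0.
have [||||y [my yP]] := @measurable_selection R _ (lebR R) p E mE H.
- apply: carathD; last exact: cQ.
  apply: carath_sum => i; apply: carath_norm.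
  apply: carathB; first exact: carath_lF.
  apply: carath_fun; exact: measurable_outmap.
- by move=> t xi Et; rewrite addr_ge0// Q0.
- move=> t Et; exists sig => xi Hxi; apply: (@Dsig t (z t)); first exact: ED.
    by move=> i; exact: zr.
  move=> i; apply: le_trans Hxi; rewrite mxE [X in _ + X]mxE /H (bigD1 i)//= -addrA.
  by rewrite lerDl addr_ge0 ?Q0// sumr_ge0.
- move=> t Et; have [xi [Fxi Qxi]] := ex t Et; exists xi.
  by rewrite /H Qxi Fxi addr0 big1// => i _; rewrite subrr normr0.
exists y; split; first exact: my.
move=> t Et; have /eqP := yP t Et.
rewrite paddr_eq0 ?Q0// psumr_eq0// => /andP[/allP F0 /eqP ->]; split => //.
apply/colP => i; have := F0 i; rewrite mem_index_enum => /(_ isT).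
by rewrite normr_eq0 subr_eq0 => /eqP.
Qed.

End bounded_region.
End output_selection.

Section local_existence.
Context {R : realType} {n m me p : nat} (S : lure R n m me p).
Notation mu := (@lebesgue_measure R).
Notation f := (lf S).
Hypothesis f_car : caratheodory_function f.
Hypothesis A1 : fibres_nonempty S.
Hypothesis A3 : fibre_images_convex S.

Section velocity_sets.
Variables (v : R -> 'cV[R]_me) (r sig : R) (D : set R) (phi : R -> R).
Hypothesis r0 : 0 <= r.
Hypothesis mD : measurable D.
Hypothesis DR : D `<=` @Rplus R.
Hypothesis mv : mfun_vec D v.
Hypothesis phi0 : forall t, 0 <= phi t.
Hypothesis Iphi : Lint phi.
Hypothesis Dsig : output_bound S v r sig D.
Hypothesis Dphi : velocity_bound S v r sig phi D.

(** Outside [D] nothing is required, and the state is truncated: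
    [differential_inclusion] wants properties that hold for all times and
    states. *)
Definition velocities t (x : 'cV[R]_n) : set 'cV[R]_n := [set u | D t ->
  exists xi, lF S t xi = outmap S v t (clipv r x) /\ u = rhs S v t (clipv r x) xi].

Lemma clipv_le (x : 'cV[R]_n) i : `|clipv r x i ord0| <= r.
Proof. by rewrite mxE clip_le. Qed.

Lemma D_ge0 t : D t -> 0 <= t.
Proof. by move=> /DR; rewrite /Rplus/= in_itv/= andbT. Qed.

Lemma fibre_bound t (x : 'cV[R]_n) xi : D t -> (forall i, `|x i ord0| <= r) ->
  lF S t xi = outmap S v t x -> forall i, `|xi i ord0| <= sig.
Proof.
move=> Dt xr Fxi; apply: Dsig Dt xr _ => i.
by rewrite Fxi subrr mxE normr0.
Qed.

(** A velocity depends affinely on the value of [f], and the admissible values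
    of [f] form a convex set. *)
Lemma velocities_convex t x : convexv (velocities t x).
Proof.
move=> u1 u2 l /andP[l0 l1] U1 U2 Dt.
have [xi1 [F1 ->]] := U1 Dt; have [xi2 [F2 ->]] := U2 Dt.
set z := clipv r x in F1 F2 *.
have := A3 (D_ge0 Dt) (outmap_im S v t z).
move=> /(_ (f t xi1) (f t xi2) (Itv01 l0 l1)).
rewrite !inE; case; [by exists xi1|by exists xi2|].
move=> xi /= Fxi fxi; exists xi; split => //.
rewrite /rhs fxi /conv/=.
rewrite mulmxDr -!scalemxAr.
apply/colP => i; rewrite !mxE /= /unstable.onem.
by ring.
Qed.

(** Outputs that belong to a convergent sequence of states are bounded, so
    they accumulate at an output of the limit state, as [f t] is continuous.
    *)
Lemma velocities_closed t (xs us : nat -> 'cV[R]_n) x u :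
  (forall k, velocities t (xs k) (us k)) -> coord_cvg xs x -> coord_cvg us u ->
  velocities t x u.
Proof.
move=> Vk xsx usu Dt.
have /choice[xi xiP] k := Vk k Dt.
have xisig k i : `|xi k i ord0| <= sig.
  by apply: (fibre_bound Dt _ (xiP k).1) => j; exact: clipv_le.
have [tau [xi0 [tm txi]]] := bounded_extraction xisig.
have cz : coord_cvg (fun k => clipv r (xs (tau k))) (clipv r x).
  by apply: coord_cvg_clipv => i; exact: cvg_comp (cvg_geid tm) (xsx i).
have cf : coord_cvg (fun k => f t (xi (tau k))) (f t xi0).
  move=> j; apply: (continuous_coord_cvg (h := fun w => f t w j ord0)) txi.
  move=> w; exact: (continuous_comp (f_car.1 t (D_ge0 Dt) w) (@coord_continuous R m 1 j ord0 _)).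
exists xi0; split.
  have c1 : coord_cvg (fun k => xi (tau k) + lD S *m (- f t (xi (tau k))))
     (xi0 + lD S *m (- f t xi0)).
    apply: coord_cvgD; first exact: txi.
    apply: coord_cvg_mulmx => j; rewrite mxE; under eq_fun do rewrite mxE.
    exact: cvgN (cf j).
  have c2 : coord_cvg (fun k => outmap S v t (clipv r (xs (tau k)))) (outmap S v t (clipv r x)).
    by apply: coord_cvgD; [exact: coord_cvg_mulmx|exact: coord_cvg_cst].
  rewrite /lF -mulmxN; apply: coord_cvg_unique c1 _.
  suff -> : (fun k => xi (tau k) + lD S *m (- f t (xi (tau k)))) =
      fun k => outmap S v t (clipv r (xs (tau k))) by [].
  by apply/funext => k; rewrite mulmxN -/(lF S t _) (xiP (tau k)).1.
have c3 : coord_cvg (fun k => rhs S v t (clipv r (xs (tau k))) (xi (tau k)))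
    (rhs S v t (clipv r x) xi0).
  apply: coord_cvgD; last exact: coord_cvg_cst.
  by apply: coord_cvgD; apply: coord_cvg_mulmx.
apply: coord_cvg_unique c3 => i.
suff -> : (fun k => rhs S v t (clipv r (xs (tau k))) (xi (tau k)) i ord0) =
    fun k => us (tau k) i ord0 by exact: cvg_comp (cvg_geid tm) (usu i).
by apply/funext => k; rewrite (xiP (tau k)).2.
Qed.

Lemma measurable_rhs (E : set R) (z : R -> 'cV[R]_n) (y : R -> 'cV[R]_p) i :
  mfun_vec E v -> mfun_vec E z -> mfun_vec E (fun t => f t (y t)) ->
  measurable_fun (E : set (lebR R)) (fun t : lebR R => rhs S v t (z t) (y t) i ord0).
Proof.
move=> mv' mz mfy; apply: measurable_coordD; last exact: measurable_mulmx.
by apply: measurable_coordD; exact: measurable_mulmx.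
Qed.

Lemma measurable_f_comp (E : set R) (y : R -> 'cV[R]_p) :
  measurable (E : set (lebR R)) -> E `<=` @Rplus R -> mfun_vec E y ->
  mfun_vec E (fun t => f t (y t)).
Proof.
move=> mE ER my j.
exact: (carath_comp_measurable mE (carath_f f_car j mE ER) my).
Qed.

Lemma velocities_selection x : exists g : R -> 'cV[R]_n,
  [/\ forall i, measurable_fun setT (fun t => g t i ord0),
      forall t i, `|g t i ord0| <= phi t &
      {ae mu, forall t, velocities t x (g t)}].
Proof.
set z := clipv r x.
have mDl := borel_caratheodory mD.
have mz : mfun_vec D (fun=> z) by move=> i; exact: measurable_cst.
have [||||y [my yP]] := @select_output R n m me p S f_car v r sig D D Dsig mDl
  (@subset_refl _ D) DR mv (fun=> z) (fun _ _ => 0) mz.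
- by move=> t i _; exact: clipv_le.
- by apply: carath_fun; exact: measurable_cst.
- by [].
- move=> t Dt; have [xi Fxi] := A1 (D_ge0 Dt) (outmap_im S v t z).
  by exists xi.
have mfy := measurable_f_comp mDl DR my.
have /choice[g0 g0P] i : exists g0, measurable_fun setT g0 /\
    {ae mu, forall t, D t -> g0 t = rhs S v t z (y t) i ord0}.
  by have [g0 mg0 g0E] := borel_version mD (measurable_rhs i mv mz mfy); exists g0.
(* the Borel version [g0] obeys the bound only almost everywhere *)
exists (fun t => \col_i clip (phi t) (g0 i t)); split.
- move=> i; under eq_fun do rewrite mxE.
  by apply: measurable_clip; [exact: Lint_measurable|case: (g0P i)].
- by move=> t i; rewrite mxE clip_le.
- have : {ae mu, forall t, forall i, D t -> g0 i t = rhs S v t z (y t) i ord0}.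
    by apply: ae_forall_count => i; case: (g0P i).
  apply: filterS => t gt Dt; have [Fy _] := yP t Dt.
  exists (y t); split => //; apply/colP => i; rewrite mxE gt// clip_id//.
  have zr j : `|z j ord0| <= r by exact: clipv_le.
  by apply: (Dphi Dt _).2 => //; exact: (fibre_bound Dt zr Fy).
Qed.

End velocity_sets.

End local_existence.

(** * Local existence *)

Lemma ae_neq (R : realType) (a : R) : {ae mu1 R, forall t, t <> a}.
Proof.
exists [set a]; split; [exact: measurable_set1|exact: lebesgue_measure_set1|].
by move=> t /= /contrapT.
Qed.

Section integral_solutions.
Context {R : realType} {n m me p : nat} (S : lure R n m me p).
Notation mu := (@lebesgue_measure R).
Notation f := (lf S).

(** Solutions on a closed interval in integral form, with a Borel density [h]
    on the line as velocity. In this form solutions are easily restricted,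
    glued and extended to the end of an interval. *)
Definition integral_solution (v : R -> 'cV[R]_me) (a b : R)
    (x : R -> 'cV[R]_n) (y : R -> 'cV[R]_p) :=
  [/\ L1 y `[a, b], L1 (fun t => f t (y t)) `[a, b] &
   exists2 h : R -> 'cV[R]_n, forall i, Lint (fun r => h r i ord0) &
     (forall t, a <= t <= b -> x t = x a + vitg h a t) /\
     {ae mu, forall t, a <= t <= b ->
        h t = rhs S v t (x t) (y t) /\ lF S t (y t) = outmap S v t (x t)}].

Lemma mfun_vecS k (g : R -> 'cV[R]_k) (E E' : set R) : measurable (E : set (lebR R)) ->
  E' `<=` E -> mfun_vec E g -> mfun_vec E' g.
Proof. by move=> mE E'E mg i; apply: measurable_funS mE E'E _; exact: mg. Qed.

Lemma L1_le_ae k (g : R -> 'cV[R]_k) (D : set R) (phi : R -> R) : measurable D ->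
  mfun_vec D g -> Lint phi -> {ae mu, forall t, D t -> enorm (g t) <= phi t} ->
  L1 g D.
Proof.
move=> mD mg Iphi gphi; split => //.
apply: (leb_integrable_le_ae mD _ Iphi).
  by apply: enorm_measurable => i; exact: mg.
by apply: filterS gphi => t gt Dt; rewrite ger0_norm ?enorm_ge0// gt.
Qed.

Hypothesis f_car : caratheodory_function f.
Hypothesis A1 : fibres_nonempty S.
Hypothesis A3 : fibre_images_convex S.
Hypothesis A2 : radially_unbounded_loc_unif S.
Hypothesis f_bnd : locally_L1_bounded f.

Lemma zero_ext_measurable k (E : set R) (y0 : R -> 'cV[R]_k) :
  measurable (E : set (lebR R)) -> mfun_vec E y0 ->
  exists y : R -> 'cV[R]_k, [/\ mfun_vec setT y, forall t, E t -> y t = y0 t &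
    forall t, ~ E t -> y t = 0].
Proof.
move=> mE my0; exists (fun t => \col_i ((fun t => y0 t i ord0) \_ E) t); split.
- move=> i; under eq_fun do rewrite mxE.
  by apply/(measurable_restrictT _ mE).1; exact: my0.
- by move=> t Et; apply/colP => i; rewrite mxE patchE mem_set.
- by move=> t Et; apply/colP => i; rewrite !mxE patchE memNset.
Qed.

(** The remaining task is a measurable output with the given velocity [h]; it
    is selected with the deviation of velocities as cost. On the exceptional
    times it is set to zero, which keeps it bounded everywhere. *)
Lemma integral_solution_of_inclusion (v : R -> 'cV[R]_me) (r sig a b : R) (D : set R)
   (phi : R -> R) (x h : R -> 'cV[R]_n) :
  on_compacts (Linfty v) (@Rplus R) -> 0 <= a -> 0 <= sig ->
  measurable D -> D `<=` @Rplus R -> {ae mu, forall t, a <= t <= b -> D t} ->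
  Lint phi -> (forall t, 0 <= phi t) ->
  output_bound S v r sig D ->
  (forall t (xi : 'cV[R]_p), D t -> (forall i, `|xi i ord0| <= sig) ->
    enorm (f t xi) <= phi t) ->
  (forall i, Lint (fun t => h t i ord0)) ->
  (forall t, x t = x a + vitg h a t) ->
  (forall t i, a <= t <= b -> `|x t i ord0| <= r) ->
  {ae mu, forall t, a < t < b ->
     exists xi, lF S t xi = outmap S v t (x t) /\ h t = rhs S v t (x t) xi} ->
  exists y, integral_solution v a b x y.
Proof.
move=> vL a0 sig0 mD DR aeD Iphi phi0 Dsig Dphi Ih xE xr aeh.
have [N [mN N0 NP]] := aeh.
pose E := (D `&` `]a, b[%classic) `\` N.
have mE : measurable E by apply: measurableD => //; exact: measurableI.
have mEl := borel_caratheodory mE.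
have ED : E `<=` D by move=> t [[]].
have ER : E `<=` @Rplus R := subset_trans ED DR.
have Eab : E `<=` `[a, b]%classic.
  by move=> t [[_ /=]]; rewrite !in_itv/= => /andP[/ltW -> /ltW ->].
have Eb t : E t -> a <= t <= b by move=> /Eab; rewrite /= in_itv.
have EP t : E t -> exists xi, lF S t xi = outmap S v t (x t) /\ h t = rhs S v t (x t) xi.
  move=> [[_ abt] nN]; apply: contrapT => nex; apply: nN; apply: NP => /= H.
  by apply: nex; apply: H; rewrite /= in_itv in abt.
have mab := leb_measurable_itv `[a, b].
have mv : mfun_vec E v.
  by apply: (mfun_vecS mab Eab); have [] := vL a b (@itv_Rplus R a b a0).
have mx : mfun_vec E x.
  move=> i; apply: measurable_funTS; apply: measurable_fun_borel => //.
  under eq_fun do rewrite xE !mxE.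
  by apply: measurable_funD; [exact: measurable_cst|exact: measurable_itg].
have mh : mfun_vec E h.
  move=> i; apply: measurable_funTS; apply: measurable_fun_borel => //.
  exact: Lint_measurable.
pose Q (t : R) (xi : 'cV[R]_p) := \sum_i `|rhs S v t (x t) xi i ord0 - h t i ord0|.
have [||||y0 [my0 y0P]] := @select_output R n m me p S f_car v r sig D E Dsig mEl
  ED ER mv x Q mx.
- by move=> t i /Eb; exact: xr.
- apply: carath_sum => i; apply: carath_norm.
  apply: carathB; last by apply: carath_fun; exact: mh.
  have -> : (fun (t : lebR R) xi => rhs S v t (x t) xi i ord0) =
     fun t xi => ((lA S *m x t) i ord0 + (lBe S *m v t) i ord0) +
       (lB S *m f t xi) i ord0.
    by apply/funext => t; apply/funext => xi; rewrite !mxE addrAC.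
  apply: carathD; last by apply: carath_mulmx => j; exact: carath_f.
  apply: carath_fun; apply: measurable_funD; exact: measurable_mulmx.
- by move=> t xi _; exact: sumr_ge0.
- move=> t Et; have [xi [Fxi hxi]] := EP t Et; exists xi; split => //.
  by rewrite /Q hxi big1// => i _; rewrite subrr normr0.
have [y [my yE y0E]] := zero_ext_measurable mEl my0.
have ysig t i : `|y t i ord0| <= sig.
  have [Et|nEt] := pselect (E t); last by rewrite y0E// mxE normr0.
  rewrite yE//; have [Fy _] := y0P t Et.
  apply: (Dsig t (x t)) => [|j|j]; [exact: ED|by apply: xr; exact: Eb|].
  by rewrite Fy subrr mxE normr0.
have my' : mfun_vec `[a, b] y by move=> i; apply: measurable_funTS; exact: my.
exists y; split.
- apply: (L1_le_ae (phi := (cst (p%:R * sig)) \_ `]a - 1, b]) (measurable_itv _) my').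
    exact: Lint_cst_cut.
  apply: nearW => t; rewrite /= in_itv/= => /andP[at_ tb].
  rewrite patchE mem_set; last by rewrite /= in_itv/= tb andbT (lt_le_trans _ at_)// gtrBl.
  exact: enorm_le.
- apply: (L1_le_ae (phi := phi) (measurable_itv _) _ Iphi).
    exact: (measurable_f_comp f_car mab (@itv_Rplus R a b a0) my').
  by apply: filterS aeD => t Dt /=; rewrite in_itv/= => /Dt {}Dt; exact: Dphi.
exists h; first exact: Ih.
split; first by move=> t _; exact: xE.
have aea : {ae mu, forall t, t <> a} by apply: ae_neq.
have aeb : {ae mu, forall t, t <> b} by apply: ae_neq.
have aeN : {ae mu, forall t, ~ N t}.
  by exists N; split => // t /= /contrapT.
apply: filterS (filterI (filterI aea aeb) (filterI aeN aeD)) => t.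
move=> [[ta tb] [nN Dt]] abt.
have Et : E t.
  split => //; split; first exact: Dt.
  by move: abt => /andP[at_ tb']; rewrite /= in_itv/= !lt_neqAle at_ tb' !andbT;
     apply/andP; split; apply/eqP => // /esym.
have [Fy /eqP] := y0P t Et; rewrite yE// psumr_eq0// => /allP Q0; split => //.
apply/colP => i; have := Q0 i; rewrite mem_index_enum => /(_ isT).
by rewrite normr_eq0 subr_eq0 => /eqP.
Qed.

(** The inclusion is solved for the truncated state. During a time over which
    the integral of [phi] is less than 1, a state that starts in the box of
    radius [rho] stays in the box of radius [rho + 1], where the truncation
    has no effect. *)
Theorem local_existence (v : R -> 'cV[R]_me) (T rho : R) :
  on_compacts (Linfty v) (@Rplus R) -> 0 <= T -> 0 <= rho ->
  exists2 eta, 0 < eta & forall s (xi0 : 'cV[R]_n), 0 <= s <= T ->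
    (forall i, `|xi0 i ord0| <= rho) ->
    forall e, 0 < e <= eta -> exists x y, x s = xi0 /\ integral_solution v s (s + e) x y.
Proof.
move=> vL T0 rho0.
have r0 : 0 <= rho + 1 by rewrite addr_ge0.
have T10 : 0 <= T + 1 by rewrite addr_ge0.
have [D [sig [phi [[mD DT] aeD [Iphi phi0] [sig0 Dsig] Dphi]]]] :=
  apriori_bounds A2 f_bnd vL T10 r0.
have [d d0 hd] := itg_small Iphi ltr01.
exists (Num.min 1 (d / 2)); first by rewrite lt_min ltr01 divr_gt0.
move=> s xi0 /andP[s0 sT] xi0rho e /andP[e0]; rewrite le_min => /andP[e1 ed].
have DR : D `<=` @Rplus R := subset_trans DT (@itv_Rplus R 0 (T + 1) (lexx 0)).
have mDT := leb_measurable_itv `[0, T + 1].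
have mv : mfun_vec D v.
  by apply: (mfun_vecS mDT DT); have [] := vL 0 (T + 1) (@itv_Rplus R 0 (T + 1) (lexx 0)).
have sse : s < s + e by rewrite ltrDl.
have aeD' : {ae mu, forall t, s <= t <= s + e -> D t}.
  apply: filterS aeD => t Dt /andP[st te]; apply: Dt.
  by rewrite (le_trans s0)// (le_trans te)// lerD.
have [h Ih hV] := differential_inclusion xi0 sse Iphi phi0
   (velocities_selection f_car A1 r0 mD DR mv phi0 Iphi Dsig Dphi)
   (velocities_convex A3 DR)
   (velocities_closed f_car r0 DR Dsig).
pose x t := xi0 + vitg h s t.
have xs : x s = xi0 by apply/colP => i; rewrite !mxE itgge// addr0.
have hphi : {ae mu, forall t, s < t < s + e -> forall i, `|h t i ord0| <= phi t}.
  apply: filterS2 hV aeD' => t ht Dt /andP[st te] i.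
  have {}Dt : D t by apply: Dt; rewrite !ltW.
  have [|xi [Fxi ->]] := ht _ Dt; first by rewrite st.
  have zr j : `|clipv (rho + 1) (x t) j ord0| <= rho + 1 by rewrite mxE clip_le.
  apply: (Dphi t xi Dt _).2 => //.
  exact: (fibre_bound Dsig Dt zr Fxi).
have xr t i : s <= t <= s + e -> `|x t i ord0| <= rho + 1.
  move=> /andP[st te]; rewrite /x !mxE (le_trans (ler_normD _ _))// lerD//.
  have hle : {ae mu, forall r, s < r <= t -> `|h r i ord0| <= `|phi r|}.
    have aee : {ae mu, forall t, t <> s + e} by apply: ae_neq.
    apply: filterS2 hphi aee => w hw we /andP[sw wt].
    apply: le_trans (ler_norm _); apply: hw; rewrite sw/= lt_neqAle (le_trans wt)// andbT.
    exact/eqP.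
  apply: (le_trans (norm_itg_le (Ih i) (Lint_norm Iphi) hle)).
  apply/ltW/hd => //; rewrite ltrBlDl (le_lt_trans te)// ltrD2l.
  by rewrite (le_lt_trans ed)// ltr_pdivrMr// ltr_pMr// ltr1n.
have xE t : x t = x s + vitg h s t by rewrite xs.
have aeh : {ae mu, forall t, s < t < s + e ->
    exists xi, lF S t xi = outmap S v t (x t) /\ h t = rhs S v t (x t) xi}.
  apply: filterS2 hV aeD' => t ht Dt /andP[st te].
  have abt : s <= t <= s + e by rewrite !ltW.
  have [|xi [Fxi hxi]] := ht _ (Dt abt); first by rewrite st.
  have cx : clipv (rho + 1) (x t) = x t by apply: clipv_id => i; exact: xr.
  by exists xi; rewrite -/(x t) cx in Fxi hxi; split.
have [y yP] := integral_solution_of_inclusion vL s0 sig0 mD DR aeD' Iphi phi0 Dsig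
   (fun t xi Dt xs => (Dphi t xi Dt xs).1) Ih xE xr aeh.
by exists x, y.
Qed.

End integral_solutions.

(** * Restriction and gluing of solutions *)

Section gluing.
Context {R : realType} {n m me p : nat} (S : lure R n m me p).
Notation mu := (@lebesgue_measure R).
Notation f := (lf S).
Implicit Types (v : R -> 'cV[R]_me) (x : R -> 'cV[R]_n) (y : R -> 'cV[R]_p) (a b c : R).

Definition splice k b (g1 g2 : R -> 'cV[R]_k) t := if t <= b then g1 t else g2 t.

Lemma L1S k (g : R -> 'cV[R]_k) (I J : set R) : measurable I -> measurable J ->
  J `<=` I -> L1 g I -> L1 g J.
Proof.
move=> mI mJ JI [mg ig]; have mIl := borel_caratheodory mI.
split; first exact: mfun_vecS mIl JI mg.
exact: (integrableS mIl (borel_caratheodory mJ) JI ig).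
Qed.

Lemma L1_eq k (g g' : R -> 'cV[R]_k) (I : set R) : (forall t, I t -> g t = g' t) ->
  L1 g I -> L1 g' I.
Proof.
move=> gg' [mg ig]; split.
  move=> i; apply: eq_measurable_fun (mg i) => t /set_mem It.
  by rewrite gg'.
apply/integrableP; have /integrableP[mi ii] := ig; split.
  by apply: eq_measurable_fun mi => t /set_mem It /=; rewrite gg'.
apply: le_lt_trans ii; rewrite le_eqVlt; apply/orP; left; apply/eqP.
by apply: eq_integral => t /set_mem It; rewrite gg'.
Qed.

Lemma L1_dominated k (g : R -> 'cV[R]_k) a b : L1 g `[a, b] ->
  exists phi, [/\ Lint phi, forall t, 0 <= phi t &
    {ae mu, forall t, a <= t <= b -> enorm (g t) <= phi t}].
Proof.
move=> [_ /(integrable_borel_version (measurable_itv _))[phi Iphi phiE]].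
exists (fun t => `|phi t|); split => //; first exact: Lint_norm.
apply: filterS phiE => t + abt; rewrite /= in_itv/= => /(_ abt) ->.
exact: ler_norm.
Qed.

Lemma L1_splice k (g1 g2 : R -> 'cV[R]_k) a b c :
  L1 g1 `[a, b] -> L1 g2 `[b, c] -> L1 (splice b g1 g2) `[a, c].
Proof.
move=> L1g1 L1g2.
have [phi1 [I1 phi10 le1]] := L1_dominated L1g1.
have [phi2 [I2 phi20 le2]] := L1_dominated L1g2.
have mi := @leb_measurable_itv R.
apply: (L1_le_ae (measurable_itv _) _ (LintD I1 I2)).
  move=> i.
  have -> : (fun t : lebR R => splice b g1 g2 t i ord0) =
      fun t => if t <= b then g1 t i ord0 else g2 t i ord0.
    by apply/funext => t; rewrite /splice; case: ifP.
  have mle : measurable_fun setT (fun t : lebR R => (t : R) <= b).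
    apply: (@measurable_fun_ler _ _ R setT (idfun : lebR R -> R)).
      by apply: measurable_fun_borel => //; exact: measurable_id.
    exact: measurable_cst.
  apply: measurable_fun_if; [exact: mi|exact: measurable_funTS| |].
  - apply: (measurable_funS (mi `[a, b]) _ (L1g1.1 i)) => t /=.
    by rewrite !in_itv/= => -[/andP[-> _] ->].
  - apply: (measurable_funS (mi `[b, c]) _ (L1g2.1 i)) => t /=.
    rewrite !in_itv/= => -[/andP[_ ->] tb].
    by rewrite andbT ltW// ltNge tb.
apply: filterS2 le1 le2 => t t1 t2; rewrite /= in_itv/= => /andP[at_ tc].
rewrite /splice; case: (leP t b) => tb.
  by rewrite (le_trans (t1 _)) ?at_// lerDl.
by rewrite (le_trans (t2 _)) ?(ltW tb)// lerDr.
Qed.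

Lemma integral_solution_sub v a b c x y : a <= b <= c ->
  integral_solution S v a c x y -> integral_solution S v a b x y.
Proof.
move=> /andP[ab bc] [Ly Lf [h Ih [xh aeh]]].
have sub : `[a, b]%classic `<=` `[a, c]%classic.
  by move=> t /=; rewrite !in_itv/= => /andP[-> tb]; exact: le_trans bc.
split; [exact: L1S Ly|exact: L1S Lf|exists h; first exact: Ih].
split => [t /andP[at_ tb]|]; first by apply: xh; rewrite at_ (le_trans tb).
by apply: filterS aeh => t ht /andP[at_ tb]; apply: ht; rewrite at_ (le_trans tb).
Qed.

Lemma integral_solution_eq v a b x y x' y' : a <= b ->
  (forall t, a <= t <= b -> x t = x' t) -> (forall t, a <= t <= b -> y t = y' t) ->
  integral_solution S v a b x y -> integral_solution S v a b x' y'.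
Proof.
move=> ab xx' yy' [Ly Lf [h Ih [xh aeh]]].
have yI t : `[a, b]%classic t -> y t = y' t by rewrite /= in_itv/=; exact: yy'.
split; first exact: L1_eq Ly.
  by apply: L1_eq Lf => t /yI ->.
exists h => //; split => [t abt|].
  by rewrite -!xx' ?lexx ?ab//; exact: xh.
by apply: filterS aeh => t ht abt; rewrite -xx' ?abt// -yy' ?abt//; exact: ht.
Qed.

Lemma integral_solution_splice v a b c x1 y1 x2 y2 : a <= b -> b <= c -> x1 b = x2 b ->
  integral_solution S v a b x1 y1 -> integral_solution S v b c x2 y2 ->
  integral_solution S v a c (splice b x1 x2) (splice b y1 y2).
Proof.
move=> ab bc xb [Ly1 Lf1 [h1 Ih1 [xh1 ae1]]] [Ly2 Lf2 [h2 Ih2 [xh2 ae2]]].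
split; first exact: L1_splice.
  have -> : (fun t => f t (splice b y1 y2 t)) =
      splice b (fun t => f t (y1 t)) (fun t => f t (y2 t)).
    by apply/funext => t; rewrite /splice; case: ifP.
  exact: L1_splice.
pose h := splice b h1 h2.
have hE i : (fun t => h t i ord0) = fun t => if t <= b then h1 t i ord0 else h2 t i ord0.
  by apply/funext => t; rewrite /h /splice; case: ifP.
have Ih i : Lint (fun t => h t i ord0).
  apply: (Lint_le_ae (g := fun t => `|h1 t i ord0| + `|h2 t i ord0|)).
  - rewrite hE; apply: measurable_fun_if => //.
    + by apply: measurable_fun_ler => //; exact: measurable_cst.
    + by apply: measurable_funTS; exact: Lint_measurable.
    + by apply: measurable_funTS; exact: Lint_measurable.
  - by apply: LintD; exact: Lint_norm.
  - apply: nearW => t; rewrite /h /splice; case: ifP => _; first by rewrite lerDl.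
    by rewrite lerDr.
have hb1 t : t <= b -> vitg h a t = vitg h1 a t.
  move=> tb; apply/colP => i; rewrite !mxE; apply: eq_Rintegral => r.
  by rewrite inE/= in_itv/= => /andP[_ rt]; rewrite /h /splice (le_trans rt tb).
have hb2 t : vitg h b t = vitg h2 b t.
  apply/colP => i; rewrite !mxE; apply: eq_Rintegral => r.
  by rewrite inE/= in_itv/= => /andP[br _]; rewrite /h /splice leNgt br.
exists h => //; split => [t /andP[at_ tc]|].
  rewrite {1 2}/splice ab; case: leP => tb.
    by rewrite hb1// xh1// at_.
  rewrite xh2 ?(ltW tb)// -xb xh1 ?ab ?lexx// -hb1// -hb2 -addrA; congr (_ + _).
  by rewrite -(coord_vitgB Ih ab (ltW tb)) addrC subrK.
apply: filterS2 ae1 ae2 => t t1 t2 /andP[at_ tc].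
rewrite /h /splice; case: leP => tb; first by apply: t1; rewrite at_.
by apply: t2; rewrite ltW.
Qed.

End gluing.

(** * Integral solutions and pre-trajectories *)

Section caratheodory_solutions.
Context {R : realType} {n m me p : nat} (S : lure R n m me p).
Notation mu := (@lebesgue_measure R).
Notation f := (lf S).
Implicit Types (v : R -> 'cV[R]_me) (x : R -> 'cV[R]_n) (y : R -> 'cV[R]_p) (a b c : R).

Lemma is_derive_coords x (t : R) (w : 'cV[R]_n) :
  (forall i, is_derive t (1 : R) (fun s => x s i ord0) (w i ord0)) <->
  is_derive t (1 : R) x w.
Proof.
split=> [dx|[dx dxw] i].
  have dx' : derivable x t 1.
    by apply/derivable_mxP => i j; rewrite (ord1 j); have [] := dx i.
  apply: DeriveDef => //; rewrite derive_mx//.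
  by apply/matrixP => i j; rewrite mxE (ord1 j); have [_] := dx i.
have dx' := (derivable_mxP _ _ _).1 dx i ord0.
by apply: DeriveDef => //; rewrite -dxw derive_mx// mxE.
Qed.

Lemma abs_continuous_vitg x (h : R -> 'cV[R]_n) a b : (forall i, Lint (fun r => h r i ord0)) ->
  (forall t, a <= t <= b -> x t = x a + vitg h a t) ->
  abs_continuous x `[a, b].
Proof.
move=> Ih xE e e0.
pose g r := \sum_i `|h r i ord0|.
have Ig : Lint g by apply: Lint_sum => i; exact: Lint_norm.
have [d d0 hd] := itg_abs_continuous Ig e0.
exists d => // N s t st no sd; apply: le_lt_trans (hd N s t _ sd); last first.
  by split => // i; case: (st i).
apply: ler_sum => j _; apply: (le_trans (enorm_le_sum _)).
have [/= + + sjt] := st j; rewrite !in_itv/= => /andP[as_ sb] /andP[at_ tb].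
have -> : x (t j) - x (s j) = vitg h (s j) (t j).
  rewrite (xE (t j)) ?at_// (xE (s j)) ?as_//.
  by rewrite -(coord_vitgB Ih as_ sjt); apply/colP => i; rewrite !mxE; ring.
apply: (@le_trans _ _ (itg g (s j) (t j))).
  rewrite itg_sum; last by move=> i; exact: Lint_norm.
  apply: ler_sum => i _; rewrite mxE; apply: norm_itg_le => //; first exact: Lint_norm.
  by apply: nearW.
apply: le_itg => //; first exact: Lint_norm.
by apply: nearW => r _; exact: ler_norm.
Qed.

Lemma abs_continuousS x (I J : set R) : J `<=` I -> abs_continuous x I -> abs_continuous x J.
Proof.
move=> JI acx e /acx[d d0 hd]; exists d => // N s t st; apply: hd => i.
by have [/JI ? /JI ? ?] := st i.
Qed.

(** The primitive of an integrable function is differentiable almost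
    everywhere. Each compact subinterval has its own exceptional set and
    density; intervals with a rational endpoint suffice. *)
Lemma pre_trajectory_of_integral_solution v t0 (tau : \bar R) x y : 0 <= t0 -> (t0%:E < tau)%E ->
  on_compacts (Linfty v) (@Rplus R) ->
  (forall b, t0 <= b -> (b%:E < tau)%E -> integral_solution S v t0 b x y) ->
  pre_trajectory S t0 tau v x y.
Proof.
move=> t00 t0tau vL sol.
have cpt a b : `[a, b]%classic `<=` Ico t0 tau ->
    exists c, integral_solution S v t0 c x y /\ `[a, b]%classic `<=` `[t0, c]%classic.
  move=> abJ; have [ab|ba] := leP a b; last first.
    exists t0; split; first exact: sol.
    by move=> t /=; rewrite in_itv/= => /andP[/le_trans/[apply]]; rewrite leNgt ba.
  have [t0b bt] : Ico t0 tau b by apply: abJ; rewrite /= in_itv/= ab lexx.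
  exists b; split; first exact: sol.
  move=> t tab; have [t0t _] := abJ t tab.
  by move: tab; rewrite /= !in_itv/= t0t => /andP[_ ->].
split => //.
- move=> a b /cpt[c [[_ _ [h Ih [xh _]]] abc]].
  exact: abs_continuousS abc (abs_continuous_vitg Ih xh).
- by split=> a b /cpt[c [[Ly Lf _] abc]];
    [exact: L1S (measurable_itv _) (measurable_itv _) abc Ly
    |exact: L1S (measurable_itv _) (measurable_itv _) abc Lf].
- apply/ae_lebE.
  have step (q : rat) : {ae mu, forall t, t0 < t < ratr q -> ((ratr q : R)%:E < tau)%E ->
      is_derive t 1 x (lA S *m x t + lB S *m f t (y t) + lBe S *m v t) /\
        y t = lC S *m x t + lD S *m f t (y t) + lDe S *m v t}.
    have [[t0q qt]|nq] := pselect (t0 <= ratr q /\ ((ratr q : R)%:E < tau)%E); last first.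
      apply: nearW => t /andP[t0t tq] qt; exfalso; apply: nq; split => //.
      by rewrite (le_trans (ltW t0t))// ltW.
    have [_ _ [h Ih [xh aeh]]] := sol (ratr q) t0q qt.
    have ad : {ae mu, forall t, forall i, t0 < t ->
        is_derive t 1 (itg (fun r => h r i ord0) t0) (h t i ord0)}.
      by apply: ae_forall_count => i; exact: itg_derive.
    apply: filterS2 aeh ad => t ht dt /andP[t0t tq] _.
    have [|hE Fy] := ht; first by rewrite !ltW.
    split; last exact/output_eq.
    rewrite -/(rhs S v t (x t) (y t)) -hE; apply/is_derive_coords => i.
    have near_eq : \near t, (fun s => x t0 i ord0 + itg (fun r => h r i ord0) t0 s) t =
        (fun s => x s i ord0) t.
      have tI : t \in `]t0, ratr q[ by rewrite in_itv/= t0t.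
      apply: filterS (near_in_itvoo tI) => s; rewrite in_itv/= => /andP[t0s sq].
      by rewrite (xh s) ?mxE// !ltW.
    apply: near_eq_is_derive near_eq _.
    rewrite -[h t i ord0]add0r; apply: is_deriveD; exact: dt.
  have := ae_forall_count step; apply: filterS2 (ae_neq t0) => t tt0 tq [t0t ttau].
  have [q tqtau] : exists q : rat, t < ratr q /\ ((ratr q : R)%:E < tau)%E.
    case: tau ttau {t0tau sol cpt step tq} => [tau|_|//].
      rewrite lte_fin => /rat_in_itvoo[q]; rewrite in_itv/= => /andP[tq qtau].
      by exists q; rewrite lte_fin.
    have [q] := rat_in_itvoo (ltr_pwDr ltr01 (lexx t)).
    by rewrite in_itv/= => /andP[tq _]; exists q; rewrite ltry.
  have [tq1 tq2] := tqtau.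
  apply: (tq q _ tq2); rewrite tq1 andbT lt_neqAle t0t andbT.
  by apply/eqP => /esym.
Unshelve. all: by end_near. Qed.

End caratheodory_solutions.

Section absolutely_continuous_functions.
Context {R : realType}.
Notation mu := (@lebesgue_measure R).

Lemma abs_continuousR_coord n (x : R -> 'cV[R]_n) I i : abs_continuous x I ->
  abs_continuousR (fun t => x t i ord0) I.
Proof.
move=> acx e /acx[d d0 hd]; exists d => // N s t st [le no] sd.
apply: le_lt_trans (hd N s t _ no sd); last by move=> j; have [] := st j.
apply: ler_sum => j _; have := coord_le_enorm (x (t j) - x (s j)) i.
by rewrite mxE [X in _ + X]mxE.
Qed.

Lemma abs_continuousRB (z1 z2 : R -> R) I :
  abs_continuousR z1 I -> abs_continuousR z2 I ->
  abs_continuousR (fun t => z1 t - z2 t) I.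
Proof.
move=> ac_1 ac_2 e e0; have e2 : 0 < e / 2 by rewrite divr_gt0.
have [d1 d10 h1] := ac_1 _ e2; have [d2 d20 h2] := ac_2 _ e2.
exists (Num.min d1 d2) => [|N s t st no]; first by rewrite lt_min d10.
rewrite lt_min => /andP[sd1 sd2].
rewrite (splitr e); apply: le_lt_trans (ltrD (h1 N s t st no sd1) (h2 N s t st no sd2)).
rewrite -big_split; apply: ler_sum => i _ /=.
have -> : z1 (t i) - z2 (t i) - (z1 (s i) - z2 (s i)) =
    (z1 (t i) - z1 (s i)) - (z2 (t i) - z2 (s i)) by ring.
exact: ler_normB.
Qed.

Lemma abs_continuousR_itg (h : R -> R) a I : Lint h -> abs_continuousR (itg h a) I.
Proof.
move=> Ih e /(itg_abs_continuous Ih)[d d0 hd]; exists d => // N s t _ no sd.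
apply: le_lt_trans (hd N s t no sd); apply: ler_sum => i _.
by apply: norm_itgB_le => //; case: no.
Qed.

Lemma abs_continuousRS (z : R -> R) (I J : set R) : J `<=` I ->
  abs_continuousR z I -> abs_continuousR z J.
Proof.
move=> JI acz e /acz[d d0 hd]; exists d => // N s t st; apply: hd => i.
by have [/JI ? /JI ?] := st i.
Qed.

Lemma abs_continuousR_clamp_continuous (z : R -> R) a b : a <= b ->
  abs_continuousR z `[a, b] ->
  continuous (fun t => z (clamp a b t)).
Proof.
move=> ab acz t; apply/cvgrPdist_lt => e e0; have [d d0 hd] := acz e e0.
have close s u : s <= u -> u - s < d -> `|z (clamp a b u) - z (clamp a b s)| < e.
  move=> su usd; have /andP[c0 cle] := clamp_dist a b su.
  have := hd 1%N (fun=> clamp a b s) (fun=> clamp a b u).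
  rewrite !big_ord1; apply.
  - by move=> i; rewrite /= !in_itv/= !clamp_itv.
  - by split => [i|i j]; [rewrite -subr_ge0|rewrite !ord1 eqxx].
  - exact: le_lt_trans usd.
near=> s; have std : `|t - s| < d.
  by near: s; exact: (nbhsx_ballx t d d0).
have [st|ts] := leP s t.
  by apply: close => //; exact: le_lt_trans (ler_norm _) std.
rewrite distrC; apply: close; first exact: ltW.
by rewrite (le_lt_trans (ler_norm _))// distrC.
Unshelve. all: by end_near. Qed.

Lemma continuous_bounded_itv (z : R -> R) a b : a <= b -> continuous z ->
  exists B, forall t, a <= t <= b -> `|z t| <= B.
Proof.
move=> ab cz.
have cn : {within `[a, b], continuous (fun t => `|z t|)}.
  apply: continuous_subspaceT => t.
  exact: (continuous_comp (cz t) (@norm_continuous _ R^o _)).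
have [c _ cP] := EVT_max ab cn.
by exists `|z c| => t abt; apply: cP; rewrite in_itv.
Qed.

Lemma abs_continuousR_measurable (z : R -> R) a b : a <= b -> abs_continuousR z `[a, b] ->
  measurable_fun `[a, b] z.
Proof.
move=> ab acz; have mc := continuous_measurable_fun (abs_continuousR_clamp_continuous ab acz).
apply: eq_measurable_fun (measurable_funTS mc) => t /set_mem/=.
by rewrite in_itv/= => /clamp_id ->.
Qed.

Lemma abs_continuousR_bounded (z : R -> R) a b : a <= b -> abs_continuousR z `[a, b] ->
  exists B, forall t, a <= t <= b -> `|z t| <= B.
Proof.
move=> ab acz; have [B HB] := continuous_bounded_itv ab (abs_continuousR_clamp_continuous ab acz).
by exists B => t abt; have := HB t abt; rewrite clamp_id.
Qed.

Lemma abs_continuous_bounded n (x : R -> 'cV[R]_n) a b : a <= b ->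
  abs_continuous x `[a, b] ->
  exists2 B, 0 <= B & forall t i, a <= t <= b -> `|x t i ord0| <= B.
Proof.
move=> ab acx.
have /choice[B HB] i := abs_continuousR_bounded ab (abs_continuousR_coord i acx).
exists (\sum_i `|B i|) => [|t i abt]; first exact: sumr_ge0.
rewrite (le_trans (HB i t abt))// (bigD1 i)//= (le_trans (ler_norm _))// lerDl.
exact: sumr_ge0.
Qed.

(** The difference of [z] and the primitive of [h] is absolutely continuous
    with derivative zero almost everywhere. *)
Lemma abs_continuousR_FTC (z w h : R -> R) a b : abs_continuousR z `[a, b] -> Lint h ->
  {ae mu, forall t, a <= t <= b -> h t = w t} ->
  {ae mu, forall t, a <= t <= b -> is_derive t (1 : R) z (w t)} ->
  forall t, a <= t <= b -> z t = z a + itg h a t.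
Proof.
move=> acz Ih hw dz t /andP[at_ tb].
have sub : `[a, t]%classic `<=` `[a, b]%classic.
  by move=> s /=; rewrite !in_itv/= => /andP[-> /le_trans ->].
have acd : abs_continuousR (fun s => z s - itg h a s) `[a, t].
  exact: abs_continuousRB (abs_continuousRS sub acz) (abs_continuousR_itg _ _ Ih).
have := abs_continuousR_derive0_eq at_ acd; rewrite (itgge h (lexx a)) subr0.
move=> H; rewrite -[LHS](subrK (itg h a t)) H//.
apply: filterS2 (filterI hw dz) (filterI (itg_derive a Ih) (ae_neq a)) => s.
move=> [hs ds] [ds' sa] /andP[as_ st].
have abs_ : a <= s <= b by rewrite as_ (le_trans st).
rewrite -(subrr (w s)) -[X in is_derive _ _ _ (_ - X)]hs//.
apply: is_deriveB; first exact: ds.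
by apply: ds'; rewrite lt_neqAle as_ andbT eq_sym; apply/eqP.
Qed.

End absolutely_continuous_functions.

Section pre_trajectories.
Context {R : realType} {n m me p : nat} (S : lure R n m me p).
Notation mu := (@lebesgue_measure R).
Notation f := (lf S).
Implicit Types (v : R -> 'cV[R]_me) (x : R -> 'cV[R]_n) (y : R -> 'cV[R]_p) (a b c : R).

Lemma Linfty_dominated v a b : on_compacts (Linfty v) (@Rplus R) -> 0 <= a ->
  mfun_vec `[a, b] v /\
  exists2 M, 0 <= M & {ae mu, forall t, a <= t <= b -> enorm (v t) <= M}.
Proof.
move=> vL a0; have [mv [M /ae_lebE vM]] := vL a b (@itv_Rplus R a b a0).
split => //; exists `|M| => //; apply: filterS vM => t + abt.
by rewrite /= in_itv/= => /(_ abt) /le_trans; apply; exact: ler_norm.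
Qed.

Lemma rhs_le v t (x : 'cV[R]_n) xi (B F M : R) i :
  (forall j, `|x j ord0| <= B) -> enorm (f t xi) <= F -> enorm (v t) <= M ->
  `|rhs S v t x xi i ord0| <= mxsum (lA S) * B + mxsum (lB S) * F + mxsum (lBe S) * M.
Proof.
move=> xB fF vM; rewrite /rhs mxE [X in `|X + _|]mxE.
rewrite (le_trans (ler_normD _ _))// lerD//; last first.
  by apply: mulmx_coord_le => j; exact: le_trans (coord_le_enorm _ _) vM.
rewrite (le_trans (ler_normD _ _))// lerD//; first exact: mulmx_coord_le.
by apply: mulmx_coord_le => j; exact: le_trans (coord_le_enorm _ _) fF.
Qed.

(** On a compact subinterval [x] is bounded, so its derivative is dominated by
    the sum of a constant and a multiple of the norm of [f t (y t)], and is
    therefore integrable; the fundamental theorem of calculus applies. *)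
Lemma integral_solution_of_pre_trajectory v t0 (tau : \bar R) x y b :
  pre_trajectory S t0 tau v x y -> t0 <= b -> (b%:E < tau)%E -> integral_solution S v t0 b x y.
Proof.
move=> [[t00 t0tau] vL acx [Ly Lf] /ae_lebE aeJ] t0b btau.
have sub : `[t0, b]%classic `<=` Ico t0 tau.
  move=> t /=; rewrite in_itv/= => /andP[t0t tb]; split => //.
  by apply: le_lt_trans btau; rewrite lee_fin.
have {}acx := acx t0 b sub; have {}Ly := Ly t0 b sub; have {}Lf := Lf t0 b sub.
have [mv [M M0 vM]] := @Linfty_dominated v t0 b vL t00.
have [phi [Iphi phi0 fphi]] := L1_dominated Lf.
have [B B0 xB] := abs_continuous_bounded t0b acx.
have mi : measurable `[t0, b]%classic by exact: measurable_itv.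
have mx : mfun_vec `[t0, b] x.
  move=> i; apply: measurable_fun_borel => //.
  exact: abs_continuousR_measurable t0b (abs_continuousR_coord i acx).
have aeJ' : {ae mu, forall t, t0 <= t <= b ->
    is_derive t (1 : R) x (rhs S v t (x t) (y t)) /\
    lF S t (y t) = outmap S v t (x t)}.
  apply: filterS aeJ => t Jt tb; have [|dx yE] := Jt; first by apply: sub; rewrite /= in_itv.
  by split => //; exact/output_eq.
pose c := mxsum (lA S) * B + mxsum (lBe S) * M.
have /choice[h hP] i : exists h, Lint h /\
    {ae mu, forall t, `[t0, b]%classic t -> h t = rhs S v t (x t) (y t) i ord0}.
  have := measurable_rhs (S := S) i mv mx Lf.1; move=> mrhs.
  have Ic : Lint (fun t => ((cst c) \_ `]t0 - 1, b]) t + mxsum (lB S) * phi t).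
    by apply: LintD; [exact: Lint_cst_cut|exact: LintZ].
  have [|h Ih hE] := integrable_borel_version mi (leb_integrable_le_ae mi mrhs Ic _).
    apply: filterS2 vM fphi => t vt ft; rewrite /= in_itv/= => tb.
    rewrite patchE mem_set; last first.
      by move: tb => /andP[t0t tb]; rewrite /= in_itv/= tb andbT (lt_le_trans _ t0t)// gtrBl.
    rewrite /c addrAC; apply: rhs_le; [|exact: ft|exact: vt].
    by move=> j; exact: xB.
  by exists h.
split => //; exists (fun t => \col_i h i t) => [i|].
  by under [X in EFin \o X]eq_fun do rewrite mxE; case: (hP i).
have hE : {ae mu, forall t, forall i, t0 <= t <= b -> h i t = rhs S v t (x t) (y t) i ord0}.
  apply: ae_forall_count => i; have [_] := hP i.
  by apply: filterS => t + tb; rewrite /= in_itv/=; exact.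
split => [t tb|].
  apply/colP => i; rewrite !mxE.
  under [X in itg X]eq_fun do rewrite mxE.
  apply: (abs_continuousR_FTC (abs_continuousR_coord i acx) (hP i).1 _ _ tb).
    by have := hE; apply: filterS => s hs; exact: hs.
  by apply: filterS aeJ' => s ds /ds[/is_derive_coords].
apply: filterS2 hE aeJ' => t ht dt tb; have [_ Fy] := dt tb; split => //.
by apply/colP => i; rewrite mxE ht.
Qed.

End pre_trajectories.

(** * Continuation of bounded solutions *)

Section half_open_intervals.
Context {R : realType}.
Notation mu := (@lebesgue_measure R).

Lemma IcoE (t0 tau : R) : Ico t0 tau%:E = `[t0, tau[%classic.
Proof. by apply/seteqP; split => t; rewrite /Ico /= in_itv/= lte_fin => /andP. Qed.

Lemma measurable_Ico (t0 tau : R) : measurable (Ico t0 tau%:E).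
Proof. by rewrite IcoE; exact: measurable_itv. Qed.

Lemma Ico_bigcup (t0 tau : R) : Ico t0 tau%:E = \bigcup_k `[t0, tau - k.+1%:R^-1]%classic.
Proof.
rewrite IcoE; apply/seteqP; split => t /=.
  rewrite in_itv/= => /andP[t0t ttau].
  have tt : 0 < tau - t by rewrite subr_gt0.
  near \oo => k; exists k => //=; rewrite in_itv/= t0t/= lerBrDr -lerBrDl ltW//.
  by near: k; exact: (near_infty_natSinv_lt (PosNum tt)).
move=> [k _] /=; rewrite !in_itv/= => /andP[-> /le_lt_trans]; apply.
by rewrite gtrBl invr_gt0.
Unshelve. all: by end_near. Qed.

Lemma mfun_vec_Ico k (g : R -> 'cV[R]_k) (t0 tau : R) :
  (forall b, t0 <= b -> b < tau -> mfun_vec `[t0, b] g) ->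
  mfun_vec (Ico t0 tau%:E) g.
Proof.
move=> mg i; rewrite Ico_bigcup.
have mi := @leb_measurable_itv R.
apply/(measurable_fun_bigcup (fun t : lebR R => g t i ord0) (fun k => mi `[t0, tau - k.+1%:R^-1])) => j.
have [le|lt] := leP t0 (tau - j.+1%:R^-1).
  by apply: mg => //; rewrite gtrBl invr_gt0.
have -> : `[t0, tau - j.+1%:R^-1]%classic = set0.
  by rewrite set_itv_ge// bnd_simp -ltNge.
exact: measurable_fun_set0.
Qed.

(** The half-open interval is a countable union of compact ones. *)
Lemma ae_Ico (P : R -> Prop) (t0 tau : R) :
  (forall b, t0 <= b -> b < tau -> {ae mu, forall t, t0 <= t <= b -> P t}) ->
  {ae mu, forall t, t0 <= t < tau -> P t}.
Proof.
move=> aeP.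
have step (k : nat) : {ae mu, forall t, t0 <= t <= tau - k.+1%:R^-1 -> P t}.
  have [le|lt] := leP t0 (tau - k.+1%:R^-1).
    by apply: aeP => //; rewrite gtrBl invr_gt0.
  by apply: nearW => t /andP[a b]; have := le_lt_trans (le_trans a b) lt; rewrite ltxx.
apply: filterS (ae_forall_count step) => t tP t0t.
have : Ico t0 tau%:E t by rewrite IcoE.
by rewrite Ico_bigcup => -[k _] /=; rewrite in_itv/=; exact: tP.
Qed.

End half_open_intervals.

Section continuation.
Context {R : realType} {n m me p : nat} (S : lure R n m me p).
Notation mu := (@lebesgue_measure R).
Notation f := (lf S).
Implicit Types (v : R -> 'cV[R]_me) (x : R -> 'cV[R]_n) (y : R -> 'cV[R]_p) (a b c : R).
Hypothesis f_car : caratheodory_function f.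
Hypothesis A1 : fibres_nonempty S.
Hypothesis A2 : radially_unbounded_loc_unif S.
Hypothesis A3 : fibre_images_convex S.
Hypothesis f_bnd : locally_L1_bounded f.

Variables (v : R -> 'cV[R]_me) (t0 tau : R) (x : R -> 'cV[R]_n) (y : R -> 'cV[R]_p).
Hypothesis t00 : 0 <= t0.
Hypothesis t0tau : t0 < tau.
Hypothesis vL : on_compacts (Linfty v) (@Rplus R).
Hypothesis sol : forall b, t0 <= b -> b < tau -> integral_solution S v t0 b x y.

Let tau0 : 0 <= tau. Proof. by rewrite (le_trans t00)// ltW. Qed.

Lemma trajectory_bounds (r : R) : 0 <= r -> exists phi (sig : R), [/\ Lint phi,
  forall t, 0 <= phi t, 0 <= sig,
  {ae mu, forall t, 0 <= t <= tau -> forall (z : 'cV[R]_n) (xi : 'cV[R]_p),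
    (forall i, `|z i ord0| <= r) -> lF S t xi = outmap S v t z ->
    [/\ forall i, `|xi i ord0| <= sig, enorm (f t xi) <= phi t &
        forall i, `|rhs S v t z xi i ord0| <= phi t]} &
  {ae mu, forall t, 0 <= t <= tau -> forall xi : 'cV[R]_p, (forall i, `|xi i ord0| <= sig) ->
    enorm (f t xi) <= phi t}].
Proof.
move=> r0.
have [D [sig [phi [[mD DT] aeD [Iphi phi0] [sig0 Dsig] Dphi]]]] :=
  apriori_bounds A2 f_bnd vL tau0 r0.
exists phi, sig; split => //.
  apply: filterS aeD => t Dt /Dt {}Dt z xi zr Fxi.
  have xis : forall i, `|xi i ord0| <= sig by exact: (fibre_bound Dsig Dt zr Fxi).
  have [fphi rphi] := Dphi t xi Dt xis.
  by split => //; exact: rphi.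
by apply: filterS aeD => t Dt /Dt {}Dt xi xis; case: (Dphi t xi Dt xis).
Qed.

Lemma integral_solution_bounded b : t0 <= b -> b < tau ->
  exists2 B, 0 <= B & forall t i, t0 <= t <= b -> `|x t i ord0| <= B.
Proof.
move=> t0b btau; have [_ _ [h Ih [xh _]]] := sol t0b btau.
exact: abs_continuous_bounded t0b (abs_continuous_vitg Ih xh).
Qed.

(** Close to [tau], the integral of [phi] over the remaining time is less than
    [1 / 2]. So a state that is in the box of radius [r] at a time [s] this
    late moves by at most [1 / 2] as long as it stays in the box of radius [r
    + 1], and therefore never leaves that box. *)
Lemma state_trapped (r : R) : 0 <= r ->
  (forall s, s < tau -> exists2 t, s < t < tau & forall i, `|x t i ord0| <= r) ->
  exists2 s, t0 <= s < tau & forall t i, s <= t < tau -> `|x t i ord0| <= r + 1.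
Proof.
move=> r0 freq; have r1 : 0 <= r + 1 by rewrite addr_ge0.
have [phi [sig [Iphi phi0 sig0 vb _]]] := trajectory_bounds r1.
have half : (0 : R) < 1 / 2 by rewrite divr_gt0.
have [d d0 hd] := itg_small Iphi half.
have [s /andP[ms stau] xsr] : exists2 s, Num.max t0 (tau - d) < s < tau &
    forall i, `|x s i ord0| <= r.
  by apply: freq; rewrite gt_max t0tau gtrBl.
move: ms; rewrite gt_max => /andP[t0s ds].
exists s; first by rewrite ltW.
move=> t1 i0 /andP[st1 t1tau].
have t0t1 : t0 <= t1 := le_trans (ltW t0s) st1.
have [_ _ [h Ih [xh aeh]]] := sol t0t1 t1tau.
have xB u w : s <= u -> u <= w -> w <= t1 -> x w - x u = vitg h u w.
  move=> su uw wt; have t0u := le_trans (ltW t0s) su.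
  rewrite xh ?(le_trans t0u uw)// (xh u) ?t0u ?(le_trans uw wt)//.
  by rewrite -(coord_vitgB Ih t0u uw); apply/colP => i; rewrite !mxE; ring.
pose g t := \sum_i `|h t i ord0|.
have Ig : Lint g by apply: Lint_sum => i; exact: Lint_norm.
(* [d] bounds the time that is left; [d'] comes from the continuity of x and
   allows to look a little beyond the time reached so far *)
have [d' d'0 hd'] := itg_small Ig half.
have small u w i : s <= u -> u <= w -> w <= t1 -> w - u < d' ->
    `|x w i ord0 - x u i ord0| <= 1 / 2.
  move=> su uw wt wud; apply/ltW; apply: le_lt_trans (hd' u w uw wud).
  have -> : x w i ord0 - x u i ord0 = vitg h u w i ord0.
    by rewrite -xB// !mxE.
  rewrite mxE; apply: norm_itg_le => //; first exact: Lint_norm.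
  apply: nearW => t _; apply: le_trans (ler_norm _).
  by rewrite /g (bigD1 i)//= lerDl; exact: sumr_ge0.
pose P t := forall u i, s <= u <= t -> `|x u i ord0 - x s i ord0| <= 1 / 2.
suff Pt1 : P t1.
  rewrite -[x t1 i0 ord0](subrK (x s i0 ord0)) addrC (le_trans (ler_normD _ _))//.
  rewrite lerD// (le_trans (Pt1 t1 i0 _)) ?st1 ?lexx//; lra.
apply: (real_induction st1).
  move=> u i /andP[su us]; have -> : u = s by apply/eqP; rewrite eq_le us su.
  by rewrite subrr normr0 ltW.
move=> c /andP[sc ct1]; exists (d' / 2); first by rewrite divr_gt0.
move=> s' u ss' ut1 /andP[cs' s'c] /andP[cu ucd] Ps' w i /andP[sw wu].
have wt1 := le_trans wu ut1.
have xr u' j : s <= u' <= u -> `|x u' j ord0| <= r + 1.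
  move=> /andP[su' u'u].
  suff H : `|x u' j ord0 - x s j ord0| <= 1.
    rewrite -[x u' j ord0](subrK (x s j ord0)) addrC (le_trans (ler_normD _ _))//.
    by rewrite lerD.
  have [u's'|s'u'] := leP u' s'.
    by rewrite (le_trans (Ps' u' j _)) ?su'//; lra.
  rewrite -[x u' j ord0](subrK (x s' j ord0)) -addrA (le_trans (ler_normD _ _))//.
  rewrite [leRHS](splitr 1) lerD ?Ps' ?ss' ?lexx// small ?(ltW s'u')//.
    exact: le_trans ut1.
  by rewrite ltrBlDr (le_lt_trans u'u)//; lra.
have -> : x w i ord0 - x s i ord0 = vitg h s w i ord0 by rewrite -xB// !mxE.
rewrite mxE; apply: (@le_trans _ _ (itg (fun t => `|phi t|) s w)).
  apply: norm_itg_le => //; first exact: Lint_norm.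
  apply: filterS2 aeh vb => t ht tb /andP[st tw].
  have t0t : t0 <= t by rewrite (le_trans (ltW t0s))// ltW.
  have tt1 : t <= t1 := le_trans tw wt1.
  have [|-> Fy] := ht; first by rewrite t0t.
  apply: le_trans (ler_norm _).
  have tt : 0 <= t <= tau by rewrite (le_trans t00 t0t) (le_trans tt1)// ltW.
  have xrt j : `|x t j ord0| <= r + 1 by apply: xr; rewrite ltW// (le_trans tw).
  by have [_ _] := tb tt _ _ xrt Fy; exact.
by apply/ltW/hd => //; rewrite ltrBlDr; lra.
Qed.

(** A bounded state has an integrable velocity up to [tau], so the integral
    formula defines the state at [tau]. The output at the single time [tau] is
    arbitrary; zero keeps it bounded. *)
Lemma integral_solution_closure (B : R) : 0 <= B ->
  (forall t i, t0 <= t < tau -> `|x t i ord0| <= B) ->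
  exists x' y', [/\ integral_solution S v t0 tau x' y', forall t, t < tau -> x' t = x t &
     forall t, t < tau -> y' t = y t].
Proof.
move=> B0 xB; have [phi [sig [Iphi phi0 sig0 vb vb2]]] := trajectory_bounds B0.
set J := Ico t0 tau%:E.
have mJ : measurable J by exact: measurable_Ico.
have mJl := borel_caratheodory mJ.
have JP t : J t -> t0 <= t < tau by rewrite /J IcoE /= in_itv.
have mi := @leb_measurable_itv R.
have aeJ : {ae mu, forall t, t0 <= t < tau -> lF S t (y t) = outmap S v t (x t)}.
  apply: ae_Ico => b t0b btau; have [_ _ [h _ [_ aeh]]] := sol t0b btau.
  by apply: filterS aeh => t ht /ht[].
have my : mfun_vec J y.
  by apply: mfun_vec_Ico => b t0b btau; have [[]] := sol t0b btau.
have mf : mfun_vec J (fun t => f t (y t)).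
  by apply: mfun_vec_Ico => b t0b btau; have [_ []] := sol t0b btau.
have mx : mfun_vec J x.
  apply: mfun_vec_Ico => b t0b btau i; have [_ _ [h Ih [xh _]]] := sol t0b btau.
  apply: measurable_fun_borel => //.
  exact: abs_continuousR_measurable t0b (abs_continuousR_coord i (abs_continuous_vitg Ih xh)).
have Jsub : J `<=` `[t0, tau]%classic.
  by move=> t /JP; rewrite /= in_itv/= => /andP[-> /ltW].
have mv : mfun_vec J v.
  by apply: (mfun_vecS (mi `[t0, tau]) Jsub); have [] := vL (@itv_Rplus R t0 tau t00).
have bnd : {ae mu, forall t, t0 <= t < tau ->
    [/\ forall i, `|y t i ord0| <= sig, enorm (f t (y t)) <= phi t &
        forall i, `|rhs S v t (x t) (y t) i ord0| <= phi t]}.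
  apply: filterS2 aeJ vb => t Fy tb t0t; apply: tb => //.
  - by move: t0t => /andP[t0t /ltW ->]; rewrite (le_trans t00).
  - by move=> i; exact: xB.
  - exact: Fy.
have /choice[h hP] i : exists h, Lint h /\
    {ae mu, forall t, J t -> h t = rhs S v t (x t) (y t) i ord0}.
  have mr := measurable_rhs (S := S) i mv mx mf.
  have [|h Ih hE] := integrable_borel_version mJ (leb_integrable_le_ae mJ mr Iphi _).
    by apply: filterS bnd => t tb /JP /tb[_ _]; exact.
  by exists h.
pose H t : 'cV[R]_n := \col_i h i t.
have IH i : Lint (fun t => H t i ord0).
  by under [X in EFin \o X]eq_fun do rewrite mxE; case: (hP i).
have HE : {ae mu, forall t, t0 <= t < tau -> H t = rhs S v t (x t) (y t)}.
  have : {ae mu, forall t, forall i, J t -> h i t = rhs S v t (x t) (y t) i ord0}.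
    by apply: ae_forall_count => i; case: (hP i).
  apply: filterS => t ht t0t; apply/colP => i; rewrite mxE ht// /J IcoE /= in_itv.
  exact: t0t.
have xH t : t0 <= t < tau -> x t = x t0 + vitg H t0 t.
  move=> /andP[t0t ttau]; have [_ _ [h' Ih' [xh' aeh']]] := sol t0t ttau.
  rewrite xh' ?t0t ?lexx//; congr (_ + _); apply/colP => i; rewrite !mxE.
  apply: eq_itg_ae; [exact: Lint_measurable|exact: Lint_measurable|].
  apply: filterS2 aeh' HE => s hs Hs /andP[t0s st].
  have [|-> _] := hs; first by rewrite ltW.
  by rewrite Hs// ltW//= (le_lt_trans st).
pose x' t := if t < tau then x t else x t0 + vitg H t0 tau.
pose y' t := if t < tau then y t else 0.
have x'E t : t < tau -> x' t = x t by rewrite /x' => ->.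
have y'E t : t < tau -> y' t = y t by rewrite /y' => ->.
exists x', y'; split => //.
have my' : mfun_vec `[t0, tau] y'.
  have [z [mz zE z0]] := zero_ext_measurable mJl my.
  move=> i; apply: eq_measurable_fun (measurable_funTS (mz i)) => t /set_mem.
  rewrite /= in_itv/= => /andP[t0t ttau]; rewrite /y'; case: ifPn => lt.
    by rewrite zE// /J IcoE /= in_itv/= t0t.
  rewrite z0// => /JP/andP[_]; exact/negP.
have aetau := ae_neq tau.
have y'sig : {ae mu, forall t, t0 <= t <= tau -> forall i, `|y' t i ord0| <= sig}.
  apply: filterS2 bnd aetau => t tb ttau /andP[t0t tle].
  have lt : t < tau by rewrite lt_neqAle tle andbT; exact/eqP.
  by rewrite y'E//; have [] := tb _; rewrite ?t0t.
split.
- apply: (L1_le_ae (phi := (cst (p%:R * sig)) \_ `]t0 - 1, tau]) (measurable_itv _) my').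
    exact: Lint_cst_cut.
  apply: filterS y'sig => t tb; rewrite /= in_itv/= => tt.
  have /andP[t0t tt'] := tt.
  rewrite patchE mem_set; last by rewrite /= in_itv/= tt' andbT (lt_le_trans _ t0t)// gtrBl.
  by apply: enorm_le => i; exact: tb.
- apply: (L1_le_ae (phi := phi) (measurable_itv _) _ Iphi).
    exact: (measurable_f_comp f_car (mi _) (@itv_Rplus R t0 tau t00) my').
  apply: filterS2 y'sig vb2 => t ts tb; rewrite /= in_itv/= => tt.
  apply: tb; last exact: ts.
  by move: tt => /andP[t0t ->]; rewrite (le_trans t00).
exists H; first exact: IH.
split => [t /andP[t0t tle]|].
  rewrite [x' t0]x'E// /x'; case: ifPn => lt; first by apply: xH; rewrite t0t.
  by have -> : t = tau by apply/eqP; rewrite eq_le tle leNgt.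
apply: filterS (filterI (filterI HE aeJ) aetau) => t [[Ht Fy] ttau] /andP[t0t tle].
have lt : t < tau by rewrite lt_neqAle tle andbT; exact/eqP.
by rewrite x'E// y'E//; split; [apply: Ht|apply: Fy]; rewrite t0t.
Qed.

Lemma integral_solution_extension (B : R) : 0 <= B ->
  (forall t i, t0 <= t < tau -> `|x t i ord0| <= B) ->
  exists c x' y', [/\ tau < c, integral_solution S v t0 c x' y',
    forall t, t < tau -> x' t = x t & forall t, t < tau -> y' t = y t].
Proof.
move=> B0 xB; have [x1 [y1 [s1 x1E y1E]]] := integral_solution_closure B0 xB.
pose rho := \sum_i `|x1 tau i ord0|.
have rho0 : 0 <= rho by exact: sumr_ge0.
have [eta eta0 loc] := local_existence f_car A1 A3 A2 f_bnd vL tau0 rho0.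
have [|||x2 [y2 [x2E s2]]] := loc tau (x1 tau) _ _ eta.
- by rewrite tau0 lexx.
- by move=> i; rewrite /rho (bigD1 i)//= lerDl sumr_ge0.
- by rewrite eta0 lexx.
have tc : tau < tau + eta by rewrite ltrDl.
exists (tau + eta), (splice tau x1 x2), (splice tau y1 y2); split => //.
- exact: (integral_solution_splice (ltW t0tau) (ltW tc) (esym x2E) s1 s2).
- by move=> t ttau; rewrite /splice ltW// x1E.
- by move=> t ttau; rewrite /splice ltW// y1E.
Qed.

End continuation.

(** * Maximal pre-trajectories *)

Section maximal_trajectories.
Context {R : realType} {n m me p : nat} (S : lure R n m me p).
Notation mu := (@lebesgue_measure R).
Notation f := (lf S).
Implicit Types (v : R -> 'cV[R]_me) (x : R -> 'cV[R]_n) (y : R -> 'cV[R]_p) (a b c : R).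
Hypothesis f_car : caratheodory_function f.
Hypothesis A1 : fibres_nonempty S.
Hypothesis A2 : radially_unbounded_loc_unif S.
Hypothesis A3 : fibre_images_convex S.
Hypothesis f_bnd : locally_L1_bounded f.

Section finite_lifespan.
Variables (v : R -> 'cV[R]_me) (t0 tau : R) (x : R -> 'cV[R]_n) (y : R -> 'cV[R]_p).
Hypothesis maxi : max_pre_trajectory S t0 tau%:E v x y.

Let pre : pre_trajectory S t0 tau%:E v x y. Proof. by case: maxi. Qed.
Let t00 : 0 <= t0. Proof. by case: pre => -[]. Qed.
Let t0tau : t0 < tau. Proof. by case: pre => -[_]; rewrite lte_fin. Qed.
Let vL : on_compacts (Linfty v) (@Rplus R). Proof. by case: pre. Qed.
Let sol b : t0 <= b -> b < tau -> integral_solution S v t0 b x y.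
Proof. by move=> t0b btau; apply: (integral_solution_of_pre_trajectory pre). Qed.

Lemma maximal_unbounded (B : R) : 0 <= B ->
  (forall t i, t0 <= t < tau -> `|x t i ord0| <= B) -> False.
Proof.
move=> B0 xB; have [c [x' [y' [tauc sc xx' yy']]]] :=
  integral_solution_extension f_car A1 A2 A3 f_bnd t00 t0tau vL sol B0 xB.
case: maxi => _; apply; exists c%:E, x', y'; split.
- by rewrite lte_fin.
- apply: pre_trajectory_of_integral_solution => //; first by rewrite lte_fin (lt_trans t0tau).
  move=> b t0b; rewrite lte_fin => bc; apply: integral_solution_sub sc.
  by rewrite t0b ltW.
- by move=> t [_]; rewrite lte_fin; exact: xx'.
- by apply: nearW => t [_]; rewrite lte_fin; exact: yy'.
Qed.

Lemma maximal_unbounded_near (s B : R) : t0 <= s < tau ->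
  (forall t i, s <= t < tau -> `|x t i ord0| <= B) -> False.
Proof.
move=> /andP[t0s stau] xB; have [B' B'0 xB'] := integral_solution_bounded sol t0s stau.
apply: (@maximal_unbounded (`|B| + B')) => [|t i /andP[t0t ttau]].
  by rewrite addr_ge0.
have [ts|/ltW st] := leP t s.
  by rewrite (le_trans (xB' t i _)) ?t0t// lerDr.
by rewrite (le_trans (xB t i _)) ?st// (le_trans (ler_norm _))// lerDl.
Qed.

(** Otherwise the state would return to a box arbitrarily close to [tau], and
    would be trapped in a larger one. *)
Lemma maximal_norm_cvgy : enorm (x t) @[t --> tau^'-] --> +oo.
Proof.
apply/cvgryPge => A.
have [[s stau xs]|nex] := pselect (exists2 s, s < tau & forall t, s < t < tau -> A <= enorm (x t)).
  near=> t; apply: xs; apply/andP; split; near: t; first exact: nbhs_left_gt.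
  exact: nbhs_left_lt.
exfalso.
have freq s : s < tau -> exists2 t, s < t < tau & forall i, `|x t i ord0| <= `|A|.
  move=> stau; apply: contrapT => nt; apply: nex; exists s => // t st.
  rewrite leNgt; apply/negP => xA; apply: nt; exists t => // i.
  by rewrite (le_trans (coord_le_enorm _ _))// (le_trans (ltW xA))// ler_norm.
have [s st xs] := state_trapped A2 f_bnd t00 t0tau vL sol (normr_ge0 A) freq.
exact: maximal_unbounded_near st xs.
Unshelve. all: by end_near. Qed.

Let J := Ico t0 tau%:E.

Let JP t : J t <-> t0 <= t < tau.
Proof. by rewrite /J IcoE /= in_itv. Qed.

Lemma mfun_vec_input : mfun_vec J (fun t => f t (y t)).
Proof. by apply: mfun_vec_Ico => b t0b btau; have [_ []] := sol t0b btau. Qed.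

Lemma measurable_input_norm :
  measurable_fun (J : set (lebR R)) (fun t : lebR R => enorm (lB S *m f t (y t))).
Proof.
by apply: enorm_measurable => i; apply: measurable_mulmx; exact: mfun_vec_input.
Qed.

(** If [B f] were integrable, the velocity would be at most [cA] times the
    size of the state plus an integrable [psi]. Let [s] be so close to [tau]
    that [cA * (tau - s) <= 1 / 2]. Then the maximum [X] of the state on an
    interval from [s] is at most its size at [s] plus [X / 2] plus the
    integral of [psi], which bounds [X] independently of the interval. *)
Lemma input_not_integrable :
  ~ (leb R).-integrable J (EFin \o (fun t => enorm (lB S *m f t (y t)))).
Proof.
move=> iBf.
have [be Ibe beE] := integrable_borel_version (measurable_Ico t0 tau) iBf.
have [_ [M M0 vM]] := Linfty_dominated tau vL t00.
pose cA := mxsum (lA S); have cA0 : 0 <= cA := mxsum_ge0 _.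
pose cBe := mxsum (lBe S); have cBe0 : 0 <= cBe := mxsum_ge0 _.
pose psi t := `|be t| + ((cst (cBe * M)) \_ `]t0 - 1, tau]) t.
have Ipsi : Lint psi by apply: LintD; [exact: Lint_norm|exact: Lint_cst_cut].
have cM0 : 0 <= cBe * M by rewrite mulr_ge0.
have psi0 t : 0 <= psi t by rewrite addr_ge0// patchE; case: ifP.
have k0 : 0 < 2 * (cA + 1) by rewrite mulr_gt0// ltr_wpDl.
pose s := Num.max t0 (tau - (2 * (cA + 1))^-1).
have t0s : t0 <= s by rewrite le_max lexx.
have stau : s < tau by rewrite gt_max t0tau gtrBl invr_gt0.
have cAs t : t < tau -> cA * (t - s) <= 1 / 2.
  move=> ttau; have ts : t - s <= (2 * (cA + 1))^-1.
    rewrite lerBlDr -lerBlDl (le_trans _ (_ : tau - (2 * (cA + 1))^-1 <= s))//.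
      by rewrite lerD2r ltW.
    by rewrite le_max lexx orbT.
  apply: (@le_trans _ _ (cA * (2 * (cA + 1))^-1)); first by rewrite ler_wpM2l.
  by rewrite ler_pdivrMr//; lra.
have [Xs Xs0 xXs] := integral_solution_bounded sol t0s stau.
pose L := itg psi s tau.
apply: (@maximal_unbounded_near s (2 * (Xs + L))); first by rewrite t0s.
move=> t1 i0 /andP[st1 t1tau].
have t0t1 := le_trans t0s st1.
have [_ _ [h Ih [xh aeh]]] := sol t0t1 t1tau.
have [X1 X10 xX1] := integral_solution_bounded sol t0t1 t1tau.
pose A := [set r | exists t i, s <= t <= t1 /\ r = `|x t i ord0|].
have A1s : A `|x t1 i0 ord0| by exists t1, i0; rewrite st1 lexx.
have ubA : ubound A X1.
  by move=> _ [t [i [/andP[st tt1] ->]]]; apply: xX1; rewrite (le_trans t0s).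
have hsA : has_sup A by split; [exists (`|x t1 i0 ord0| ) | exists X1].
pose X := sup A.
have xX t i : s <= t <= t1 -> `|x t i ord0| <= X.
  by move=> stt; apply: ub_le_sup; [exists X1|exists t, i].
have X0 : 0 <= X := le_trans (normr_ge0 _) (xX t1 i0 (introT andP (conj st1 (lexx _)))).
suff XL : X <= Xs + X / 2 + L.
  by rewrite (le_trans (xX t1 i0 _)) ?st1 ?lexx//; lra.
apply: ge_sup; first by exists `|x t1 i0 ord0|.
move=> _ [t [i [/andP[st tt1] ->]]].
have ttau := le_lt_trans tt1 t1tau.
have t0t := le_trans t0s st.
have -> : x t i ord0 = x s i ord0 + itg (fun r => h r i ord0) s t.
  rewrite (xh t) ?t0t// (xh s) ?t0s ?(le_trans st)// !mxE.
  by rewrite (itg_chasles (Ih i) t0s st) addrA.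
rewrite (le_trans (ler_normD _ _))// -addrA lerD//; first by apply: xXs; rewrite t0s lexx.
pose phi r := ((cst (cA * X)) \_ `]t0 - 1, tau]) r + psi r.
have Iphi : Lint phi by apply: LintD => //; exact: Lint_cst_cut.
apply: (@le_trans _ _ (itg phi s t)); last first.
  rewrite itgD//; last exact: Lint_cst_cut.
  have t01s : t0 - 1 <= s by rewrite (le_trans _ t0s)// gerBl.
  rewrite itg_cst_cut ?(ltW ttau)// lerD//; last by rewrite itg_sub// ltW.
  by rewrite mulrAC [leRHS]mulrC ler_wpM2r// (le_trans (cAs t ttau))// mul1r.
apply: norm_itg_le => //.
have beE' : {ae mu, forall r, t0 <= r < tau -> be r = enorm (lB S *m f r (y r))}.
  by apply: filterS beE => r br /JP.
apply: filterS (filterI aeh (filterI beE' vM)) => r [hr [br vr]] /andP[sr rt].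
have t0r : t0 <= r by rewrite (le_trans t0s)// ltW.
have rt1 : r <= t1 := le_trans rt tt1.
have rtau := le_lt_trans rt1 t1tau.
have [|-> _] := hr; first by rewrite t0r.
have rI : `]t0 - 1, tau]%classic r.
  by rewrite /= in_itv/= (ltW rtau) andbT (lt_le_trans _ t0r)// gtrBl.
rewrite /phi /psi !patchE mem_set//= addrA.
rewrite /rhs mxE [X in `|X + _|]mxE (le_trans (ler_normD _ _))// lerD//; last first.
  apply: mulmx_coord_le => j; apply: (le_trans (coord_le_enorm _ _)).
  by apply: vr; rewrite t0r ltW.
rewrite (le_trans (ler_normD _ _))// lerD//.
  by apply: mulmx_coord_le => j; apply: xX; rewrite (ltW sr).
rewrite br ?t0r// (le_trans (coord_le_enorm _ _))//; exact: ler_norm.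
Qed.

Lemma input_integral_infty :
  (\int[leb R]_(t in J) (enorm (lB S *m f t (y t)))%:E)%E = +oo%E.
Proof.
apply: contrapT => /eqP; rewrite -ltey => lt.
apply: input_not_integrable; apply/integrableP; split.
  exact/measurable_EFinP/measurable_input_norm.
apply: le_lt_trans lt; rewrite le_eqVlt; apply/orP; left; apply/eqP.
by apply: eq_integral => t _ /=; rewrite ger0_norm// enorm_ge0.
Qed.

(** On a bounded set of outputs [f] has an integrable bound, so a bounded
    output would make [B f] integrable. *)
Lemma output_not_Linfty : ~ Linfty y J.
Proof.
move=> [_ [M /ae_lebE yM]]; apply: input_not_integrable.
have [phiK [phiK0 phiKI phiKP]] := f_bnd (@compact_box R p `|M|).
have [phi Iphi phiE] := integrable_borel_version (measurable_itv _)
  (phiKI 0 tau (@itv_Rplus R 0 tau (lexx 0))).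
apply: (leb_integrable_le_ae (measurable_Ico t0 tau) measurable_input_norm
  (phi := fun t => n%:R * mxsum (lB S) * phi t)); first exact: LintZ.
apply: filterS2 yM phiE => t yt pt Jt; have /andP[t0t ttau] := (JP t).1 Jt.
have t_ge0 := le_trans t00 t0t.
rewrite ger0_norm ?enorm_ge0// -mulrA; apply: enorm_le => i.
apply: mulmx_coord_le => j; apply: (le_trans (coord_le_enorm _ _)).
rewrite pt; last by rewrite /= in_itv/= t_ge0 ltW.
apply: phiKP => // k; apply: (le_trans (coord_le_enorm _ _)).
exact: le_trans (yt Jt) (ler_norm _).
Qed.

Lemma limsup_state_infty :
  (limf_esup (fun t => (enorm (x t))%:E) (tau^'-) = +oo)%E.
Proof.
apply/eqP; rewrite -leye_eq; apply: le_ereal_inf_tmp => _ [V tV <-].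
rewrite leye_eq; apply/eqP/eq_infty => A.
have /cvgryPge/(_ A) xA := maximal_norm_cvgy.
have [t [At Vt]] := @filter_ex _ (tau^'-) _ _ (filterI xA tV).
apply: (@le_trans _ _ (enorm (x t))%:E); first by rewrite lee_fin.
by apply: ereal_sup_ubound; exists t.
Qed.

End finite_lifespan.

Lemma lure_blow_up : blow_up_property S.
Proof.
move=> t0 tau v x y maxi; rewrite (limsup_state_infty maxi).
rewrite addye// -ltNye; apply: (@lt_le_trans _ _ 0%E) => //.
by apply: integral_ge0 => t _; rewrite lee_fin addr_ge0// enorm_ge0.
Qed.

Lemma integral_solution_point v a x y : 0 <= a -> integral_solution S v a a x y.
Proof.
move=> a0; have aea := ae_neq a.
have mt k (g : R -> 'cV[R]_k) : L1 g `[a, a].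
  apply: (L1_le_ae (measurable_itv _) _ Lint0).
    by move=> i; rewrite set_itv1; exact: measurable_fun_set1.
  apply: filterS aea => t ta; rewrite /= in_itv/= => /andP[at_ ta'].
  by exfalso; apply: ta; apply/eqP; rewrite eq_le at_ ta'.
split; [exact: mt|exact: mt|exists (fun=> 0)].
  by move=> i; under [X in EFin \o X]eq_fun do rewrite mxE; exact: Lint0.
split => [t /andP[at_ ta]|].
  have -> : t = a by apply/eqP; rewrite eq_le at_ ta.
  by apply/colP => i; rewrite !mxE itgge// addr0.
apply: filterS aea => t ta /andP[at_ ta'].
by exfalso; apply: ta; apply/eqP; rewrite eq_le at_ ta'.
Qed.

(** Starting from [t0], the solution is prolonged again and again by
    [k.+1%:R^-1], where [k] is the least number for which some solution
    prolongs it that far. If the limit of the times were some [r] beyond which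
    the result could be continued, the states would be bounded, and by
    [local_existence] the numbers [k] would be bounded too: the times would
    grow without bound. *)
Theorem maximal_existence v (t0 : R) (x0 : 'cV[R]_n) :
  on_compacts (Linfty v) (@Rplus R) -> 0 <= t0 ->
  exists tau x y, max_pre_trajectory S t0 tau v x y /\ x t0 = x0.
Proof.
move=> vL t00.
pose has_step k s (xi : 'cV[R]_n) :=
  exists x y, x s = xi /\ integral_solution S v s (s + k.+1%:R^-1) x y.
have small_step (eta : R) : 0 < eta -> exists k, k.+1%:R^-1 <= eta.
  move=> eta0; near \oo => k; exists k; apply/ltW.
  by near: k; exact: (near_infty_natSinv_lt (PosNum eta0)).
(* [stp] maps a time and a state to the step, the state and the output of a
   nearly longest solution from there *)
have /choice[stp stpP] (sx : R * 'cV[R]_n) :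
    exists w : nat * (R -> 'cV[R]_n) * (R -> 'cV[R]_p), 0 <= sx.1 ->
    [/\ w.1.2 sx.1 = sx.2, integral_solution S v sx.1 (sx.1 + w.1.1.+1%:R^-1) w.1.2 w.2 &
      forall k, has_step k sx.1 sx.2 -> (w.1.1 <= k)%N].
  case: sx => s xi; have [s0|ns0] := pselect (0 <= s); last first.
    by exists (0%N, fun=> 0, fun=> 0).
  pose rho := \sum_i `|xi i ord0|.
  have rho0 : 0 <= rho by exact: sumr_ge0.
  have [eta eta0 loc] := local_existence f_car A1 A3 A2 f_bnd vL s0 rho0.
  have [k keta] := small_step _ eta0.
  have ex : exists k, `[< has_step k s xi >].
    exists k; apply/asboolP; have [|||x [y [xs sxy]]] := loc s xi _ _ k.+1%:R^-1.
    - by rewrite s0 lexx.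
    - by move=> i; rewrite /rho (bigD1 i)//= lerDl sumr_ge0.
    - by rewrite invr_gt0 ltr0n.
    - by exists x, y.
  case: (ex_minnP ex) => k0 /asboolP[x [y [xs sxy]]] mink.
  by exists (k0, x, y) => _; split => // j /asboolP; exact: mink.
pose fix st k : R * (R -> 'cV[R]_n) * (R -> 'cV[R]_p) :=
  if k is k'.+1 then
    let s := (st k').1.1 in let w := stp (s, (st k').1.2 s) in
    (s + w.1.1.+1%:R^-1, splice s (st k').1.2 w.1.2, splice s (st k').2 w.2)
  else (t0, fun=> x0, fun=> 0).
pose T k := (st k).1.1; pose X k := (st k).1.2; pose Y k := (st k).2.
pose W k := stp (T k, X k (T k)).
have TS k : T k.+1 = T k + (W k).1.1.+1%:R^-1 by [].
have XS k : X k.+1 = splice (T k) (X k) (W k).1.2 by [].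
have YS k : Y k.+1 = splice (T k) (Y k) (W k).2 by [].
have Tlt k : T k < T k.+1 by rewrite TS ltrDl invr_gt0.
have t0T k : t0 <= T k.
  by elim: k => [|k ih]; [exact: lexx|rewrite (le_trans ih)// ltW].
have T0 k : 0 <= T k := le_trans t00 (t0T k).
have WP k : [/\ (W k).1.2 (T k) = X k (T k),
    integral_solution S v (T k) (T k.+1) (W k).1.2 (W k).2 &
    forall j, has_step j (T k) (X k (T k)) -> ((W k).1.1 <= j)%N].
  by have := stpP (T k, X k (T k)) (T0 k).
have Tle j k : (j <= k)%N -> T j <= T k.
  elim: k => [|k ih]; first by rewrite leqn0 => /eqP ->.
  by rewrite leq_eqVlt => /predU1P[->//|/ih le]; rewrite (le_trans le)// ltW.
have XE j k t : (j <= k)%N -> t <= T j -> X k t = X j t /\ Y k t = Y j t.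
  elim: k => [|k ih]; first by rewrite leqn0 => /eqP ->.
  rewrite leq_eqVlt => /predU1P[->//|jk tj].
  rewrite XS YS /splice (le_trans tj (Tle j k jk)); exact: ih jk tj.
have solk k : integral_solution S v t0 (T k) (X k) (Y k).
  elim: k => [|k ih]; first exact: integral_solution_point.
  have [WT sW _] := WP k.
  by rewrite XS YS; apply: integral_solution_splice (ltW (Tlt k)) _ ih sW.
have Xt0 k : X k t0 = x0 by have [] := XE 0%N k t0 (leq0n k) (lexx _).
pose tau := ereal_sup (range (fun k => (T k)%:E)).
have Ttau k : ((T k)%:E < tau)%E.
  apply: (@lt_le_trans _ _ (T k.+1)%:E); first by rewrite lte_fin.
  by apply: ereal_sup_ubound; exists k.+1.
(* all stages whose time is at least t agree at t; [kap t] is one of them *)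
have /choice[kap kapP] (t : R) : exists k, forall j, t <= T j -> t <= T k.
  have [[k tk]|nk] := pselect (exists k, t <= T k); first by exists k.
  by exists 0%N => j tj; exfalso; apply: nk; exists j.
pose x t := X (kap t) t; pose y t := Y (kap t) t.
have xyE k t : t <= T k -> x t = X k t /\ y t = Y k t.
  move=> tk; have tkap := kapP t k tk; rewrite /x /y.
  have [le|/ltnW le] := leqP k (kap t); first exact: XE.
  by have [-> ->] := XE _ _ t le tkap.
have sol b : t0 <= b -> (b%:E < tau)%E -> integral_solution S v t0 b x y.
  move=> t0b /ereal_sup_gt[_ [k _ <-]]; rewrite lte_fin => bk.
  apply: (@integral_solution_sub _ _ _ _ _ S v t0 b (T k)); first by rewrite t0b ltW.
  apply: (integral_solution_eq (t0T k) _ _ (solk k)) => t /andP[_ tk]; have [] := xyE k t tk => //.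
have pre : pre_trajectory S t0 tau v x y.
  exact: pre_trajectory_of_integral_solution t00 (Ttau 0%N) vL sol.
exists tau, x, y; split; last by have [-> _] := xyE 0%N t0 (lexx _); exact: Xt0.
split => //; move=> [tau' [x' [y' [tautau' pre' xx' yy']]]].
have [r tauE] : exists r : R, tau = r%:E.
  case: (tau) tautau' (Ttau 0%N) => [r _ _|//|//]; first by exists r.
  by rewrite ltNge leey.
rewrite tauE in tautau' Ttau xx'.
have t0r : t0 <= r by have := Ttau 0%N; rewrite lte_fin => /ltW.
have r0 : 0 <= r := le_trans t00 t0r.
have [_ _ [h Ih [xh _]]] := integral_solution_of_pre_trajectory pre' t0r tautau'.
have [B B0 xB] := abs_continuous_bounded t0r (abs_continuous_vitg Ih xh).
have [eta eta0 loc] := local_existence f_car A1 A3 A2 f_bnd vL r0 B0.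
have [N Neta] := small_step _ eta0.
have WN k : ((W k).1.1 <= N)%N.
  have [_ _] := WP k; apply.
  have Tr : T k < r by have := Ttau k; rewrite lte_fin.
  have [|||x1 [y1 [x1s s1]]] := loc (T k) (X k (T k)) _ _ N.+1%:R^-1.
  - by rewrite T0 ltW.
  - move=> i; have [<- _] := xyE k (T k) (lexx _).
    rewrite -xx'; last by split => //; rewrite lte_fin.
    by apply: xB; rewrite t0T ltW.
  - by rewrite invr_gt0 ltr0n.
  - by exists x1, y1.
have Tk k : t0 + k%:R * N.+1%:R^-1 <= T k.
  elim: k => [|k ih]; first by rewrite mul0r addr0.
  rewrite TS -natr1 mulrDl mul1r addrA lerD//.
  by rewrite lef_pV2 ?posrE// ler_nat ltnS.
near \oo => k.
have := le_lt_trans (Tk k) (Ttau k : T k < r).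
apply/negP; rewrite -leNgt -lerBlDl ler_pdivlMr//.
by apply/ltW; near: k; exact: nbhs_infty_gtr.
Unshelve. all: by end_near. Qed.

End maximal_trajectories.

Theorem theorem4p10 (R : realType) (n m me p : nat)
  (n_gt0 : (0 < n)%N) (m_gt0 : (0 < m)%N)
  (me_gt0 : (0 < me)%N) (p_gt0 : (0 < p)%N)
  (S : lure R n m me p)
  (f_car : caratheodory_function (lf S))
  (A1 : forall t xi, 0 <= t -> im_CDe S xi -> lfibre S t xi !=set0)
  (A2 : radially_unbounded_loc_unif S)
  (A3 : forall t xi, 0 <= t -> im_CDe S xi ->
     convex_set (lf S t @` lfibre S t xi : set (convex_lmodType 'cV[R]_m)))
  (f_bnd : forall K : set 'cV[R]_p, compact K -> exists phi : R -> R,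
     [/\ forall t, 0 <= t -> 0 <= phi t,
         on_compacts (fun I : set R => (leb R).-integrable I (EFin \o phi))
           (@Rplus R) &
         forall t xi, 0 <= t -> K xi -> enorm (lf S t xi) <= phi t])
  (v : R -> 'cV[R]_me) (v_Linfty : on_compacts (Linfty v) (@Rplus R))
  (t0 : R) (t0_ge0 : 0 <= t0) (x0 : 'cV[R]_n) :
  (exists tau x y, max_pre_trajectory S t0 tau v x y /\ x t0 = x0) /\
  ((forall (tau : R) x y, max_pre_trajectory S t0 tau%:E v x y ->
     [/\ (\int[leb R]_(t in Ico t0 tau%:E)
            (enorm (lB S *m lf S t (y t)))%:E)%E = +oo%E,
         ~ Linfty y (Ico t0 tau%:E) &
         enorm (x t) @[t --> tau^'-] --> +oo]) /\
   blow_up_property S).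
Proof.
split; first exact: maximal_existence.
split; last exact: lure_blow_up.
move=> tau x y maxi; split.
- exact: (input_integral_infty f_car A1 A2 A3 f_bnd maxi).
- exact: (output_not_Linfty f_car A1 A2 A3 f_bnd maxi).
- exact: (maximal_norm_cvgy f_car A1 A2 A3 f_bnd maxi).
Qed.
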